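(* Let $V\models\mathsf{ZFC}$, let $G_0\subseteq\mathbb P=\mathrm{Add}(\omega,\omega_1)$ be $V$-generic, let $\mathcal N=\mathrm{HS}^{G_0}$ be the symmetric extension of $V$ determined by $\mathbb P$, the group $\mathcal G=\mathrm{Sym}(\omega_1)$ and the countable-support filter $\mathcal F$, let $A=\{c_\alpha:\alpha<\omega_1\}$ be the set of Cohen reals added by $G_0$, and let $S=(A^\omega)^{\mathcal N}$. Then $\mathcal N\models\mathsf{SVC}(S)$.
   Context: For a set $S$, $\mathsf{SVC}(S)$ is the statement: for every set $X$ there are an ordinal $\eta$ and a surjection $e:S\times\eta\twoheadrightarrow X$ (where, under the usual convention, the case $X=\varnothing$ is trivial, taking $\eta=0$). $\mathbb P=\mathrm{Add}(\omega,\omega_1)=\mathrm{Fn}(\omega_1\times\omega,2,{<}\omega)$ is the set of finite partial functions from $\omega_1\times\omega$ to $2$, ordered by reverse inclusion, as defined in $V$. $\mathcal G=\mathrm{Sym}(\omega_1)$ is the group of all permutations of $\omega_1$; $\pi\in\mathcal G$ acts on $\mathbb P$ by $\mathrm{dom}(\pi p)=\{(\pi(\alpha),n):(\alpha,n)\in\mathrm{dom}(p)\}$, $(\pi p)(\pi(\alpha),n)=p(\alpha,n)$, and on $\mathbb P$-names by $\pi\dot x=\{\langle\pi\dot y,\pi p\rangle:\langle\dot y,p\rangle\in\dot x\}$. For $E\subseteq\omega_1$, $\mathrm{Fix}(E)=\{\pi\in\mathcal G:\pi\restriction E=\mathrm{id}_E\}$. $\mathcal F$ is the normal filter of subgroups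 of $\mathcal G$ (closed upward, under finite intersections, and under conjugation) generated by $\{\mathrm{Fix}(E):E\in[\omega_1]^{\le\omega}\}$, where countability is computed in $V$. A name $\dot x$ is symmetric if $\mathrm{Stab}(\dot x)=\{\pi\in\mathcal G:\pi\dot x=\dot x\}\in\mathcal F$; $\dot x\in\mathrm{HS}$ if $\dot x$ is symmetric and every name appearing in $\dot x$ is in $\mathrm{HS}$. $\mathrm{HS}^{G_0}=\{\dot x^{G_0}:\dot x\in\mathrm{HS}\}$. For $\alpha<\omega_1$, $\dot c_\alpha=\{\langle\check n,p\rangle:p\in\mathbb P,\ (\alpha,n)\in\mathrm{dom}(p),\ p(\alpha,n)=1\}$ and $c_\alpha=\dot c_\alpha^{G_0}$ (identified with an element of $2^\omega$). $(A^\omega)^{\mathcal N}$ is the set of all functions $\omega\to A$ belonging to $\mathcal N$. *)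

(* Defs.v *)
From Stdlib Require Import Classical ClassicalEpsilon FunctionalExtensionality
  PropExtensionality ProofIrrelevance.

Set Implicit Arguments.
Unset Strict Implicit.
Unset Printing Implicit Defensive.

(* ------------------------------------------------------------------------- *)
(* The ambient universe, in which the transitive ground model V, the generic
   filter and the symmetric extension live: Aczel's well-founded trees modulo
   bisimulation.  A set is represented by a bisimulation class of trees, so
   that Leibniz equality is equality of sets. *)

Inductive tree : Type := node (I : Type) (c : I -> tree).

Fixpoint bisim (s t : tree) : Prop :=
  match s, t with
  | node f, node g =>
      (forall i, exists j, bisim (f i) (g j)) /\
      (forall j, exists i, bisim (f i) (g j))
  end.

Record iset : Type := ISet {
  cls : tree -> Prop;
  cls_class : exists t, forall s, cls s <-> bisim t s }.

Definition imem (x y : iset) : Prop :=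
  exists (I : Type) (c : I -> tree) (i : I), cls y (node c) /\ cls x (c i).

Lemma bisim_refl t : bisim t t.
Proof.
induction t as [I c IH]; simpl; split; intro i; exists i; apply IH.
Qed.

Lemma bisim_sym s : forall t, bisim s t -> bisim t s.
Proof.
induction s as [I c IH]; intros [J d] [H1 H2]; simpl; split.
- intro j; destruct (H2 j) as [i Hi]; exists i; auto.
- intro i; destruct (H1 i) as [j Hj]; exists j; auto.
Qed.

Lemma bisim_trans s : forall t u, bisim s t -> bisim t u -> bisim s u.
Proof.
induction s as [I c IH]; intros [J d] [K e] [H1 H2] [H3 H4]; simpl; split.
- intro i; destruct (H1 i) as [j Hj]; destruct (H3 j) as [k Hk]; exists k; eauto.
- intro k; destruct (H4 k) as [j Hj]; destruct (H2 j) as [i Hi]; exists i; eauto.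
Qed.

Definition iset_of (t : tree) : iset :=
  @ISet (bisim t) (ex_intro _ t (fun s => iff_refl (bisim t s))).

Lemma iset_eq (x y : iset) : (forall t, cls x t <-> cls y t) -> x = y.
Proof.
destruct x as [P hP], y as [Q hQ]; simpl; intro H.
assert (E : P = Q).
{ apply functional_extensionality; intro t; apply propositional_extensionality, H. }
subst Q; f_equal; apply proof_irrelevance.
Qed.

Lemma iset_repr (x : iset) : exists t, x = iset_of t.
Proof.
destruct (cls_class x) as [t Ht]; exists t; apply iset_eq; exact Ht.
Qed.

Lemma iset_of_eq s t : bisim s t -> iset_of s = iset_of t.
Proof.
intro H; apply iset_eq; intro u; simpl; split; intro K.
- exact (bisim_trans (bisim_sym H) K).
- exact (bisim_trans H K).
Qed.

Lemma imem_of x (I : Type) (c : I -> tree) :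
  imem x (iset_of (node c)) <-> exists i, x = iset_of (c i).
Proof.
split.
- intros (J & d & j & H & K); simpl in H; destruct H as [_ H].
  destruct (H j) as [i Hi]; exists i.
  destruct (iset_repr x) as [t ->]; simpl in K.
  apply iset_of_eq; exact (bisim_trans K (bisim_sym Hi)).
- intros [i ->]; exists I, c, i; split; apply bisim_refl.
Qed.

Lemma imem_ext (x y : iset) : (forall z, imem z x <-> imem z y) -> x = y.
Proof.
destruct (iset_repr x) as [[I c] ->], (iset_repr y) as [[J d] ->]; intro H.
assert (B : forall s t, iset_of s = iset_of t -> bisim s t).
{ intros s t E; change (cls (iset_of s) t); rewrite E; apply bisim_refl. }
apply iset_of_eq; simpl; split.
- intro i; destruct (proj1 (imem_of _ d)
    (proj1 (H (iset_of (c i))) (proj2 (imem_of _ c) (ex_intro _ i eq_refl))))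
    as [j Hj]; exists j; auto.
- intro j; destruct (proj1 (imem_of _ c)
    (proj2 (H (iset_of (d j))) (proj2 (imem_of _ d) (ex_intro _ j eq_refl))))
    as [i Hi]; exists i; apply bisim_sym; auto.
Qed.

Lemma imem_wf : well_founded imem.
Proof.
intro x; destruct (iset_repr x) as [t ->].
induction t as [I c IH]; constructor; intros y Hy.
apply imem_of in Hy; destruct Hy as [i ->]; apply IH.
Qed.

Lemma imem_range (I : Type) (f : I -> iset) :
  exists y, forall x, imem x y <-> exists i, x = f i.
Proof.
pose (r i := constructive_indefinite_description _ (iset_repr (f i))).
exists (iset_of (node (fun i => proj1_sig (r i)))); intro x.
split.
- intro H; apply imem_of in H; destruct H as [i ->]; exists i.
  symmetry; exact (proj2_sig (r i)).
- intros [i ->]; apply imem_of; exists i; exact (proj2_sig (r i)).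
Qed.

(* ------------------------------------------------------------------------- *)
(* Structures for the language of set theory.  All set-theoretic notions below
   are interpreted inside such a structure (their quantifiers range over it),
   so that e.g. [is_omega1] over V is the first uncountable ordinal of V. *)

Record estruct : Type := EStruct {
  dom :> Type;
  rel : dom -> dom -> Prop }.

Notation "x ∈ y" := (@rel _ x y) (at level 70, no associativity).

(* A class of the universe, as a structure with the true membership. *)
Definition class_struct (C : iset -> Prop) : estruct :=
  @EStruct (sig C) (fun x y => imem (proj1_sig x) (proj1_sig y)).

Definition transitive_class (C : iset -> Prop) : Prop :=
  forall x y, C y -> imem x y -> C x.

Section SetTheory.
Variable M : estruct.
Implicit Types (x y z u : M).

Definition subset x y : Prop := forall z, z ∈ x -> z ∈ y.
Definition is_empty x : Prop := forall z, ~ z ∈ x.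
Definition is_one x : Prop := forall z, z ∈ x <-> is_empty z.
Definition is_pair u x y : Prop := forall z, z ∈ u <-> z = x \/ z = y.
Definition is_opair u x y : Prop :=
  exists s d, is_pair s x x /\ is_pair d x y /\ is_pair u s d.
Definition is_succ y x : Prop := forall z, z ∈ y <-> z ∈ x \/ z = x.
Definition is_prod d a b : Prop :=
  forall u, u ∈ d <-> exists x y, x ∈ a /\ y ∈ b /\ is_opair u x y.

Definition app f x y : Prop := exists u, u ∈ f /\ is_opair u x y.
Definition is_fun f a b : Prop :=
  (forall u, u ∈ f -> exists x y, x ∈ a /\ y ∈ b /\ is_opair u x y) /\
  (forall x, x ∈ a -> exists! y, app f x y).
Definition is_inj f a b : Prop :=
  is_fun f a b /\ forall x x' y, app f x y -> app f x' y -> x = x'.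
Definition is_surj f a b : Prop :=
  is_fun f a b /\ forall y, y ∈ b -> exists x, app f x y.

(* Transitive and well-ordered by membership. *)
Definition is_ord a : Prop :=
  (forall x y, x ∈ y -> y ∈ a -> x ∈ a) /\
  (forall x y z, x ∈ a -> y ∈ a -> z ∈ a -> x ∈ y -> y ∈ z -> x ∈ z) /\
  (forall x y, x ∈ a -> y ∈ a -> x ∈ y \/ x = y \/ y ∈ x) /\
  (forall b, subset b a -> (exists x, x ∈ b) ->
     exists m, m ∈ b /\ forall x, x ∈ b -> ~ x ∈ m).

Definition inductive_set w : Prop :=
  (exists z, is_empty z /\ z ∈ w) /\
  (forall x, x ∈ w -> exists y, y ∈ w /\ is_succ y x).
Definition is_omega w : Prop :=
  inductive_set w /\ forall w', inductive_set w' -> subset w w'.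

Definition finite a : Prop :=
  exists w n f, is_omega w /\ n ∈ w /\ is_inj f a n.
Definition countable a : Prop := exists w f, is_omega w /\ is_inj f a w.
Definition is_omega1 k : Prop :=
  is_ord k /\ ~ countable k /\ forall a, a ∈ k -> countable a.

Definition SVC s : Prop :=
  forall x, exists eta d e,
    is_ord eta /\ is_prod d s eta /\ is_surj e d x.

(* First-order formulas, with de Bruijn indices. *)
Inductive fml : Type :=
| FMem (i j : nat)
| FEq (i j : nat)
| FBot
| FImp (A B : fml)
| FAll (A : fml).

Definition scons (x : M) (e : nat -> M) (n : nat) : M :=
  match n with 0 => x | S k => e k end.

Fixpoint sat (e : nat -> M) (A : fml) : Prop :=
  match A with
  | FMem i j => e i ∈ e j
  | FEq i j => e i = e j
  | FBot => False
  | FImp B C => sat e B -> sat e C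
  | FAll B => forall x, sat (scons x e) B
  end.

(* Separation and replacement are the first-order schemes (with parameters,
   given by the environment). *)
Record ZFC : Prop := {
  zfc_ext : forall x y, (forall z, z ∈ x <-> z ∈ y) -> x = y;
  zfc_foundation : forall x, (exists y, y ∈ x) ->
    exists y, y ∈ x /\ forall z, z ∈ x -> ~ z ∈ y;
  zfc_pairing : forall x y, exists u, is_pair u x y;
  zfc_union : forall x, exists u, forall z, z ∈ u <-> exists y, z ∈ y /\ y ∈ x;
  zfc_power : forall x, exists u, forall z, z ∈ u <-> subset z x;
  zfc_infinity : exists w, inductive_set w;
  zfc_separation : forall (A : fml) (e : nat -> M) x,
    exists u, forall z, z ∈ u <-> z ∈ x /\ sat (scons z e) A;
  zfc_replacement : forall (A : fml) (e : nat -> M) x,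
    (forall y z z', y ∈ x -> sat (scons z (scons y e)) A ->
       sat (scons z' (scons y e)) A -> z = z') ->
    exists u, forall z, z ∈ u <->
      exists y, y ∈ x /\ sat (scons z (scons y e)) A;
  zfc_choice : forall x, (forall y, y ∈ x -> exists z, z ∈ y) ->
    (forall y y' z, y ∈ x -> y' ∈ x -> z ∈ y -> z ∈ y' -> y = y') ->
    exists c, forall y, y ∈ x -> exists! z, z ∈ y /\ z ∈ c }.

End SetTheory.

(* ------------------------------------------------------------------------- *)
(* The symmetric system, in a structure V; [w] and [k] stand for the omega and
   the omega_1 of V.  The recursive operations on names (action of a
   permutation, check names, evaluation) are given by their graphs: the two
   premises of each constructor are the two inclusions of the recursive
   equation, and when membership is well-founded the inductively defined graph
   is that of the function defined by recursion. *)

Section SymmetricSystem.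
Variables (V : estruct) (w k : V).

(* t = <<a, n>, i> *)
Definition is_triple (t a n i : V) : Prop :=
  exists u, is_opair u a n /\ is_opair t u i.

(* Finite partial functions from k * w to 2; q is stronger than p when
   [subset p q], and the empty condition is the largest one. *)
Definition cond (p : V) : Prop :=
  finite p /\
  (forall t, t ∈ p -> exists a n i,
     a ∈ k /\ n ∈ w /\ (is_empty i \/ is_one i) /\ is_triple t a n i) /\
  (forall t t' a n i i', t ∈ p -> t' ∈ p ->
     is_triple t a n i -> is_triple t' a n i' -> i = i').

Definition perm (f : V) : Prop := is_inj f k k /\ is_surj f k k.

Definition is_comp (f g h : V) : Prop := (* h = f o g *)
  forall a c, app h a c <-> exists b, app g a b /\ app f b c.
Definition is_inv (f g : V) : Prop := forall a b, app g a b <-> app f b a.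
Definition is_conj (f g h : V) : Prop := (* h = f o g o f^-1 *)
  exists f' m, perm f' /\ perm m /\ perm h /\
    is_inv f f' /\ is_comp f g m /\ is_comp m f' h.

Definition subgroup (H : V) : Prop :=
  (forall f, f ∈ H -> perm f) /\
  (forall f, perm f -> (forall a, a ∈ k -> app f a a) -> f ∈ H) /\
  (forall f g h, f ∈ H -> g ∈ H -> perm h -> is_comp f g h -> h ∈ H) /\
  (forall f g, f ∈ H -> perm g -> is_inv f g -> g ∈ H).

Definition is_Fix (E H : V) : Prop :=
  forall f, f ∈ H <-> perm f /\ forall a, a ∈ E -> app f a a.

Inductive in_filter : V -> Prop :=
| filter_gen E H :
    subset E k -> countable E -> is_Fix E H -> in_filter H
| filter_up H K :
    in_filter H -> subgroup K -> subset H K -> in_filter K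
| filter_cap H K L :
    in_filter H -> in_filter K ->
    (forall f, f ∈ L <-> f ∈ H /\ f ∈ K) -> in_filter L
| filter_conj f H K :
    in_filter H -> perm f ->
    (forall h, h ∈ K <-> exists g, g ∈ H /\ is_conj f g h) -> in_filter K.

Definition cond_act (f p q : V) : Prop :=
  forall t, t ∈ q <-> exists t' a b n i,
    t' ∈ p /\ is_triple t' a n i /\ app f a b /\ is_triple t b n i.

Inductive is_name : V -> Prop :=
| is_name_intro x :
    (forall u, u ∈ x -> exists y p, is_opair u y p /\ is_name y /\ cond p) ->
    is_name x.

Inductive name_act (f : V) : V -> V -> Prop :=
| name_act_intro x x' :
    (forall u y p, u ∈ x -> is_opair u y p ->
       exists u' y' p', u' ∈ x' /\ is_opair u' y' p' /\
         name_act f y y' /\ cond_act f p p') ->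
    (forall u', u' ∈ x' -> exists u y p y' p',
       u ∈ x /\ is_opair u y p /\ is_opair u' y' p' /\
         name_act f y y' /\ cond_act f p p') ->
    name_act f x x'.

Definition symmetric (x : V) : Prop :=
  exists H, (forall f, f ∈ H <-> perm f /\ name_act f x x) /\ in_filter H.

Inductive HS : V -> Prop :=
| HS_intro x :
    is_name x -> symmetric x ->
    (forall u y p, u ∈ x -> is_opair u y p -> HS y) ->
    HS x.

Inductive is_check : V -> V -> Prop :=
| is_check_intro x x' :
    (forall y, y ∈ x -> exists u y' o,
       u ∈ x' /\ is_opair u y' o /\ is_check y y' /\ is_empty o) ->
    (forall u, u ∈ x' -> exists y y' o,
       y ∈ x /\ is_opair u y' o /\ is_check y y' /\ is_empty o) ->
    is_check x x'.

(* [c] is the canonical name of the [a]-th Cohen real. *)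
Definition is_cohen_name (a c : V) : Prop :=
  forall u, u ∈ c <-> exists n n' p t i,
    n ∈ w /\ is_check n n' /\ cond p /\
    t ∈ p /\ is_triple t a n i /\ is_one i /\ is_opair u n' p.

Record generic (G : V -> Prop) : Prop := {
  gen_cond : forall p, G p -> cond p;
  gen_inhabited : exists p, G p;
  gen_up : forall p q, G q -> cond p -> subset p q -> G p;
  gen_directed : forall p q, G p -> G q ->
    exists r, G r /\ subset p r /\ subset q r;
  gen_dense : forall D : V,
    (forall p, p ∈ D -> cond p) ->
    (forall p, cond p -> exists q, q ∈ D /\ subset p q) ->
    exists p, p ∈ D /\ G p }.

Inductive eval (G : V -> Prop) : V -> iset -> Prop :=
| eval_intro x v :
    (forall u y p, u ∈ x -> is_opair u y p -> G p ->
       exists z, imem z v /\ eval G y z) ->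
    (forall z, imem z v -> exists u y p,
       u ∈ x /\ is_opair u y p /\ G p /\ eval G y z) ->
    eval G x v.

Definition sym_ext (G : V -> Prop) : iset -> Prop :=
  fun v => exists x, HS x /\ eval G x v.

End SymmetricSystem.

(* Main.v *)
(* Every element of a set X = x^G of the symmetric extension is the value of some
   y in dom x, and y is fixed by Fix (ran a) for some sequence a : omega -> k of
   the ground model.  For a permutation f, the sequence c o f o a of Cohen reals
   determines the value of the name f y: the Cohen reals being distinct,
   c o f o a = c o g o a makes f and g agree on ran a, hence f y = g y.  Choice
   in the ground model enumerates the pairs (y, a) as (y_i, a_i) for i < eta, and
   (c o f o a_i, i) |-> (f y_i)^G then has a name fixed by every permutation.
   Cutting its values down to X and using a default value x0^G elsewhere keeps
   it hereditarily symmetric.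

   That the extension contains the set of all its sequences of Cohen reals, and
   the decision of the default case, need the forcing relation only for
   equality and membership of names.  Equality is the greatest bisimulation
   between names indexed by conditions, so that its definability is immediate. *)

Require Import Defs.
From Stdlib Require Import Classical ClassicalEpsilon FunctionalExtensionality
  PropExtensionality ProofIrrelevance Wf_nat Lia PeanoNat.

Set Implicit Arguments.
Unset Strict Implicit.
Unset Printing Implicit Defensive.

(** * First-order definability with parameters *)

Section Definability.
Variable M : estruct.
Implicit Types e : nat -> M.

(** The reals along a support have to be kept as a sequence: the mere set of reals with index in
    f[E] would determine f[E], but not f on E and hence not f y. Since the filter is generated by
    countable supports, sequences of length omega are long enough. Names and supports cannot be
    selected inside the extension, where choice may fail; the listing is made on names in V, so that
    its index set is an honest ordinal. Every name in dom x is listed with every one of its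
    supports, and f runs over the whole group: applying a permutation g merely replaces f by g o f,
    so the graph needs no support for y or a. The default name x0 is taken from dom x with a
    condition in the generic filter, which keeps its value in X. V is known only as a transitive
    class satisfying first-order ZFC. Every set of names has to be carved out by a formula, so a
    calculus of definable predicates and terms precedes the mathematics. Induction, in contrast, may
    use arbitrary properties, because membership is well-founded in the ambient universe. *)

Lemma sat_ext A : forall e e' : nat -> M,
  (forall i, e i = e' i) -> sat e A <-> sat e' A.
Proof.
induction A as [i j|i j| |A IHA B IHB|A IHA]; intros e e' H; simpl.
- now rewrite !H.
- now rewrite !H.
- tauto.
- now rewrite (IHA e e' H), (IHB e e' H).
- split; intros K x; (eapply IHA; [|apply (K x)]); intros [|i]; simpl; auto.
Qed.

Fixpoint ren (f : nat -> nat) (A : fml) : fml :=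
  match A with
  | FMem i j => FMem (f i) (f j)
  | FEq i j => FEq (f i) (f j)
  | FBot => FBot
  | FImp B C => FImp (ren f B) (ren f C)
  | FAll B => FAll (ren (fun n => match n with 0 => 0 | S m => S (f m) end) B)
  end.

Lemma sat_ren A : forall f e, sat e (ren f A) <-> sat (fun i => e (f i)) A.
Proof.
induction A as [i j|i j| |A IHA B IHB|A IHA]; intros f e; simpl; try tauto.
- now rewrite IHA, IHB.
- split; intros K x; specialize (K x); rewrite IHA in *;
    (eapply sat_ext; [|apply K]); intros [|i]; reflexivity.
Qed.

Definition slot e (s : nat + M) : M :=
  match s with inl j => e j | inr c => c end.

(* [s] assigns to each free variable of the formula an argument of the
   predicate or a parameter from M. *)
Definition Def (P : (nat -> M) -> Prop) : Prop :=
  exists A (s : nat -> nat + M), forall e, P e <-> sat (fun i => slot e (s i)) A.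

(** The language has no function symbols, so a map with values in [M] counts as definable through
    its graph: slot 0 holds the value and the later slots hold the arguments. *)
Definition DT (t : (nat -> M) -> M) : Prop :=
  Def (fun e => e 0 = t (fun n => e (S n))).

Lemma Def_ext (P Q : (nat -> M) -> Prop) :
  (forall e, P e <-> Q e) -> Def Q -> Def P.
Proof.
intros H [A [s K]]; exists A, s; intro e; now rewrite H, K.
Qed.

Lemma Def_subst (P : (nat -> M) -> Prop) (u : nat -> nat + M) :
  Def P -> Def (fun e => P (fun n => slot e (u n))).
Proof.
intros [A [s K]].
exists A, (fun i => match s i with inl j => u j | inr c => inr c end).
intro e; rewrite K; apply sat_ext; intro i; destruct (s i); reflexivity.
Qed.

(** The two formulas come with unrelated assignments of their variables. Moving the variables of one
    to the even indices and those of the other to the odd ones lets a single assignment serve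
    both. *)
Lemma Def_imp P Q : Def P -> Def Q -> Def (fun e => P e -> Q e).
Proof.
intros [A [s K]] [B [u L]].
exists (FImp (ren (fun i => 2 * i) A) (ren (fun i => S (2 * i)) B)),
  (fun i => if Nat.even i then s (Nat.div2 i) else u (Nat.div2 i)).
intro e; simpl sat; rewrite !sat_ren, K, L.
assert (E1 : forall i, slot e (if Nat.even (2 * i) then s (Nat.div2 (2 * i))
  else u (Nat.div2 (2 * i))) = slot e (s i)).
{ intro i; rewrite Nat.div2_double, Nat.even_mul; reflexivity. }
assert (E2 : forall i, slot e (if Nat.even (S (2 * i)) then s (Nat.div2 (S (2 * i)))
  else u (Nat.div2 (S (2 * i)))) = slot e (u i)).
{ intro i; rewrite Nat.div2_succ_double, Nat.even_succ, Nat.odd_mul; reflexivity. }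
rewrite (sat_ext A E1), (sat_ext B E2); tauto.
Qed.

(** Preparation for a quantifier: all variables that [s] sends to argument 0 are merged into the
    bound index 0, and the others move up by one. The entry [inl 0] left for the merged variables is
    a filler. *)
Lemma bind_sat A (s : nat -> nat + M) x e :
  sat (fun i => slot (scons x e) (s i)) A <->
  sat (scons x (fun i => slot e (match s i with inl (S j) => inl j | inl 0 => inl 0 | inr c => inr c end)))
    (ren (fun i => match s i with inl 0 => 0 | _ => S i end) A).
Proof.
rewrite sat_ren; apply sat_ext; intro i.
destruct (s i) as [[|j]|c] eqn:E; simpl; try rewrite E; reflexivity.
Qed.

Lemma Def_all (Q : (nat -> M) -> M -> Prop) :
  Def (fun e => Q (fun n => e (S n)) (e 0)) -> Def (fun e => forall x, Q e x).
Proof.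
intros [A [s K]].
exists (FAll (ren (fun i => match s i with inl 0 => 0 | _ => S i end) A)),
  (fun i => match s i with inl (S j) => inl j | inl 0 => inl 0 | inr c => inr c end).
intro e; simpl sat; split; intros H x.
- apply bind_sat, K; exact (H x).
- specialize (H x); apply bind_sat, K in H; exact H.
Qed.

(** Classically, a proposition that ignores the environment is equivalent to a fixed true or false
    sentence. Hence any metatheoretic statement about fixed objects may occur as a subformula. *)
Lemma Def_const (P : Prop) : Def (fun _ => P).
Proof.
destruct (classic P) as [H|H].
- exists (FImp FBot FBot), inl; simpl; tauto.
- exists FBot, inl; simpl; tauto.
Qed.

Lemma Def_not P : Def P -> Def (fun e => ~ P e).
Proof. intro H; apply (Def_imp H (Def_const False)). Qed.

Lemma Def_or P Q : Def P -> Def Q -> Def (fun e => P e \/ Q e).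
Proof.
intros H K; apply (@Def_ext _ (fun e => ~ P e -> Q e)).
- intro e; destruct (classic (P e)); tauto.
- apply Def_imp; [apply Def_not|]; assumption.
Qed.

Lemma Def_and P Q : Def P -> Def Q -> Def (fun e => P e /\ Q e).
Proof.
intros H K; apply (@Def_ext _ (fun e => ~ (P e -> ~ Q e))).
- intro e; destruct (classic (P e)), (classic (Q e)); tauto.
- apply Def_not, Def_imp; [|apply Def_not]; assumption.
Qed.

Lemma Def_iff P Q : Def P -> Def Q -> Def (fun e => P e <-> Q e).
Proof. intros H K; apply Def_and; apply Def_imp; assumption. Qed.

Lemma Def_ex (Q : (nat -> M) -> M -> Prop) :
  Def (fun e => Q (fun n => e (S n)) (e 0)) -> Def (fun e => exists x, Q e x).
Proof.
intro H; apply (@Def_ext _ (fun e => ~ forall x, ~ Q e x)).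
- intro e; split.
  + intros [x K] L; exact (L x K).
  + apply not_all_not_ex.
- apply Def_not, (@Def_all (fun e x => ~ Q e x)), Def_not, H.
Qed.

Lemma DT_var i : DT (fun e => e i).
Proof. exists (FEq 0 1), (fun j => match j with 0 => inl 0 | _ => inl (S i) end). simpl; tauto. Qed.

Lemma DT_const c : DT (fun _ => c).
Proof. exists (FEq 0 1), (fun j => match j with 0 => inl 0 | _ => inr c end). simpl; tauto. Qed.

(** Substituting a definable term into a relation means quantifying over its value; the variants
    with more arguments introduce one such quantifier per argument that must be renamed away. *)
Lemma Def_rel1 (R : M -> Prop) t :
  Def (fun e => R (e 0)) -> DT t -> Def (fun e => R (t e)).
Proof.
intros HR Ht; apply (@Def_ext _ (fun e => exists x, x = t e /\ R x)).
- intro e; split; [eauto|]. intros (x & -> & H); exact H.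
- apply (@Def_ex (fun e x => x = t e /\ R x)), Def_and; [exact Ht|exact HR].
Qed.

Lemma Def_rel2 (R : M -> M -> Prop) t u :
  Def (fun e => R (e 0) (e 1)) -> DT t -> DT u -> Def (fun e => R (t e) (u e)).
Proof.
intros HR Ht Hu; apply (@Def_ext _ (fun e => exists x, x = u e /\ R (t e) x)).
- intro e; split; [eauto|]. intros (x & -> & H); exact H.
- apply (@Def_ex (fun e x => x = u e /\ R (t e) x)), Def_and; [exact Hu|].
  apply (@Def_ext _ (fun e => exists x, x = t (fun n => e (S n)) /\ R x (e 0))).
  + intro e; split; [eauto|]. intros (x & -> & H); exact H.
  + apply (@Def_ex (fun e x => x = t (fun n => e (S n)) /\ R x (e 0))), Def_and.
    * exact (@Def_subst _ (fun n => inl (match n with 0 => 0 | S m => S (S m) end)) Ht).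
    * exact HR.
Qed.

Lemma Def_rel3 (R : M -> M -> M -> Prop) t u v :
  Def (fun e => R (e 0) (e 1) (e 2)) -> DT t -> DT u -> DT v ->
  Def (fun e => R (t e) (u e) (v e)).
Proof.
intros HR Ht Hu Hv; apply (@Def_ext _ (fun e => exists x, x = v e /\ R (t e) (u e) x)).
- intro e; split; [eauto|]. intros (x & -> & H); exact H.
- apply (@Def_ex (fun e x => x = v e /\ R (t e) (u e) x)), Def_and; [exact Hv|].
  apply (@Def_ext _ (fun e => exists x, x = u (fun n => e (S n)) /\ R (t (fun n => e (S n))) x (e 0))).
  + intro e; split; [eauto|]. intros (x & -> & H); exact H.
  + apply (@Def_ex (fun e x => x = u (fun n => e (S n)) /\ R (t (fun n => e (S n))) x (e 0))), Def_and.
    * exact (@Def_subst _ (fun n => inl (match n with 0 => 0 | S m => S (S m) end)) Hu).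
    * apply (@Def_ext _ (fun e => exists x, x = t (fun n => e (S (S n))) /\ R x (e 0) (e 1))).
      -- intro e; split; [eauto|]. intros (x & -> & H); exact H.
      -- apply (@Def_ex (fun e x => x = t (fun n => e (S (S n))) /\ R x (e 0) (e 1))), Def_and.
         ++ exact (@Def_subst _ (fun n => inl (match n with 0 => 0 | S m => S (S (S m)) end)) Ht).
         ++ exact HR.
Qed.

Lemma Def_rel4 (R : M -> M -> M -> M -> Prop) s t u v :
  Def (fun e => R (e 0) (e 1) (e 2) (e 3)) -> DT s -> DT t -> DT u -> DT v ->
  Def (fun e => R (s e) (t e) (u e) (v e)).
Proof.
intros HR Hs Ht Hu Hv.
apply (@Def_ext _ (fun e => exists x, x = s e /\ R x (t e) (u e) (v e))).
- intro e; split; [eauto|]. intros (x & -> & H); exact H.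
- apply (@Def_ex (fun e x => x = s e /\ R x (t e) (u e) (v e))), Def_and; [exact Hs|].
  apply (@Def_ext _ (fun e => exists x, x = t (fun n => e (S n)) /\
    R (e 0) x (u (fun n => e (S n))) (v (fun n => e (S n))))).
  + intro e; split; [eauto|]. intros (x & -> & H); exact H.
  + apply (@Def_ex (fun e x => x = t (fun n => e (S n)) /\
      R (e 0) x (u (fun n => e (S n))) (v (fun n => e (S n))))), Def_and.
    * exact (@Def_subst _ (fun n => inl (match n with 0 => 0 | S m => S (S m) end)) Ht).
    * apply (@Def_ext _ (fun e => exists x, x = u (fun n => e (S (S n))) /\
        R (e 1) (e 0) x (v (fun n => e (S (S n)))))).
      -- intro e; split; [eauto|]. intros (x & -> & H); exact H.
      -- apply (@Def_ex (fun e x => x = u (fun n => e (S (S n))) /\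
           R (e 1) (e 0) x (v (fun n => e (S (S n)))))), Def_and.
         ++ exact (@Def_subst _ (fun n => inl (match n with 0 => 0 | S m => S (S (S m)) end)) Hu).
         ++ apply (@Def_ext _ (fun e => exists x, x = v (fun n => e (S (S (S n)))) /\
              R (e 2) (e 1) (e 0) x)).
            ** intro e; split; [eauto|]. intros (x & -> & H); exact H.
            ** apply (@Def_ex (fun e x => x = v (fun n => e (S (S (S n)))) /\
                 R (e 2) (e 1) (e 0) x)), Def_and.
               --- exact (@Def_subst _ (fun n => inl (match n with 0 => 0 | S m => S (S (S (S m))) end)) Hv).
               (* The values were bound in the order of the arguments, so the last one sits at index
                  0 and the four indices come out reversed. *)
               --- exact (@Def_subst _ (fun n => inl (match n with 0 => 3 | 1 => 2 | 2 => 1 | _ => 0 end)) HR).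
Qed.

Lemma Def_mem t u : DT t -> DT u -> Def (fun e => t e ∈ u e).
Proof.
apply (@Def_rel2 (fun x y => x ∈ y)); exists (FMem 0 1), inl; simpl; tauto.
Qed.

Lemma Def_eq t u : DT t -> DT u -> Def (fun e => t e = u e).
Proof.
apply (@Def_rel2 (fun x y => x = y)); exists (FEq 0 1), inl; simpl; tauto.
Qed.

Lemma DT_fun1 (F : M -> M) t :
  DT (fun e => F (e 0)) -> DT t -> DT (fun e => F (t e)).
Proof.
intros HF Ht; unfold DT.
apply (@Def_rel2 (fun x y => x = F y) (fun e => e 0) (fun e => t (fun n => e (S n)))).
- exact HF.
- apply DT_var.
- exact (@Def_subst _ (fun n => inl (match n with 0 => 0 | S m => S (S m) end)) Ht).
Qed.

Lemma DT_fun2 (F : M -> M -> M) t u :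
  DT (fun e => F (e 0) (e 1)) -> DT t -> DT u ->
  DT (fun e => F (t e) (u e)).
Proof.
intros HF Ht Hu; unfold DT.
apply (@Def_rel3 (fun x y z => x = F y z) (fun e => e 0)
  (fun e => t (fun n => e (S n))) (fun e => u (fun n => e (S n)))).
- exact HF.
- apply DT_var.
- exact (@Def_subst _ (fun n => inl (match n with 0 => 0 | S m => S (S m) end)) Ht).
- exact (@Def_subst _ (fun n => inl (match n with 0 => 0 | S m => S (S m) end)) Hu).
Qed.

Lemma DT_fun3 (F : M -> M -> M -> M) t u v :
  DT (fun e => F (e 0) (e 1) (e 2)) -> DT t -> DT u -> DT v ->
  DT (fun e => F (t e) (u e) (v e)).
Proof.
intros HF Ht Hu Hv; unfold DT.
apply (@Def_rel4 (fun x y z z' => x = F y z z') (fun e => e 0)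
  (fun e => t (fun n => e (S n))) (fun e => u (fun n => e (S n)))
  (fun e => v (fun n => e (S n)))).
- exact HF.
- apply DT_var.
- exact (@Def_subst _ (fun n => inl (match n with 0 => 0 | S m => S (S m) end)) Ht).
- exact (@Def_subst _ (fun n => inl (match n with 0 => 0 | S m => S (S m) end)) Hu).
- exact (@Def_subst _ (fun n => inl (match n with 0 => 0 | S m => S (S m) end)) Hv).
Qed.

End Definability.

(* Extended below with the definability lemma of each new notion. *)
Ltac dhint := fail.

(** Definability is read off the shape of the predicate. The constant case comes first, so that a
    subformula free of the environment is treated as a parameter. *)
Ltac dfn :=
  cbv beta;
  lazymatch goal with
  | |- Def (fun _ => ?P) => apply Def_const
  | |- Def (fun e => @?A e /\ @?B e) => apply (@Def_and _ A B); dfn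
  | |- Def (fun e => @?A e \/ @?B e) => apply (@Def_or _ A B); dfn
  | |- Def (fun e => @?A e <-> @?B e) => apply (@Def_iff _ A B); dfn
  | |- Def (fun e => ~ @?A e) => apply (@Def_not _ A); dfn
  | |- Def (fun e => @?A e -> @?B e) => apply (@Def_imp _ A B); dfn
  | |- Def (fun e => forall x, @?Q e x) => apply (@Def_all _ Q); dfn
  | |- Def (fun e => exists x, @?Q e x) => apply (@Def_ex _ Q); dfn
  | |- Def (fun e => @?A e ∈ @?B e) => apply (@Def_mem _ A B); dfn
  | |- Def (fun e => @?A e = @?B e) => apply (@Def_eq _ A B); dfn
  | |- DT (fun e => e ?i) => apply DT_var
  | |- DT (fun _ => ?c) => apply DT_const
  | |- _ => dhint; dfn
  end.

Ltac splits := repeat match goal with |- _ /\ _ => split end.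

(** * Basic set constructions in the ground model *)

Class Ground (M : estruct) : Prop := {
  gr_zfc : ZFC M;
  gr_wf : well_founded (@rel M);
  gr_inh : inhabited M;
  (* Elements of [M] are indexed by a type of the universe in which the sets of
     the ambient universe are formed, smaller than the carrier of [M]. *)
  gr_small : forall x : M, exists (I : Type) (f : I -> M),
    forall y, y ∈ x -> exists i, y = f i }.

Section Sets.
Context {M : estruct} {gr : Ground M}.
Implicit Types (x y z u f : M) (P : M -> Prop).

Lemma ext x y : (forall z, z ∈ x <-> z ∈ y) -> x = y.
Proof. apply (zfc_ext gr_zfc). Qed.

(** Membership of the model is well-founded from outside, so [P] may be any property and not only a
    definable one. *)
Lemma mem_ind P : (forall x, (forall y, y ∈ x -> P y) -> P x) -> forall x, P x.
Proof. apply (well_founded_ind gr_wf). Qed.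

Lemma mem_irrefl x : ~ x ∈ x.
Proof. induction x as [x IH] using mem_ind; intro H; exact (IH x H H). Qed.

Lemma mem_min P x : P x -> exists m, P m /\ forall y, y ∈ m -> ~ P y.
Proof.
induction x as [x IH] using mem_ind; intro H.
destruct (classic (exists y, y ∈ x /\ P y)) as [(y & K & L)|K]; [eauto|].
exists x; split; [exact H|]. intros y Hy L; apply K; eauto.
Qed.

Definition pick P : M := epsilon gr_inh P.

Lemma pick_spec P : (exists x, P x) -> P (pick P).
Proof. apply epsilon_spec. Qed.

Lemma pick_eq P x : P x -> (forall y, P y -> y = x) -> pick P = x.
Proof. intros H K; apply K, pick_spec; eauto. Qed.

(* Junk unless [P] is the extension of a set, see [isset]. *)
Definition comp P : M := pick (fun u => forall z, z ∈ u <-> P z).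

Definition isset P : Prop := exists u, forall z, z ∈ u <-> P z.

Lemma in_comp P : isset P -> forall z, z ∈ comp P <-> P z.
Proof. apply (@pick_spec (fun u => forall z, z ∈ u <-> P z)). Qed.

Lemma comp_eq P u : (forall z, z ∈ u <-> P z) -> comp P = u.
Proof.
intro H; apply pick_eq; auto. intros y K; apply ext; intro z; now rewrite H, K.
Qed.

Lemma isset_sep P x : Def (fun e => P (e 0)) -> (forall z, P z -> z ∈ x) -> isset P.
Proof.
intros [A [s K]] B.
destruct (zfc_separation gr_zfc (ren (fun i => match s i with inl 0 => 0 | _ => S i end) A)
  (fun i => slot (fun _ => x) (match s i with inl (S j) => inl j | inl 0 => inl 0 | inr c => inr c end))
  x) as [u Hu].
exists u; intro z; rewrite Hu, <- bind_sat, <- K; simpl.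
split; [tauto|auto].
Qed.

Lemma isset_sep_in P x : Def (fun e => P (e 0)) -> isset (fun z => z ∈ x /\ P z).
Proof.
intro H; apply (@isset_sep (fun z => z ∈ x /\ P z) x); [|tauto].
apply Def_and; [dfn|exact H].
Qed.

Lemma isset_repl (R : M -> M -> Prop) x :
  Def (fun e => R (e 0) (e 1)) ->
  (forall y z z', y ∈ x -> R y z -> R y z' -> z = z') ->
  isset (fun z => exists y, y ∈ x /\ R y z).
Proof.
intros HR F.
assert (HR' : Def (fun e => R (e 1) (e 0))).
{ exact (Def_subst (fun i => inl (match i with 0 => 1 | 1 => 0 | S i => S i end)) HR). }
destruct HR' as [A [s K]].
pose (f i := match s i with inl 0 => 0 | inl 1 => 1 | _ => S (S i) end).
pose (e i := slot (fun _ => x) (match s i with inl j => inl j | inr c => inr c end)).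
assert (E : forall y z, sat (scons z (scons y e)) (ren f A) <-> R y z).
{ intros y z; rewrite sat_ren.
  specialize (K (scons z (scons y (fun _ => x)))); simpl in K; rewrite K.
  apply sat_ext; intro i; unfold f, e.
  destruct (s i) as [[|[|j]]|c] eqn:E; simpl; try rewrite E; reflexivity. }
destruct (zfc_replacement gr_zfc (A := ren f A) (e := e) (x := x)) as [u Hu].
- intros y z z'; rewrite !E; apply F.
- exists u; intro z; rewrite Hu; split; intros (y & H & L); exists y;
    (split; [exact H|]); apply E; exact L.
Qed.

Lemma isset_image (F : M -> M) x :
  DT (fun e => F (e 0)) -> isset (fun z => exists y, y ∈ x /\ z = F y).
Proof.
intro HF; apply (@isset_repl (fun y z => z = F y)); [|intros; congruence].
exact (Def_subst (fun i => inl (match i with 0 => 1 | 1 => 0 | S i => S i end)) HF).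
Qed.

(** The graph of a comprehension term is one universally quantified equivalence. This is correct
    only when the property defines a set in every environment, since [comp] is junk otherwise. *)
Lemma DT_comp (P : (nat -> M) -> M -> Prop) :
  (forall e, isset (P e)) -> Def (fun e => P (fun n => e (S n)) (e 0)) ->
  DT (fun e => comp (P e)).
Proof.
intros H K.
apply (@Def_ext _ _ (fun e => forall z, z ∈ e 0 <-> P (fun n => e (S n)) z)).
- intro e; split.
  + intros -> z; apply in_comp, H.
  + intro L; symmetry; apply comp_eq, L.
- apply (@Def_all _ (fun e z => z ∈ e 0 <-> P (fun n => e (S n)) z)).
  apply Def_iff; [dfn|].
  exact (Def_subst (fun i => inl (match i with 0 => 0 | S i => S (S i) end)) K).
Qed.

Lemma Def_swap (R : M -> M -> Prop) :
  Def (fun e => R (e 0) (e 1)) -> Def (fun e => R (e 1) (e 0)).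
Proof.
intro H; exact (Def_subst (fun i => inl (match i with 0 => 1 | 1 => 0 | S i => S i end)) H).
Qed.

Definition emp : M := comp (fun _ => False).

Lemma in_emp z : ~ z ∈ emp.
Proof.
unfold emp; rewrite in_comp; [tauto|].
destruct gr_inh as [x]; apply (isset_sep (x := x)); [dfn|tauto].
Qed.

Lemma is_empty_emp x : is_empty x <-> x = emp.
Proof.
split; [|intros -> z; apply in_emp].
intro H; apply ext; intro z; split; intro K; [destruct (H z K)|destruct (in_emp K)].
Qed.

Definition up x y : M := comp (fun z => z = x \/ z = y).

Lemma isset_up x y : isset (fun z => z = x \/ z = y).
Proof. exact (zfc_pairing gr_zfc x y). Qed.

Lemma in_up x y z : z ∈ up x y <-> z = x \/ z = y.
Proof. unfold up; rewrite in_comp; [tauto|apply isset_up]. Qed.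

Lemma DT_up (t u : (nat -> M) -> M) : DT t -> DT u -> DT (fun e => up (t e) (u e)).
Proof. apply DT_fun2; apply DT_comp; [intro; apply isset_up|dfn]. Qed.

Definition sg x : M := up x x.

Lemma in_sg x z : z ∈ sg x <-> z = x.
Proof. unfold sg; rewrite in_up; tauto. Qed.

Definition op x y : M := up (sg x) (up x y).

Lemma is_pair_up u x y : is_pair u x y <-> u = up x y.
Proof.
split; [|intros ->; exact (in_up x y)].
intro H; apply ext; intro z; now rewrite in_up, (H z).
Qed.

Lemma is_opair_op u x y : is_opair u x y <-> u = op x y.
Proof.
unfold is_opair; split.
- intros (s & d & H & K & L); rewrite is_pair_up in *; subst; reflexivity.
- intros ->; exists (sg x), (up x y); rewrite !is_pair_up; auto.
Qed.

Lemma sg_inj x y : sg x = sg y -> x = y.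
Proof. intro H; apply in_sg; rewrite <- H; apply in_sg; reflexivity. Qed.

Lemma up_inj_r x y y' : up x y = up x y' -> y = y'.
Proof.
intro H.
assert (K : y ∈ up x y') by (rewrite <- H; apply in_up; auto).
assert (L : y' ∈ up x y) by (rewrite H; apply in_up; auto).
rewrite in_up in K, L; intuition congruence.
Qed.

Lemma op_inj x y x' y' : op x y = op x' y' -> x = x' /\ y = y'.
Proof.
intro H.
assert (E : x = x').
{ assert (K : sg x ∈ op x' y') by (rewrite <- H; apply in_up; auto).
  apply in_up in K; destruct K as [K|K]; [now apply sg_inj|].
  symmetry; apply in_sg; rewrite K; apply in_up; auto. }
subst x'; split; [reflexivity|].
apply up_inj_r in H; now apply up_inj_r in H.
Qed.

Lemma DT_op (t u : (nat -> M) -> M) : DT t -> DT u -> DT (fun e => op (t e) (u e)).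
Proof. intros H K; repeat apply DT_up; assumption. Qed.

Lemma DT_sg (t : (nat -> M) -> M) : DT t -> DT (fun e => sg (t e)).
Proof. intros H; repeat apply DT_up; assumption. Qed.

Definition un x : M := comp (fun z => exists y, z ∈ y /\ y ∈ x).

Lemma isset_un x : isset (fun z => exists y, z ∈ y /\ y ∈ x).
Proof. exact (zfc_union gr_zfc x). Qed.

Lemma in_un x z : z ∈ un x <-> exists y, z ∈ y /\ y ∈ x.
Proof. unfold un; rewrite in_comp; [tauto|apply isset_un]. Qed.

Lemma DT_un (t : (nat -> M) -> M) : DT t -> DT (fun e => un (t e)).
Proof. apply DT_fun1; apply DT_comp; [intro; apply isset_un|dfn]. Qed.

Definition cup x y : M := un (up x y).

Lemma in_cup x y z : z ∈ cup x y <-> z ∈ x \/ z ∈ y.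
Proof.
unfold cup; rewrite in_un; split.
- intros (a & H & K); rewrite in_up in K; intuition congruence.
- intros [H|H]; [exists x|exists y]; rewrite in_up; auto.
Qed.

Lemma DT_cup (t u : (nat -> M) -> M) : DT t -> DT u -> DT (fun e => cup (t e) (u e)).
Proof. intros H K; apply DT_un, DT_up; assumption. Qed.

Definition suc x : M := cup x (sg x).

Lemma in_suc x z : z ∈ suc x <-> z ∈ x \/ z = x.
Proof. unfold suc; now rewrite in_cup, in_sg. Qed.

Lemma DT_suc (t : (nat -> M) -> M) : DT t -> DT (fun e => suc (t e)).
Proof. intro H; apply DT_cup; [|apply DT_sg]; assumption. Qed.

Lemma is_succ_suc y x : is_succ y x <-> y = suc x.
Proof.
split; [|intros ->; exact (in_suc x)].
intro H; apply ext; intro z; now rewrite in_suc, (H z).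
Qed.

Definition pow x : M := comp (fun z => subset z x).

Lemma in_pow x z : z ∈ pow x <-> subset z x.
Proof. unfold pow; rewrite in_comp; [tauto|exact (zfc_power gr_zfc x)]. Qed.

Definition prod x y : M := comp (fun u => exists a b, a ∈ x /\ b ∈ y /\ u = op a b).

Ltac dhint ::=
  lazymatch goal with
  | |- DT (fun e => op _ _) => apply DT_op
  | |- DT (fun e => up _ _) => apply DT_up
  | |- DT (fun e => sg _) => apply DT_sg
  | |- DT (fun e => cup _ _) => apply DT_cup
  | |- DT (fun e => suc _) => apply DT_suc
  | |- DT (fun e => un _) => apply DT_un
  end.

Lemma isset_prod x y : isset (fun u => exists a b, a ∈ x /\ b ∈ y /\ u = op a b).
Proof.
apply (isset_sep (x := pow (pow (cup x y)))); [dfn|].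
intros z (a & b & Ha & Hb & ->); apply in_pow; intros s Hs; apply in_pow; intros t Ht.
apply in_up in Hs; destruct Hs as [->| ->]; apply in_cup.
- apply in_sg in Ht; subst; auto.
- apply in_up in Ht; destruct Ht; subst; auto.
Qed.

Lemma in_prod x y u : u ∈ prod x y <-> exists a b, a ∈ x /\ b ∈ y /\ u = op a b.
Proof. unfold prod; rewrite in_comp; [tauto|apply isset_prod]. Qed.

Lemma in_prod_op x y a b : op a b ∈ prod x y <-> a ∈ x /\ b ∈ y.
Proof.
rewrite in_prod; split; [|intros []; eauto 6].
intros (a' & b' & H & K & E); apply op_inj in E; destruct E; subst; auto.
Qed.

Lemma DT_prod (t u : (nat -> M) -> M) : DT t -> DT u -> DT (fun e => prod (t e) (u e)).
Proof. apply DT_fun2; apply DT_comp; [intro; apply isset_prod|dfn]. Qed.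

Definition trans x : Prop := forall y z, y ∈ x -> z ∈ y -> z ∈ x.

Definition tc x : M := comp (fun z => forall t, trans t -> subset x t -> z ∈ t).

Lemma Def_tc_graph : Def (fun e : nat -> M => forall z, z ∈ e 0 <->
  forall t, trans t -> subset (e 1) t -> z ∈ t).
Proof. unfold trans, subset; dfn. Qed.

(** By induction the closures of the elements of [x] exist, and replacement gathers them into a set
    [c]; the closure of [x] is then separated from [x] together with the union of [c]. The graph is
    spelled out because the definability of [tc] itself depends on this lemma. *)
Lemma isset_tc x : isset (fun z => forall t, trans t -> subset x t -> z ∈ t).
Proof.
induction x as [x IH] using mem_ind.
assert (S0 : isset (fun v => exists y, y ∈ x /\
  forall z, z ∈ v <-> forall t, trans t -> subset y t -> z ∈ t)).
{ apply (@isset_repl (fun y v => forall z, z ∈ v <-> forall t, trans t -> subset y t -> z ∈ t)).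
  - apply Def_swap with (R := fun v y => forall z, z ∈ v <-> forall t, trans t -> subset y t -> z ∈ t).
    apply Def_tc_graph.
  - intros y z z' _ H K; apply ext; intro t; now rewrite H, K. }
destruct S0 as [c Hc].
apply (isset_sep (x := cup x (un c))); [unfold trans, subset; dfn|].
intros z Hz; apply Hz.
- intros y u Hy Hu; apply in_cup; right; apply in_un.
  apply in_cup in Hy; destruct Hy as [Hy|Hy].
  + destruct (IH y Hy) as [v Hv]; exists v; split.
    * apply Hv; intros t _ Ht; auto.
    * apply Hc; eauto.
  + apply in_un in Hy; destruct Hy as (v & Hy & K); exists v; split; [|exact K].
    apply Hc in K; destruct K as (y' & L & K); rewrite K in *.
    intros t Ht Ht'; exact (Ht y u (Hy t Ht Ht') Hu).
- intros y Hy; apply in_cup; auto.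
Qed.

Lemma in_tc x z : z ∈ tc x <-> forall t, trans t -> subset x t -> z ∈ t.
Proof. unfold tc; rewrite in_comp; [tauto|apply isset_tc]. Qed.

Lemma DT_tc (t : (nat -> M) -> M) : DT t -> DT (fun e => tc (t e)).
Proof. apply DT_fun1; apply DT_comp; [intro; apply isset_tc|unfold trans, subset; dfn]. Qed.

Lemma tc_sub x y : y ∈ x -> y ∈ tc x.
Proof. intro H; apply in_tc; auto. Qed.

Lemma tc_trans x : trans (tc x).
Proof.
intros y z Hy Hz; apply in_tc; intros t Ht Hx.
rewrite in_tc in Hy; eauto.
Qed.

Lemma tc_min x t : trans t -> subset x t -> subset (tc x) t.
Proof. intros H K z Hz; rewrite in_tc in Hz; auto. Qed.

Lemma tc_mono x y : y ∈ tc x -> subset (tc y) (tc x).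
Proof.
intro H; apply tc_min; [apply tc_trans|].
intros z Hz; exact (tc_trans H Hz).
Qed.

(** Recursion on names descends to first components of ordered pairs, which lie in the transitive
    closure of the name but in general not in the name. Hence induction along [tc] instead of
    membership. *)
Lemma tc_ind P : (forall x, (forall y, y ∈ tc x -> P y) -> P x) -> forall x, P x.
Proof.
intros H x; apply H.
induction x as [x IH] using mem_ind; intros y Hy.
(* The members of [tc x] that equal an element of [x] or lie in the closure of one form a transitive
   set including [x], and so exhaust [tc x]. *)
assert (K : exists z, z ∈ x /\ (y = z \/ y ∈ tc z)).
{ apply NNPP; intro N.
  pose (Q := fun z => exists a, a ∈ x /\ (z = a \/ z ∈ tc a)).
  destruct (@isset_sep (fun z => z ∈ tc x /\ Q z) (tc x)) as [t Ht].
  - unfold Q; pose proof DT_tc.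
    apply Def_and; [dfn|].
    apply (@Def_ex M (fun e a => a ∈ x /\ (e 0 = a \/ e 0 ∈ tc a))).
    apply Def_and; [dfn|]. apply Def_or; [dfn|]. apply Def_mem; [dfn|apply DT_tc; dfn].
  - tauto.
  - apply N; cut (y ∈ t); [intro Y; apply Ht in Y; exact (proj2 Y)|].
    apply (proj1 (in_tc x y) Hy t).
    + intros u v Hu Hv; apply Ht in Hu; destruct Hu as (L & a & La & U); apply Ht.
      split; [exact (tc_trans L Hv)|exists a; split; [exact La|right]].
      destruct U as [->|U]; [apply tc_sub; auto|exact (tc_trans U Hv)].
    + intros u Hu; apply Ht; split; [apply tc_sub; auto|exists u; auto]. }
destruct K as (z & Hz & [->|K]); [|eauto].
apply H, IH, Hz.
Qed.

Lemma tc_irrefl x : ~ x ∈ tc x.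
Proof. induction x as [x IH] using tc_ind; intro H; exact (IH x H H). Qed.

(* The union makes [ap] definable without assuming that [f] is functional. *)
Definition ap f x : M := comp (fun z => exists y, op x y ∈ f /\ z ∈ y).

Lemma isset_ap f x : isset (fun z => exists y, op x y ∈ f /\ z ∈ y).
Proof.
apply (isset_sep (x := un (un (un f)))); [dfn|].
intros z (y & H & K); apply in_un; exists y; split; [exact K|].
apply in_un; exists (up x y); split; [apply in_up; auto|].
apply in_un; exists (op x y); split; [apply in_up; auto|exact H].
Qed.

Lemma ap_eq f x y : op x y ∈ f -> (forall z, op x z ∈ f -> z = y) -> ap f x = y.
Proof.
intros H K; apply comp_eq; intro z; split; [eauto|].
intros (a & L & Hz); rewrite (K a L) in Hz; exact Hz.
Qed.

Lemma DT_ap (s t : (nat -> M) -> M) : DT s -> DT t -> DT (fun e => ap (s e) (t e)).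
Proof. apply DT_fun2; apply DT_comp; [intro; apply isset_ap|dfn]. Qed.

Definition pr1 u : M := pick (fun x => exists y, u = op x y).
Definition pr2 u : M := pick (fun y => exists x, u = op x y).

Lemma pr1_op x y : pr1 (op x y) = x.
Proof.
apply pick_eq; [eauto|]. intros a [b H]; apply op_inj in H; destruct H; auto.
Qed.

Lemma pr2_op x y : pr2 (op x y) = y.
Proof.
apply pick_eq; [eauto|]. intros a [b H]; apply op_inj in H; destruct H; auto.
Qed.

(* When nothing satisfies [P], the value of [pick] is a constant independent of
   [P], so the graph stays definable. *)
Lemma DT_pick (P : (nat -> M) -> M -> Prop) :
  Def (fun e => P (fun n => e (S n)) (e 0)) ->
  (forall e y z, P e y -> P e z -> y = z) ->
  DT (fun e => pick (P e)).
Proof.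
intros H U.
pose (c := pick (fun _ => False)).
apply (@Def_ext _ _ (fun e => P (fun n => e (S n)) (e 0) \/
  (~ exists y, P (fun n => e (S n)) y) /\ e 0 = c)).
- intro e; set (e' := fun n => e (S n)); split.
  + intros ->; destruct (classic (exists y, P e' y)) as [K|K].
    * left; apply pick_spec, K.
    * right; split; [exact K|]. unfold c; f_equal.
      apply functional_extensionality; intro y; apply propositional_extensionality.
      split; [intro L; apply K; eauto|tauto].
  + intros [K|[K ->]].
    * symmetry; apply pick_eq; [exact K|intros y L; exact (U e' _ _ L K)].
    * unfold c; f_equal.
      apply functional_extensionality; intro y; apply propositional_extensionality.
      split; [tauto|intro L; apply K; eauto].
- apply Def_or; [exact H|]. apply Def_and; [|dfn].
  apply Def_not, (@Def_ex _ (fun e y => P (fun n => e (S n)) y)).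
  exact (Def_subst (fun i => inl (match i with 0 => 0 | S i => S (S i) end)) H).
Qed.

Lemma DT_pr1 (t : (nat -> M) -> M) : DT t -> DT (fun e => pr1 (t e)).
Proof.
apply DT_fun1; apply (@DT_pick (fun e x => exists y, e 0 = op x y)); [dfn|].
intros e y z [a H] [b K]; rewrite H in K; apply op_inj in K; tauto.
Qed.

Lemma DT_pr2 (t : (nat -> M) -> M) : DT t -> DT (fun e => pr2 (t e)).
Proof.
apply DT_fun1; apply (@DT_pick (fun e x => exists y, e 0 = op y x)); [dfn|].
intros e y z [a H] [b K]; rewrite H in K; apply op_inj in K; tauto.
Qed.

End Sets.

Ltac dhintB :=
  lazymatch goal with
  | |- DT (fun e => op _ _) => apply DT_op
  | |- DT (fun e => up _ _) => apply DT_up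
  | |- DT (fun e => sg _) => apply DT_sg
  | |- DT (fun e => cup _ _) => apply DT_cup
  | |- DT (fun e => suc _) => apply DT_suc
  | |- DT (fun e => un _) => apply DT_un
  | |- DT (fun e => prod _ _) => apply DT_prod
  | |- DT (fun e => tc _) => apply DT_tc
  | |- DT (fun e => ap _ _) => apply DT_ap
  | |- DT (fun e => pr1 _) => apply DT_pr1
  | |- DT (fun e => pr2 _) => apply DT_pr2
  | |- Def (fun e => subset _ _) => unfold subset
  | |- Def (fun e => trans _) => unfold trans
  end.
Ltac dhint ::= dhintB.

(** * Definable recursion along transitive closures *)

Section Recursion.
Context {M : estruct} {gr : Ground M}.
Implicit Types (x y z u f : M) (P : M -> Prop).

Definition restr (F : M -> M) x : M :=
  comp (fun u => exists y, y ∈ tc x /\ u = op y (F y)).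

Lemma in_restr (F : M -> M) x u : DT (fun e => F (e 0)) ->
  u ∈ restr F x <-> exists y, y ∈ tc x /\ u = op y (F y).
Proof.
intro H; unfold restr; rewrite in_comp; [tauto|].
apply (@isset_image _ _ (fun y => op y (F y))).
apply DT_op; [dfn|exact H].
Qed.

Lemma ap_restr (F : M -> M) x y : DT (fun e => F (e 0)) -> y ∈ tc x ->
  ap (restr F x) y = F y.
Proof.
intros H K; apply ap_eq.
- apply in_restr; eauto.
- intros z L; apply in_restr in L; [|exact H]. destruct L as (a & _ & E).
  apply op_inj in E; destruct E; subst; reflexivity.
Qed.

Definition rel_res (g a : M) : M :=
  comp (fun u => u ∈ g /\ exists y, y ∈ a /\ exists z, u = op y z).

Lemma in_rel_res g a u :
  u ∈ rel_res g a <-> u ∈ g /\ exists y, y ∈ a /\ exists z, u = op y z.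
Proof.
unfold rel_res; rewrite in_comp; [tauto|]. apply isset_sep_in; dfn.
Qed.

Lemma DT_rel_res (t s : (nat -> M) -> M) :
  DT t -> DT s -> DT (fun e => rel_res (t e) (s e)).
Proof.
apply DT_fun2, DT_comp; [|dfn]. intro e; apply isset_sep_in; dfn.
Qed.

Variable Phi : M -> M -> M -> M.
Hypothesis HPhi : DT (fun e => Phi (e 0) (e 1) (e 2)).

(** A partial solution on a transitive set [d]; only pairs with first entry in [d] are constrained.
    A recursive call sees [g] on the whole closure of [y], as recursion on names requires. *)
Definition attempt p d g : Prop :=
  trans d /\ forall y z, y ∈ d -> (op y z ∈ g <-> z = Phi p y (rel_res g (tc y))).

Definition rec_rel p x z : Prop :=
  exists d g, attempt p d g /\ x ∈ d /\ op x z ∈ g.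

Ltac dhint ::=
  lazymatch goal with
  | |- DT (fun e => Phi _ _ _) => apply (DT_fun3 HPhi)
  | |- DT (fun e => rel_res _ _) => apply DT_rel_res
  | |- _ => dhintB
  end.

Lemma Def_rec_rel : Def (fun e => rec_rel (e 0) (e 1) (e 2)).
Proof. unfold rec_rel, attempt, trans; dfn. Qed.

Lemma attempt_res p d g d' g' : attempt p d g -> attempt p d' g' ->
  forall x, x ∈ d -> x ∈ d' -> rel_res g (tc x) = rel_res g' (tc x).
Proof.
intros [T H] [T' H'].
assert (S1 : forall x, x ∈ d -> subset (tc x) d).
{ intros x Hx; apply tc_min; [exact T|]. intros y Hy; exact (T x y Hx Hy). }
assert (S2 : forall x, x ∈ d' -> subset (tc x) d').
{ intros x Hx; apply tc_min; [exact T'|]. intros y Hy; exact (T' x y Hx Hy). }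
intro x; induction x as [x IH] using tc_ind; intros K K'.
apply ext; intro u; rewrite !in_rel_res; split; intros (L & y & Hy & z & ->);
  (split; [|eauto]).
- apply H'; [exact (S2 _ K' _ Hy)|]. rewrite <- IH; auto.
  + apply H; [exact (S1 _ K _ Hy)|exact L].
  + exact (S1 _ K _ Hy).
  + exact (S2 _ K' _ Hy).
- apply H; [exact (S1 _ K _ Hy)|]. rewrite IH; auto.
  + apply H'; [exact (S2 _ K' _ Hy)|exact L].
  + exact (S1 _ K _ Hy).
  + exact (S2 _ K' _ Hy).
Qed.

Lemma rec_rel_unique p x z z' : rec_rel p x z -> rec_rel p x z' -> z = z'.
Proof.
intros (d & g & H & K & L) (d' & g' & H' & K' & L').
apply (proj2 H) in L; [|exact K]. apply (proj2 H') in L'; [|exact K'].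
rewrite L, L'; f_equal; eapply attempt_res; eassumption.
Qed.

(** Values on [tc x] exist by induction and are unique, so replacement collects them into [g0].
    Adding the pair of [x] and [Phi p x g0] produces an attempt on [tc x] with [x] adjoined. *)
Lemma rec_rel_total p x : exists z, rec_rel p x z.
Proof.
induction x as [x IH] using tc_ind.
destruct (@isset_repl _ _ (fun y u => exists z, u = op y z /\ rec_rel p y z) (tc x)) as [g0 Hg0].
{ apply (@Def_ex M (fun e z => e 1 = op (e 0) z /\ rec_rel p (e 0) z)); apply Def_and; [dfn|].
  apply (Def_rel3 Def_rec_rel); dfn. }
{ intros y u u' _ (z & -> & H) (z' & -> & H'); f_equal; eapply rec_rel_unique; eassumption. }
assert (G0 : forall y z, op y z ∈ g0 <-> y ∈ tc x /\ rec_rel p y z).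
{ intros y z; rewrite Hg0; split.
  - intros (y' & H & z' & E & K); apply op_inj in E; destruct E; subst; auto.
  - intros [H K]; eauto. }
set (z0 := Phi p x g0).
set (g := cup g0 (sg (op x z0))).
assert (G1 : forall y z, op y z ∈ g <-> y ∈ tc x /\ rec_rel p y z \/ y = x /\ z = z0).
{ intros y z; unfold g; rewrite in_cup, in_sg, G0; split; intros [H|H]; auto.
  - apply op_inj in H; auto.
  - destruct H; subst; auto. }
exists z0, (cup (tc x) (sg x)), g.
split; [split|split].
- intros y z Hy Hz; apply in_cup in Hy; apply in_cup; left.
  destruct Hy as [Hy|Hy]; [exact (tc_trans Hy Hz)|].
  apply in_sg in Hy; subst y; apply tc_sub, Hz.
- intros y z Hy; apply in_cup in Hy; rewrite G1; destruct Hy as [Hy|Hy].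
  + assert (Nx : y <> x) by (intros ->; exact (tc_irrefl Hy)).
    destruct (IH y Hy) as [v Hv].
    assert (E : rec_rel p y z <-> z = v).
    { split; [intro K; eapply rec_rel_unique; eassumption|intros ->; exact Hv]. }
    rewrite E.
    destruct Hv as (d & g' & A & Hd & Hg).
    (* The values in [g] may stem from different attempts, but any two attempts agree on closures,
       so below [y] they coincide with those of [g']. *)
    assert (R : rel_res g (tc y) = rel_res g' (tc y)).
    { apply ext; intro u; rewrite !in_rel_res; split; intros (L & a & Ha & b & ->);
        (split; [|eauto]).
      - apply G1 in L; destruct L as [[L1 L2]|[-> _]].
        + assert (Had : a ∈ d).
          { apply (@tc_min _ _ y d (proj1 A)); [|exact Ha].
            intros c Hc; exact (proj1 A _ _ Hd Hc). }
          destruct L2 as (d2 & g2 & A2 & H2 & K2).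
          apply (proj2 A); [exact Had|]. apply (proj2 A2) in K2; [|exact H2].
          rewrite K2; f_equal; eapply attempt_res; eassumption.
        + destruct (tc_irrefl (tc_mono Hy Ha)).
      - apply G1; left; split; [exact (tc_mono Hy Ha)|].
        exists d, g'; split; [exact A|split; [|exact L]].
        apply (@tc_min _ _ y d (proj1 A)); [|exact Ha].
        intros c Hc; exact (proj1 A _ _ Hd Hc). }
    rewrite R. apply (proj2 A) in Hg; [|exact Hd]. rewrite <- Hg.
    intuition.
  + apply in_sg in Hy; subst y.
    assert (R : rel_res g (tc x) = g0).
    { apply ext; intro u; rewrite in_rel_res; split.
      - intros (L & a & Ha & b & ->); apply G1 in L; destruct L as [L|[-> _]].
        + apply G0, L.
        + destruct (tc_irrefl Ha).
      - intro L; split; [apply in_cup; auto|].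
        apply Hg0 in L; destruct L as (a & Ha & b & -> & _); eauto. }
    rewrite R; fold z0; split; [|auto].
    intros [[H _]|[_ H]]; [destruct (tc_irrefl H)|exact H].
- apply in_cup; right; apply in_sg; reflexivity.
- apply G1; auto.
Qed.

(** The parameter remains an argument of [H], so that the solution is definable jointly in both; for
    the action on names the parameter is the permutation. *)
Theorem recursion : exists H : M -> M -> M,
  DT (fun e => H (e 0) (e 1)) /\
  forall p x, H p x = Phi p x (restr (H p) x).
Proof.
pose (H p x := pick (rec_rel p x)).
assert (S1 : forall p x, rec_rel p x (H p x)).
{ intros p x; apply pick_spec, rec_rel_total. }
assert (S2 : DT (fun e => H (e 0) (e 1))).
{ apply DT_pick; [apply (Def_rel3 Def_rec_rel); dfn|].
  intros e y z; apply rec_rel_unique. }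
assert (S3 : forall p, DT (fun e => H p (e 0))).
{ intro p; apply (DT_fun2 S2); dfn. }
exists H; split; [exact S2|]. intros p x.
destruct (S1 p x) as (d & g & A & K & L).
apply (proj2 A) in L; [|exact K].
rewrite L at 1; f_equal; apply ext; intro u.
rewrite in_rel_res, in_restr; [|apply S3].
assert (D : forall y, y ∈ tc x -> y ∈ d).
{ apply (tc_min (proj1 A)); intros y Hy; exact (proj1 A _ _ K Hy). }
split.
- intros (U & y & Hy & z & ->); exists y; split; [exact Hy|]. f_equal.
  apply rec_rel_unique with p y; [|apply S1]. exists d, g; auto.
- intros (y & Hy & ->); split; [|eauto].
  destruct (rec_rel_total p y) as [z Hz].
  assert (E : H p y = Phi p y (rel_res g (tc y))).
  { destruct (S1 p y) as (d' & g' & A' & K' & L').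
    apply (proj2 A') in L'; [|exact K']. rewrite L'; f_equal.
    eapply attempt_res; eauto. }
  apply (proj2 A); auto.
Qed.

End Recursion.

Ltac dhint ::= dhintB.

(** * The natural numbers of the model are standard *)

Section Naturals.
Context {M : estruct} {gr : Ground M}.
Implicit Types (x y z u f : M) (P : M -> Prop).

Fixpoint num (n : nat) : M := match n with 0 => emp | S n => suc (num n) end.

Lemma inductive_iff x :
  inductive_set x <-> emp ∈ x /\ forall y, y ∈ x -> suc y ∈ x.
Proof.
unfold inductive_set; split.
- intros [(z & E & K) H]; apply is_empty_emp in E; subst z; split; [exact K|].
  intros y Hy; destruct (H y Hy) as (s & K' & E); apply is_succ_suc in E; subst; auto.
- intros [K H]; split; [exists emp; split; [apply is_empty_emp; reflexivity|exact K]|].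
  intros y Hy; exists (suc y); split; [auto|exact (in_suc y)].
Qed.

Lemma Def_inductive (t : (nat -> M) -> M) : DT t -> Def (fun e => inductive_set (t e)).
Proof.
intro H; apply (@Def_ext _ _ (fun e => emp ∈ t e /\ forall y, y ∈ t e -> suc y ∈ t e)).
- intro e; apply inductive_iff.
- apply (@Def_rel1 M (fun x => emp ∈ x /\ forall y, y ∈ x -> suc y ∈ x)); [dfn|exact H].
Qed.

Lemma omega_exists : exists w : M, is_omega w.
Proof.
destruct (zfc_infinity gr_zfc) as [x Hx].
destruct (@isset_sep _ _ (fun z => forall w, inductive_set w -> z ∈ w) x) as [w Hw].
- apply (@Def_all M (fun e w => inductive_set w -> e 0 ∈ w)).
  apply Def_imp; [apply Def_inductive; dfn|dfn].
- auto.
- exists w; split.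
  + apply inductive_iff; split.
    * apply Hw; intros v Hv; apply inductive_iff in Hv; apply Hv.
    * intros y Hy; apply Hw; intros v Hv.
      pose proof (proj1 (Hw y) Hy v Hv); apply inductive_iff in Hv; apply Hv; auto.
  + intros v Hv z Hz; exact (proj1 (Hw z) Hz v Hv).
Qed.

(** Well-foundedness gives a minimal element [m] of [w] that is no numeral. It is neither empty nor
    the successor of an element of [w], so removing it leaves an inductive set, against the
    minimality of [w]. *)
Lemma in_omega w : is_omega w -> forall z, z ∈ w <-> exists n, z = num n.
Proof.
intros [I H] z; pose proof I as I'; apply inductive_iff in I'; destruct I' as [I0 I1].
split.
- intro Hz; apply NNPP; intro N.
  destruct (@mem_min _ _ (fun m => m ∈ w /\ ~ exists n, m = num n) z) as (m & [Hm Nm] & L); auto.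
  destruct (@isset_sep_in _ _ (fun y => y <> m) w) as [v Hv]; [dfn|].
  assert (K : inductive_set v).
  { apply inductive_iff; split.
    - apply Hv; split; [exact I0|intros <-; apply Nm; exists 0; reflexivity].
    - intros y Hy; apply Hv in Hy; destruct Hy as [Hy E]; apply Hv; split; [auto|].
      intros E'; apply (L y); [rewrite <- E'; apply in_suc; auto|].
      split; [exact Hy|]. intros [n ->]; apply Nm; exists (S n); auto. }
  destruct (proj1 (Hv m) (H v K m Hm)) as [_ E]; auto.
- intros [n ->]; induction n; simpl; auto.
Qed.

Definition om : M := pick (@is_omega M).

Lemma om_omega : is_omega om.
Proof. exact (pick_spec omega_exists). Qed.

Lemma in_om z : z ∈ om <-> exists n, z = num n.
Proof. apply in_omega, om_omega. Qed.

Lemma num_om n : num n ∈ om.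
Proof. apply in_om; eauto. Qed.

Lemma is_omega_iff w : is_omega w <-> w = om.
Proof.
split; [|intros ->; exact om_omega].
intro H; apply ext; intro z; now rewrite (in_omega H), in_om.
Qed.

Lemma in_num n z : z ∈ num n <-> exists m, m < n /\ z = num m.
Proof.
induction n as [|n IH]; simpl.
- split; [intro H; destruct (in_emp H)|intros (m & H & _); lia].
- rewrite in_suc, IH; split.
  + intros [(m & H & ->)| ->]; [exists m|exists n]; split; auto; lia.
  + intros (m & H & ->); destruct (Nat.eq_dec m n) as [->|N]; [auto|left; exists m; split; auto; lia].
Qed.

Lemma num_inj m n : num m = num n -> m = n.
Proof.
assert (W : forall a b, a < b -> num a <> num b).
{ intros a b H E; apply (mem_irrefl (x := num b)).
  rewrite <- E at 1; apply in_num; eauto. }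
intro E; destruct (Nat.lt_trichotomy m n) as [H|[H|H]]; auto.
- destruct (W _ _ H E).
- destruct (W _ _ H (eq_sym E)).
Qed.

Lemma isset_double x g :
  isset (fun z => exists y, y ∈ x /\ z ∈ suc (suc (ap g y))).
Proof.
destruct (@isset_image _ _ (fun y => suc (suc (ap g y))) x) as [v Hv].
{ apply DT_suc, DT_suc, DT_ap; dfn. }
exists (un v); intro z; rewrite in_un; split.
- intros (y & H & K); apply Hv in K; destruct K as (a & K & ->); eauto.
- intros (y & H & K); exists (suc (suc (ap g y))); split; [exact K|apply Hv; eauto].
Qed.

(** [D x] is the union of the sets [suc (suc (D y))] for [y] in [x]: on numerals this is doubling,
    2n being the supremum of 2i + 2 over i < n. It serves to interleave two sequences definably. *)
Lemma double_exists : exists D : M -> M, DT (fun e => D (e 0)) /\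
  forall n, D (num n) = num (2 * n).
Proof.
destruct (@recursion _ _ (fun _ x g => comp (fun z => exists y, y ∈ x /\ z ∈ suc (suc (ap g y)))))
  as (H & H1 & H2).
{ apply DT_comp; [intro e; apply isset_double|dfn]. }
assert (H3 : DT (fun e => H emp (e 0))) by (apply (DT_fun2 H1); dfn).
exists (H emp); split; [exact H3|].
intro n; induction n as [n IH] using lt_wf_ind.
rewrite H2; apply comp_eq; intro z; rewrite in_num; split.
- intros (m & Hm & ->).
  (* A number [m] below 2n is below 2i + 2 for i its rounded half, and this i is below n. *)
  pose (i := Nat.div2 m).
  assert (Hi : i < n) by (pose proof (Nat.div2_odd m); unfold i; destruct (Nat.odd m); simpl in *; lia).
  exists (num i); split; [apply in_num; eauto|].
  rewrite ap_restr, IH; auto; [|apply tc_sub, in_num; eauto].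
  change (num m ∈ num (S (S (2 * i)))); apply in_num; exists m; split; auto.
  pose proof (Nat.div2_odd m); unfold i; destruct (Nat.odd m); simpl in *; lia.
- intros (y & Hy & K); pose proof (tc_sub Hy) as T.
  apply in_num in Hy; destruct Hy as (i & Hi & ->).
  rewrite ap_restr, IH in K; auto.
  change (z ∈ num (S (S (2 * i)))) in K; apply in_num in K; destruct K as (m & Hm & ->).
  exists m; split; auto; lia.
Qed.

End Naturals.

(** * Ordinals, choice functions and well-ordering *)

Section Ordinals.
Context {M : estruct} {gr : Ground M}.
Implicit Types (x y z u f : M) (P : M -> Prop).

(** Double induction. If neither set is a member of the other, each element of one is comparable
    with the other, and transitivity excludes all cases but membership; so the two sets have the
    same elements. *)
Lemma hered_trans_total x : forall y,
  trans x -> (forall z, z ∈ x -> trans z) -> trans y -> (forall z, z ∈ y -> trans z) ->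
  x ∈ y \/ x = y \/ y ∈ x.
Proof.
induction x as [x IHx] using mem_ind; intro y; induction y as [y IHy] using mem_ind.
intros Tx Hx Ty Hy.
destruct (classic (x ∈ y)) as [|N1]; [auto|].
destruct (classic (y ∈ x)) as [|N2]; [auto|].
right; left; apply ext; intro z; split; intro Hz.
- destruct (IHx z Hz y) as [K|[K|K]]; auto.
  + intros v Hv; apply Hx; exact (Tx _ _ Hz Hv).
  + subst; contradiction.
  + destruct N2; exact (Tx _ _ Hz K).
- destruct (IHy z Hz) as [K|[K|K]]; auto.
  + intros v Hv; apply Hy; exact (Ty _ _ Hz Hv).
  + destruct N1; exact (Ty _ _ Hz K).
  + subst; contradiction.
Qed.

(** Since membership is well-founded, hereditary transitivity already yields linearity and least
    elements. *)
Lemma is_ord_iff x : is_ord x <-> trans x /\ forall y, y ∈ x -> trans y.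
Proof.
split.
- intros (H1 & H2 & _); split.
  + intros y z Hy Hz; eauto.
  + intros y Hy a b Ha Hb; apply (H2 b a y); eauto.
- intros [H1 H2]; split; [|split; [|split]].
  + intros a b Ha Hb; eauto.
  + intros a b c _ _ Hc Hab Hbc; exact (H2 c Hc _ _ Hbc Hab).
  + intros a b Ha Hb; apply hered_trans_total; auto;
      intros z Hz; apply H2; eauto.
  + intros b Hb [y Hy].
    destruct (@mem_min _ _ (fun m => m ∈ b) y Hy) as (m & Hm & K).
    exists m; split; auto. intros z Hz L; exact (K z L Hz).
Qed.

Lemma is_ord_in x y : is_ord x -> y ∈ x -> is_ord y.
Proof.
rewrite !is_ord_iff; intros [H1 H2] Hy; split; auto.
intros z Hz; apply H2; eauto.
Qed.

Lemma is_ord_total x y : is_ord x -> is_ord y -> x ∈ y \/ x = y \/ y ∈ x.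
Proof. rewrite !is_ord_iff; intros [] []; now apply hered_trans_total. Qed.

Lemma Def_is_ord (t : (nat -> M) -> M) : DT t -> Def (fun e => is_ord (t e)).
Proof.
intro H; apply (@Def_ext _ _ (fun e => trans (t e) /\ forall y, y ∈ t e -> trans y)).
- intro e; apply is_ord_iff.
- apply (@Def_rel1 M (fun x => trans x /\ forall y, y ∈ x -> trans y)); [dfn|exact H].
Qed.

(** The axiom provides selectors only for disjoint families, so each nonempty subset [Y] of [X] is
    replaced by its tagged copy [prod (sg Y) Y]. *)
Lemma choice_function X : exists ch : M -> M, DT (fun e => ch (e 0)) /\
  forall Y, subset Y X -> (exists y, y ∈ Y) -> ch Y ∈ Y.
Proof.
destruct (@isset_repl _ _ (fun Y u => (exists y, y ∈ Y) /\ u = prod (sg Y) Y) (pow X))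
  as [F HF].
{ dfn. }
{ intros y z z' _ [_ ->] [_ ->]; reflexivity. }
destruct (zfc_choice gr_zfc (x := F)) as [c Hc].
- intros y Hy; apply HF in Hy; destruct Hy as (Y & _ & [y' Hy'] & ->).
  exists (op Y y'); apply in_prod_op; rewrite in_sg; auto.
- intros y y' z Hy Hy'; apply HF in Hy, Hy'.
  destruct Hy as (Y & _ & _ & ->), Hy' as (Y' & _ & _ & ->).
  intros H H'; apply in_prod in H, H'.
  destruct H as (a & b & Ha & _ & ->), H' as (a' & b' & Ha' & _ & E).
  apply op_inj in E; destruct E; subst; apply in_sg in Ha, Ha'; congruence.
(* A selector may contain stray elements; discarding those outside the family leaves exactly one
   pair over each [Y], as [ap] requires. *)
- destruct (@isset_sep_in _ _ (fun z => z ∈ un F) c) as [c0 Hc0]; [dfn|].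
  exists (ap c0); split; [apply DT_ap; dfn|].
  intros Y HY N.
  assert (K : prod (sg Y) Y ∈ F) by (apply HF; exists Y; rewrite in_pow; auto).
  destruct (Hc _ K) as (z & [Hz Hzc] & U).
  pose proof Hz as Hz'; apply in_prod in Hz'; destruct Hz' as (a & b & Ha & Hb & ->).
  apply in_sg in Ha; subst a.
  rewrite (@ap_eq _ _ c0 Y b); [exact Hb| |].
  + apply Hc0; split; [exact Hzc|apply in_un; eauto].
  + intros t Ht; apply Hc0 in Ht; destruct Ht as [Ht HtF].
    apply in_un in HtF; destruct HtF as (w & Hw & HwF).
    apply HF in HwF; destruct HwF as (Y' & _ & _ & ->).
    pose proof (proj1 (in_prod_op _ _ _ _) Hw) as [E _]; apply in_sg in E; subst Y'.
    assert (E : op Y b = op Y t) by (apply U; auto).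
    apply op_inj in E; destruct E; auto.
Qed.

(** Transfinite selection of elements not yet listed, with [t0] as the value once [X] is exhausted.
    Values stay in [X] at every argument, ordinal or not. If no ordinal exhausted [X], then [h]
    would be injective on all ordinals. *)
Lemma well_order X t0 : t0 ∈ X -> exists eta (h : M -> M),
  is_ord eta /\ DT (fun e => h (e 0)) /\ (forall i, h i ∈ X) /\
  forall t, t ∈ X -> exists i, i ∈ eta /\ h i = t.
Proof.
intro Ht0; destruct (choice_function X) as (ch & Dch & Hch).
pose (W x g t := t ∈ X /\ ((forall y, y ∈ x -> t <> ap g y) \/
  t = t0 /\ forall s, s ∈ X -> exists y, y ∈ x /\ s = ap g y)).
assert (IW : forall x g, isset (W x g)).
{ intros x g; apply isset_sep_in; dfn. }
assert (NW : forall x g, exists t, W x g t).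
{ intros x g; destruct (classic (exists t, t ∈ X /\ forall y, y ∈ x -> t <> ap g y))
    as [(t & H & K)|N].
  - exists t; split; auto.
  - exists t0; split; [auto|right; split; [reflexivity|]].
    intros s Hs; apply NNPP; intro L; apply N; exists s; split; [auto|].
    intros y Hy E; apply L; eauto. }
destruct (@recursion _ _ (fun _ x g => ch (comp (W x g)))) as (H & H1 & H2).
{ apply (DT_fun1 Dch), DT_comp; [intro; apply IW|unfold W; dfn]. }
pose (h := H emp).
assert (Dh : DT (fun e => h (e 0))) by (apply (DT_fun2 H1); dfn).
assert (hW : forall i, W i (restr h i) (h i)).
{ intro i; unfold h at 2; rewrite H2; fold h.
  rewrite <- in_comp; [|apply IW]. apply Hch.
  - intros t Ht; rewrite in_comp in Ht; [|apply IW]. apply Ht.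
  - destruct (NW i (restr h i)) as [t Ht]; exists t; rewrite in_comp; auto. }
assert (hX : forall i, h i ∈ X) by (intro i; apply hW).
destruct (classic (exists eta, is_ord eta /\ forall t, t ∈ X -> exists i, i ∈ eta /\ h i = t))
  as [(eta & O & K)|N]; [exists eta, h; auto|exfalso].
assert (S1 : forall i j, is_ord i -> j ∈ i -> h i <> h j).
{ intros i j Oi Hj E.
  destruct (proj2 (hW i)) as [K|[_ K]].
  - apply (K j Hj); rewrite ap_restr; auto; apply tc_sub, Hj.
  - apply N; exists i; split; [exact Oi|].
    intros t Ht; destruct (K t Ht) as (y & Hy & L); exists y; split; [exact Hy|].
    rewrite ap_restr in L; auto; apply tc_sub, Hy. }
(* Replacement along the inverse of the injective [h] makes the class of all ordinals a set, which
   would then be an ordinal and its own member. *)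
destruct (@isset_repl _ _ (fun t i => is_ord i /\ h i = t) X) as [O HO].
- apply Def_and; [apply Def_is_ord; dfn|].
  apply Def_eq; [apply (DT_fun1 Dh); dfn|dfn].
- intros t i j _ [Oi Ei] [Oj Ej].
  destruct (is_ord_total Oi Oj) as [K|[K|K]]; auto.
  + destruct (S1 _ _ Oj K); congruence.
  + destruct (S1 _ _ Oi K); congruence.
- assert (HO' : forall i, i ∈ O <-> is_ord i).
  { intro i; rewrite HO; split; [intros (t & _ & K & _); exact K|].
    intro K; exists (h i); auto. }
  apply (mem_irrefl (x := O)), HO', is_ord_iff; split.
  + intros y z Hy Hz; apply HO' in Hy; apply HO'; exact (is_ord_in Hy Hz).
  + intros y Hy; apply HO', is_ord_iff in Hy; exact (proj1 Hy).
Qed.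

End Ordinals.

(** * Cohen conditions and permutations *)

Section Conditions.
Context {M : estruct} {gr : Ground M}.
Variable k : M.
Implicit Types (x y z u f g h p q a b n i : M) (P : M -> Prop).

Lemma is_one_iff i : is_one i <-> i = sg emp.
Proof.
split.
- intro H; apply ext; intro z; rewrite in_sg, (H z); apply is_empty_emp.
- intros -> z; rewrite in_sg, is_empty_emp; tauto.
Qed.

Lemma app_iff f x y : app f x y <-> op x y ∈ f.
Proof.
unfold app; split.
- intros (u & H & K); apply is_opair_op in K; subst; auto.
- intro H; exists (op x y); rewrite is_opair_op; auto.
Qed.

Lemma is_triple_iff t a n i : is_triple t a n i <-> t = op (op a n) i.
Proof.
unfold is_triple; split.
- intros (u & H & K); rewrite is_opair_op in *; subst; auto.
- intros ->; exists (op a n); rewrite !is_opair_op; auto.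
Qed.

Lemma trip_inj a n i a' n' i' : op (op a n) i = op (op a' n') i' ->
  a = a' /\ n = n' /\ i = i'.
Proof.
intro H; apply op_inj in H; destruct H as [H ->]; apply op_inj in H.
destruct H; auto.
Qed.

(** Finiteness in the sense of the model gives a genuine list, because the numeral bounding [p] is
    standard. *)
Lemma finite_in_list p : finite p -> exists l : list M, forall z, z ∈ p -> List.In z l.
Proof.
intros (w & n & f & Hw & Hn & [F1 F2] & I).
apply is_omega_iff in Hw; subst w; apply in_om in Hn; destruct Hn as [m ->].
exists (List.map (fun j => pick (fun t => op t (num j) ∈ f)) (List.seq 0 m)).
intros z Hz; destruct (F2 z Hz) as (y & Hy & _); apply app_iff in Hy.
destruct (F1 _ Hy) as (z' & y' & _ & K & E); apply is_opair_op, op_inj in E.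
destruct E; subst z' y'; apply in_num in K; destruct K as (j & L & ->).
apply List.in_map_iff; exists j; split; [|apply List.in_seq; lia].
apply pick_eq; [exact Hy|].
intros t Ht; apply (I t z (num j)); apply app_iff; assumption.
Qed.

Lemma list_finite (l : list M) : forall p, (forall z, z ∈ p -> List.In z l) -> finite p.
Proof.
induction l as [|a l IH]; intros p H.
- exists om, emp, emp; split; [exact om_omega|split; [exact (num_om 0)|]].
  split; [split|].
  + intros u Hu; destruct (in_emp Hu).
  + intros x Hx; destruct (H x Hx).
  + intros x x' y Hx; apply app_iff in Hx; destruct (in_emp Hx).
- destruct (classic (a ∈ p)) as [Ha|Ha].
  2:{ apply IH; intros z Hz; destruct (H z Hz) as [->|K]; [contradiction|exact K]. }
  destruct (@isset_sep_in _ _ (fun z => z <> a) p) as [p' Hp']; [dfn|].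
  destruct (IH p') as (w & n & f & Hw & Hn & [F1 F2] & I).
  { intros z Hz; apply Hp' in Hz; destruct Hz as [Hz Na]; destruct (H z Hz) as [E|K]; [congruence|exact K]. }
  apply is_omega_iff in Hw; subst w.
  assert (A1 : forall x y, app (cup f (sg (op a n))) x y <-> op x y ∈ f \/ x = a /\ y = n).
  { intros x y; rewrite app_iff, in_cup, in_sg; split; intros [K|K]; auto.
    - apply op_inj in K; auto.
    - destruct K; subst; auto. }
  assert (A2 : forall x y, op x y ∈ f -> x ∈ p' /\ y ∈ n).
  { intros x y K; destruct (F1 _ K) as (x' & y' & Hx & Hy & E).
    apply is_opair_op, op_inj in E; destruct E; subst; auto. }
  exists om, (suc n), (cup f (sg (op a n))); split; [exact om_omega|].
  split; [apply in_om in Hn; destruct Hn as [m ->]; exact (num_om (S m))|].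
  split; [split|].
  + intros u Hu; apply in_cup in Hu; destruct Hu as [Hu|Hu].
    * destruct (F1 _ Hu) as (x' & y' & Hx & Hy & E); exists x', y'.
      apply Hp' in Hx; rewrite in_suc; tauto.
    * apply in_sg in Hu; exists a, n; rewrite in_suc, is_opair_op; auto.
  + intros x Hx; destruct (classic (x = a)) as [->|N].
    * exists n; split; [apply A1; auto|].
      intros y Hy; apply A1 in Hy; destruct Hy as [K|[_ ->]]; [|auto].
      apply A2 in K; destruct K as [K _]; apply Hp' in K; destruct K; congruence.
    * destruct (F2 x) as (y & Hy & U); [apply Hp'; auto|].
      exists y; split; [apply A1; left; apply app_iff, Hy|].
      intros y' K; apply A1 in K; destruct K as [K|[-> _]]; [|congruence].
      apply U, app_iff, K.
  + intros x x' y H1 H2; apply A1 in H1, H2; destruct H1 as [H1|[-> ->]], H2 as [H2|[-> E]]; auto.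
    * apply (I x x' y); apply app_iff; assumption.
    * subst y; apply A2 in H1; destruct H1 as [_ H1]; destruct (mem_irrefl H1).
    * apply A2 in H2; destruct H2 as [_ H2]; destruct (mem_irrefl H2).
Qed.

Notation cnd := (cond om k).

Lemma cond_iff p : cnd p <-> finite p /\
  (forall t, t ∈ p -> exists a n i, a ∈ k /\ n ∈ om /\ (i = emp \/ i = sg emp) /\
     t = op (op a n) i) /\
  (forall a n i i', op (op a n) i ∈ p -> op (op a n) i' ∈ p -> i = i').
Proof.
unfold cond; split; intros (H & K & L); (split; [exact H|split]).
- intros t Ht; destruct (K t Ht) as (a & n & i & Ha & Hn & Hi & E).
  apply is_triple_iff in E; rewrite is_empty_emp, is_one_iff in Hi; eauto 8.
- intros a n i i' H1 H2; apply (L _ _ a n i i' H1 H2); apply is_triple_iff; reflexivity.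
- intros t Ht; destruct (K t Ht) as (a & n & i & Ha & Hn & Hi & E).
  exists a, n, i; rewrite is_empty_emp, is_one_iff, is_triple_iff; auto.
- intros t t' a n i i' H1 H2 E1 E2; apply is_triple_iff in E1, E2; subst; eauto.
Qed.

Lemma cond_trip p a n i : cnd p -> op (op a n) i ∈ p ->
  a ∈ k /\ n ∈ om /\ (i = emp \/ i = sg emp).
Proof.
intros H K; apply cond_iff in H; destruct H as (_ & H & _).
destruct (H _ K) as (a' & n' & i' & Ha & Hn & Hi & E).
apply trip_inj in E; destruct E as (-> & -> & ->); auto.
Qed.

Lemma cond_in p t : cnd p -> t ∈ p -> exists a n i, a ∈ k /\ n ∈ om /\ t = op (op a n) i.
Proof.
intros H K; apply cond_iff in H; destruct H as (_ & H & _).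
destruct (H _ K) as (a & n & i & Ha & Hn & Hi & E); eauto 6.
Qed.

Lemma cond_emp : cnd emp.
Proof.
apply cond_iff; split; [|split].
- apply (@list_finite nil); intros z Hz; destruct (in_emp Hz).
- intros t Ht; destruct (in_emp Ht).
- intros a n i i' H; destruct (in_emp H).
Qed.

Lemma Def_finite (t : (nat -> M) -> M) : DT t -> Def (fun e => finite (t e)).
Proof.
intro H; apply (@Def_rel1 M (fun x => finite x)); [|exact H].
unfold finite, is_inj, is_fun, is_omega, inductive_set, is_succ, is_empty, is_opair, is_pair,
  app, is_opair, is_pair, subset, unique; dfn.
Qed.

Lemma Def_cond (t : (nat -> M) -> M) : DT t -> Def (fun e => cnd (t e)).
Proof.
intro H; apply (@Def_rel1 M (fun x => cnd x)); [|exact H].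
unfold cond, is_triple, is_empty, is_one, is_empty, is_opair, is_pair.
apply Def_and; [apply Def_finite|]; dfn.
Qed.

Definition conds : M := comp cnd.

Lemma in_conds p : p ∈ conds <-> cnd p.
Proof.
unfold conds; rewrite in_comp; [tauto|].
apply (isset_sep (x := pow (prod (prod k om) (up emp (sg emp))))).
- apply Def_cond; dfn.
- intros z Hz; apply in_pow; intros t Ht; apply cond_iff in Hz; destruct Hz as (_ & H & _).
  destruct (H t Ht) as (a & n & i & Ha & Hn & Hi & ->).
  rewrite !in_prod_op, in_up; auto.
Qed.

Lemma cond_add p a n i : cnd p -> a ∈ k -> n ∈ om -> (i = emp \/ i = sg emp) ->
  (forall j, ~ op (op a n) j ∈ p) -> cnd (cup p (sg (op (op a n) i))).
Proof.
intros Hp Ha Hn Hi F; apply cond_iff in Hp; destruct Hp as (P1 & P2 & P3).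
apply cond_iff; split; [|split].
- destruct (finite_in_list P1) as [l Hl].
  apply (@list_finite (op (op a n) i :: l)%list).
  intros z Hz; apply in_cup in Hz; rewrite in_sg in Hz; simpl; destruct Hz; auto.
- intros t Ht; apply in_cup in Ht; rewrite in_sg in Ht; destruct Ht as [Ht|Ht]; eauto 8.
- intros a' n' j j' H1 H2; apply in_cup in H1, H2; rewrite in_sg in *.
  destruct H1 as [H1|H1], H2 as [H2|H2]; eauto.
  + apply trip_inj in H2; destruct H2 as (-> & -> & ->); destruct (F _ H1).
  + apply trip_inj in H1; destruct H1 as (-> & -> & ->); destruct (F _ H2).
  + apply trip_inj in H1, H2; destruct H1 as (_ & _ & ->), H2 as (_ & _ & ->); auto.
Qed.

(** A finite condition speaks about finitely many places. One place that is free at all indices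
    simultaneously leaves room to separate two Cohen reals. *)
Lemma cond_fresh p : cnd p -> exists m, forall a i, ~ op (op a (num m)) i ∈ p.
Proof.
intro Hp; destruct (finite_in_list (proj1 Hp)) as [l Hl].
assert (K : exists m, forall j a i, m <= j -> ~ List.In (op (op a (num j)) i) l).
{ clear; induction l as [|t l [m IH]]; [exists 0; simpl; auto|].
  destruct (classic (exists j a i, t = op (op a (num j)) i)) as [(j & a & i & ->)|N].
  - exists (S (max m j)); intros j' a' i' H [E|E].
    + apply trip_inj in E; destruct E as (_ & E & _); apply num_inj in E; lia.
    + apply (IH j' a' i'); [lia|exact E].
  - exists m; intros j a i H [E|E]; [apply N; eauto|exact (IH j a i H E)]. }
destruct K as [m K]; exists m; intros a i H; exact (K m a i (Nat.le_refl m) (Hl _ H)).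
Qed.

(** Permutations expressed by their pairs: the clauses are symmetric in the two coordinates, so that
    inverting amounts to swapping them. *)
Definition bij f : Prop :=
  (forall u, u ∈ f -> exists x y, x ∈ k /\ y ∈ k /\ u = op x y) /\
  (forall x, x ∈ k -> exists y, op x y ∈ f) /\
  (forall y, y ∈ k -> exists x, op x y ∈ f) /\
  (forall x y y', op x y ∈ f -> op x y' ∈ f -> y = y') /\
  (forall x x' y, op x y ∈ f -> op x' y ∈ f -> x = x').

Lemma perm_bij f : perm k f <-> bij f.
Proof.
unfold perm, is_inj, is_surj, is_fun; split.
- intros [[[H1 H2] H3] [_ H4]].
  assert (H1' : forall u, u ∈ f -> exists x y, x ∈ k /\ y ∈ k /\ u = op x y).
  { intros u Hu; destruct (H1 u Hu) as (x & y & Hx & Hy & E); apply is_opair_op in E; eauto 6. }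
  split; [exact H1'|]. repeat split.
  + intros x Hx; destruct (H2 x Hx) as (y & Hy & _); apply app_iff in Hy; eauto.
  + intros y Hy; destruct (H4 y Hy) as (x & Hx); apply app_iff in Hx; eauto.
  + intros x y y' K L; destruct (H1' _ K) as (x0 & y0 & Hx & _ & E); apply op_inj in E.
    destruct E; subst x0 y0; destruct (H2 x Hx) as (z & _ & U).
    rewrite <- (U y), <- (U y'); auto; apply app_iff; auto.
  + intros x x' y K L; apply (H3 x x' y); apply app_iff; auto.
- intros (H1 & H2 & H3 & H4 & H5).
  assert (A : (forall u, u ∈ f -> exists x y, x ∈ k /\ y ∈ k /\ is_opair u x y) /\
    (forall x, x ∈ k -> exists! y, app f x y)).
  { split.
    - intros u Hu; destruct (H1 u Hu) as (x & y & Hx & Hy & ->).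
      exists x, y; rewrite is_opair_op; auto.
    - intros x Hx; destruct (H2 x Hx) as [y Hy]; exists y; split; [apply app_iff; auto|].
      intros y' K; apply app_iff in K; eauto. }
  split; (split; [exact A|]).
  + intros x x' y K L; apply app_iff in K, L; eauto.
  + intros y Hy; destruct (H3 y Hy) as [x Hx]; exists x; apply app_iff, Hx.
Qed.

Lemma Def_perm (t : (nat -> M) -> M) : DT t -> Def (fun e => perm k (t e)).
Proof.
intro H; apply (@Def_ext _ _ (fun e => bij (t e))).
- intro e; apply perm_bij.
- apply (@Def_rel1 M bij); [unfold bij; dfn|exact H].
Qed.

Lemma perm_ap f x : perm k f -> x ∈ k -> op x (ap f x) ∈ f /\ ap f x ∈ k.
Proof.
intros Hf Hx; apply perm_bij in Hf; destruct Hf as (H1 & H2 & H3 & H4 & H5).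
destruct (H2 x Hx) as [y Hy]; rewrite (@ap_eq _ _ f x y); eauto.
split; [exact Hy|]. destruct (H1 _ Hy) as (x0 & y0 & _ & K & E); apply op_inj in E.
destruct E; subst; auto.
Qed.

Lemma perm_op f x y : perm k f -> op x y ∈ f <-> x ∈ k /\ y = ap f x.
Proof.
intro Hf; split.
- intro H; pose proof (proj1 (perm_bij f) Hf) as (H1 & _ & _ & H4 & _).
  destruct (H1 _ H) as (x0 & y0 & K & _ & E); apply op_inj in E; destruct E; subst x0 y0.
  split; [exact K|]. apply (H4 x); [exact H|apply perm_ap; auto].
- intros [H ->]; apply perm_ap; auto.
Qed.

Lemma perm_inj f x x' : perm k f -> x ∈ k -> x' ∈ k -> ap f x = ap f x' -> x = x'.
Proof.
intros Hf Hx Hx' E; pose proof (proj1 (perm_bij f) Hf) as (_ & _ & _ & _ & H5).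
apply (H5 x x' (ap f x)); [|rewrite E]; apply perm_ap; auto.
Qed.

Lemma perm_surj f y : perm k f -> y ∈ k -> exists x, x ∈ k /\ ap f x = y.
Proof.
intros Hf Hy; pose proof (proj1 (perm_bij f) Hf) as (_ & _ & H3 & _).
destruct (H3 y Hy) as [x Hx]; apply perm_op in Hx; auto.
destruct Hx; eauto.
Qed.

Lemma perm_ext f g : perm k f -> perm k g -> (forall x, x ∈ k -> ap f x = ap g x) -> f = g.
Proof.
assert (W : forall f g, perm k f -> perm k g -> (forall x, x ∈ k -> ap f x = ap g x) ->
  subset f g).
{ clear; intros f g Hf Hg E u Hu; pose proof (proj1 (perm_bij f) Hf) as (H1 & _).
  destruct (H1 u Hu) as (x & y & _ & _ & ->); apply perm_op in Hu; auto.
  destruct Hu as [Hx ->]; apply perm_op; auto. }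
intros Hf Hg E; apply ext; intro z; split; apply W; auto.
intros x Hx; symmetry; auto.
Qed.

Definition graph (F : M -> M) x : M := comp (fun u => exists y, y ∈ x /\ u = op y (F y)).

Lemma in_graph (F : M -> M) x y z : DT (fun e => F (e 0)) ->
  op y z ∈ graph F x <-> y ∈ x /\ z = F y.
Proof.
intro H; unfold graph; rewrite in_comp.
- split; [|intros [K ->]; eauto].
  intros (a & K & E); apply op_inj in E; destruct E; subst; auto.
- apply (@isset_image _ _ (fun y => op y (F y))), DT_op; [dfn|exact H].
Qed.

Lemma mem_graph (F : M -> M) x u : DT (fun e => F (e 0)) ->
  u ∈ graph F x <-> exists y, y ∈ x /\ u = op y (F y).
Proof.
intro H; unfold graph; rewrite in_comp; [tauto|].
apply (@isset_image _ _ (fun y => op y (F y))), DT_op; [dfn|exact H].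
Qed.

Lemma ap_graph (F : M -> M) x y : DT (fun e => F (e 0)) -> y ∈ x ->
  ap (graph F x) y = F y.
Proof.
intros H K; apply ap_eq; [apply in_graph; auto|].
intros z L; apply in_graph in L; tauto.
Qed.

Lemma perm_graph (F : M -> M) : DT (fun e => F (e 0)) ->
  (forall x, x ∈ k -> F x ∈ k) ->
  (forall x x', x ∈ k -> x' ∈ k -> F x = F x' -> x = x') ->
  (forall y, y ∈ k -> exists x, x ∈ k /\ F x = y) -> perm k (graph F k).
Proof.
intros D H1 H2 H3; apply perm_bij; repeat split.
- intros u Hu; apply mem_graph in Hu; [|exact D]. destruct Hu as (y & Hy & ->); eauto 6.
- intros x Hx; exists (F x); apply in_graph; auto.
- intros y Hy; destruct (H3 y Hy) as (x & Hx & <-); exists x; apply in_graph; auto.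
- intros x y y' K L; apply in_graph in K, L; auto; destruct K, L; congruence.
- intros x x' y K L; apply in_graph in K, L; auto; destruct K as [K ->], L as [L E]; auto.
Qed.

Definition pid : M := graph (fun x => x) k.
Definition pcomp f g : M := graph (fun x => ap f (ap g x)) k.
Definition pinv f : M := comp (fun u => exists x y, op x y ∈ f /\ u = op y x).

Lemma ap_pid x : x ∈ k -> ap pid x = x.
Proof. intro H; apply (ap_graph (F := fun x => x)); [dfn|exact H]. Qed.

Lemma perm_pid : perm k pid.
Proof. apply perm_graph; eauto; dfn. Qed.

Lemma ap_pcomp f g x : x ∈ k -> ap (pcomp f g) x = ap f (ap g x).
Proof. intro H; apply (ap_graph (F := fun x => ap f (ap g x))); [dfn|exact H]. Qed.

Lemma perm_pcomp f g : perm k f -> perm k g -> perm k (pcomp f g).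
Proof.
intros Hf Hg; apply perm_graph; [dfn| | |].
- intros x Hx; apply perm_ap; auto; apply perm_ap; auto.
- intros x x' Hx Hx' E; apply (perm_inj Hg); auto.
  apply (perm_inj Hf); auto; apply perm_ap; auto.
- intros y Hy; destruct (perm_surj Hf Hy) as (z & Hz & <-).
  destruct (perm_surj Hg Hz) as (x & Hx & <-); eauto.
Qed.

Lemma in_pinv f x y : perm k f -> op y x ∈ pinv f <-> op x y ∈ f.
Proof.
intro Hf; unfold pinv; rewrite in_comp.
- split; [|eauto]. intros (a & b & H & E); apply op_inj in E; destruct E; subst; auto.
- apply (isset_sep (x := prod k k)); [dfn|].
  intros u (a & b & H & ->); apply in_prod_op.
  pose proof (proj1 (perm_op a b Hf) H) as [Ha ->]; split; auto; apply perm_ap; auto.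
Qed.

Lemma perm_pinv f : perm k f -> perm k (pinv f).
Proof.
intro Hf; pose proof (proj1 (perm_bij f) Hf) as (H1 & H2 & H3 & H4 & H5).
apply perm_bij; repeat split.
- intros u Hu; unfold pinv in Hu; rewrite in_comp in Hu.
  + destruct Hu as (x & y & K & ->).
    destruct (H1 _ K) as (x' & y' & Hx & Hy & E); apply op_inj in E; destruct E; subst; eauto 6.
  + apply (isset_sep (x := prod k k)); [dfn|].
    intros v (a & b & H & ->); apply in_prod_op.
    pose proof (proj1 (perm_op a b Hf) H) as [Ha ->]; split; auto; apply perm_ap; auto.
- intros x Hx; destruct (H3 x Hx) as [y Hy]; exists y; apply in_pinv; auto.
- intros x Hx; destruct (H2 x Hx) as [y Hy]; exists y; apply in_pinv; auto.
- intros x y y' K L; rewrite in_pinv in K, L by exact Hf; eauto.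
- intros x y y' K L; rewrite in_pinv in K, L by exact Hf; eauto.
Qed.

Lemma pinv_l f x : perm k f -> x ∈ k -> ap (pinv f) (ap f x) = x.
Proof.
intros Hf Hx; pose proof (perm_pinv Hf) as Hi.
assert (K : op (ap f x) x ∈ pinv f) by (apply in_pinv; auto; apply perm_ap; auto).
apply (perm_op _ _ Hi) in K; destruct K; auto.
Qed.

Lemma pinv_r f x : perm k f -> x ∈ k -> ap f (ap (pinv f) x) = x.
Proof.
intros Hf Hx; destruct (perm_surj Hf Hx) as (y & Hy & <-).
now rewrite pinv_l.
Qed.

Lemma pcomp_pinv_l f : perm k f -> pcomp (pinv f) f = pid.
Proof.
intro Hf; apply perm_ext; auto using perm_pcomp, perm_pinv, perm_pid.
intros x Hx; rewrite ap_pcomp, ap_pid, pinv_l; auto.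
Qed.

Lemma pcomp_pinv_r f : perm k f -> pcomp f (pinv f) = pid.
Proof.
intro Hf; apply perm_ext; auto using perm_pcomp, perm_pinv, perm_pid.
intros x Hx; rewrite ap_pcomp, ap_pid, pinv_r; auto.
Qed.

Definition perms : M := comp (perm k).

Lemma in_perms f : f ∈ perms <-> perm k f.
Proof.
unfold perms; rewrite in_comp; [tauto|].
apply (isset_sep (x := pow (prod k k))); [apply Def_perm; dfn|].
intros z Hz; apply in_pow; intros t Ht; pose proof (proj1 (perm_bij z) Hz) as (H1 & _).
destruct (H1 t Ht) as (x & y & Hx & Hy & ->); apply in_prod_op; auto.
Qed.

Definition cact f p : M :=
  comp (fun t => exists a b n i, op (op a n) i ∈ p /\ op a b ∈ f /\ t = op (op b n) i).

Lemma isset_cact f p :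
  isset (fun t => exists a b n i, op (op a n) i ∈ p /\ op a b ∈ f /\ t = op (op b n) i).
Proof.
apply (isset_sep (x := prod (prod (un (un f)) (un (un (un (un p))))) (un (un p)))); [dfn|].
assert (W : forall x y z, op x y ∈ z -> x ∈ un (un z) /\ y ∈ un (un z)).
{ intros x y z H; split; apply in_un; exists (up x y); (split; [apply in_up; auto|]);
    apply in_un; exists (op x y); (split; [apply in_up; auto|exact H]). }
intros t (a & b & n & i & H & K & ->); rewrite !in_prod_op.
apply W in H, K; destruct H as [H H'], K as [_ K]; apply W in H; tauto.
Qed.

Lemma in_cact f p t : t ∈ cact f p <->
  exists a b n i, op (op a n) i ∈ p /\ op a b ∈ f /\ t = op (op b n) i.
Proof. unfold cact; rewrite in_comp; [tauto|apply isset_cact]. Qed.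

Lemma DT_cact (s t : (nat -> M) -> M) : DT s -> DT t -> DT (fun e => cact (s e) (t e)).
Proof. apply DT_fun2; apply DT_comp; [intro; apply isset_cact|dfn]. Qed.

Lemma cond_act_iff f p q : cond_act f p q <-> q = cact f p.
Proof.
split.
- intro H; apply ext; intro t; rewrite (H t), in_cact; split.
  + intros (t' & a & b & n & i & K & E & L & E').
    apply is_triple_iff in E, E'; apply app_iff in L; subst; eauto 8.
  + intros (a & b & n & i & K & L & ->).
    exists (op (op a n) i), a, b, n, i; rewrite !is_triple_iff, app_iff; auto.
- intros -> t; rewrite in_cact; split.
  + intros (a & b & n & i & K & L & ->).
    exists (op (op a n) i), a, b, n, i; rewrite !is_triple_iff, app_iff; auto.
  + intros (t' & a & b & n & i & K & E & L & E').
    apply is_triple_iff in E, E'; apply app_iff in L; subst; eauto 8.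
Qed.

Lemma cact_mono f p q : subset p q -> subset (cact f p) (cact f q).
Proof.
intros H t Ht; apply in_cact in Ht; apply in_cact.
destruct Ht as (a & b & n & i & K & L & E); eauto 8.
Qed.

Lemma cact_emp f : cact f emp = emp.
Proof.
apply is_empty_emp; intros t Ht; apply in_cact in Ht.
destruct Ht as (a & b & n & i & K & _); destruct (in_emp K).
Qed.

Lemma cond_cact f p : perm k f -> cnd p -> cnd (cact f p).
Proof.
intros Hf Hp; apply cond_iff; split; [|split].
- destruct (finite_in_list (proj1 Hp)) as [l Hl].
  apply (@list_finite (List.map (fun t => op (op (ap f (pr1 (pr1 t))) (pr2 (pr1 t))) (pr2 t)) l)).
  intros z Hz; apply in_cact in Hz; destruct Hz as (a & b & n & i & K & L & ->).
  apply List.in_map_iff; exists (op (op a n) i); split; [|auto].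
  rewrite !pr1_op, !pr2_op; apply perm_op in L; auto; destruct L as [_ ->]; reflexivity.
- intros t Ht; apply in_cact in Ht; destruct Ht as (a & b & n & i & K & L & ->).
  exists b, n, i; pose proof (cond_trip Hp K) as (Ha & Hn & Hi).
  apply perm_op in L; auto; destruct L as [_ ->]; repeat split; auto; apply perm_ap; auto.
- intros b n i i' H H'; apply in_cact in H, H'.
  destruct H as (a & b0 & n0 & i0 & K & L & E), H' as (a' & b1 & n1 & i1 & K' & L' & E').
  apply trip_inj in E, E'; destruct E as (<- & <- & <-), E' as (<- & <- & <-).
  pose proof (proj1 (perm_bij f) Hf) as (_ & _ & _ & _ & H5).
  rewrite (H5 _ _ _ L L') in K.
  apply cond_iff in Hp; destruct Hp as (_ & _ & Hp); eauto.
Qed.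

Lemma cact_pcomp f g p : perm k f -> perm k g -> cnd p ->
  cact f (cact g p) = cact (pcomp f g) p.
Proof.
intros Hf Hg Hp; pose proof (perm_pcomp Hf Hg) as Hc.
apply ext; intro t; rewrite !in_cact; split.
- intros (a & b & n & i & K & L & ->); apply in_cact in K.
  destruct K as (a' & b' & n' & i' & K & L' & E); apply trip_inj in E; destruct E as (<- & <- & <-).
  exists a', b, n, i; split; [exact K|split; [|reflexivity]].
  apply perm_op in L, L'; auto; apply perm_op; auto.
  destruct L as [La ->], L' as [La' ->]; split; auto; now rewrite ap_pcomp.
- intros (a & b & n & i & K & L & ->); apply perm_op in L; auto; destruct L as [La ->].
  rewrite ap_pcomp; auto.
  exists (ap g a), (ap f (ap g a)), n, i; split; [|split; [|reflexivity]].
  + apply in_cact; exists a, (ap g a), n, i; split; [exact K|split; [|reflexivity]].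
    apply perm_ap; auto.
  + apply perm_ap; auto; apply perm_ap; auto.
Qed.

Lemma cact_pid p : cnd p -> cact pid p = p.
Proof.
intro Hp; apply ext; intro t; rewrite in_cact; split.
- intros (a & b & n & i & K & L & ->); apply (perm_op _ _ perm_pid) in L.
  destruct L as [La ->]; rewrite ap_pid; auto.
- intro Ht; destruct (cond_in Hp Ht) as (a & n & i & Ha & Hn & ->).
  exists a, a, n, i; split; [exact Ht|split; [|reflexivity]].
  apply (perm_op _ _ perm_pid); rewrite ap_pid; auto.
Qed.

End Conditions.

Ltac dhintD :=
  lazymatch goal with
  | |- DT (fun e => cact _ _) => apply DT_cact
  | |- Def (fun e => cond om _ _) => apply Def_cond
  | |- Def (fun e => perm _ _) => apply Def_perm
  | |- Def (fun e => is_ord _) => apply Def_is_ord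
  | |- _ => dhintB
  end.
Ltac dhint ::= dhintD.

(** * Names, the action of permutations, and supports *)

Section Names.
Context {M : estruct} {gr : Ground M}.
Variable k : M.
Implicit Types (x y z u v f g h p q a b n i : M) (P : M -> Prop).
Notation cnd := (cond om k).
Notation name := (is_name om k).

Lemma op_tc x y p : op y p ∈ x -> y ∈ tc x.
Proof.
intro H; apply (@tc_trans _ _ x (sg y)); [|apply in_sg; auto].
apply (@tc_trans _ _ x (op y p)); [apply tc_sub, H|apply in_up; auto].
Qed.

Lemma name_induction P :
  (forall x, (forall y p, op y p ∈ x -> P y) -> P x) -> forall x, P x.
Proof.
intros H x; induction x as [x IH] using tc_ind.
apply H; intros y p K; apply IH, (op_tc K).
Qed.

Lemma isset_pairs (F : M -> M -> M) x : DT (fun e => F (e 0) (e 1)) ->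
  isset (fun u => exists y p, op y p ∈ x /\ u = F y p).
Proof.
intro HF.
destruct (@isset_repl _ _ (fun v u => exists y p, v = op y p /\ u = F y p) x) as [s Hs].
- apply (@Def_ex M (fun e y => exists p, e 0 = op y p /\ e 1 = F y p)).
  apply (@Def_ex M (fun e p => e 1 = op (e 0) p /\ e 2 = F (e 0) p)).
  apply Def_and; [dfn|]. apply Def_eq; [dfn|]. apply (DT_fun2 HF); dfn.
- intros v u u' _ (y & p & -> & ->) (y' & p' & E & ->).
  apply op_inj in E; destruct E; subst; reflexivity.
- exists s; intro u; rewrite Hs; split.
  + intros (v & Hv & y & p & -> & ->); eauto.
  + intros (y & p & H & ->); eauto 8.
Qed.

Lemma isset_act_step f x g :
  isset (fun u => exists y p, op y p ∈ x /\ u = op (ap g y) (cact f p)).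
Proof. apply (@isset_pairs (fun y p => op (ap g y) (cact f p))); dfn. Qed.

Lemma act_exists : exists act : M -> M -> M,
  DT (fun e => act (e 0) (e 1)) /\
  forall f x, act f x = comp (fun u => exists y p, op y p ∈ x /\
                                u = op (ap (restr (act f) x) y) (cact f p)).
Proof.
apply (@recursion _ _ (fun f x g => comp (fun u => exists y p, op y p ∈ x /\
                                u = op (ap g y) (cact f p)))).
apply DT_comp; [intro; apply isset_act_step|dfn].
Qed.

Definition act : M -> M -> M :=
  proj1_sig (constructive_indefinite_description _ act_exists).

Lemma DT_act (s t : (nat -> M) -> M) : DT s -> DT t -> DT (fun e => act (s e) (t e)).
Proof.
apply DT_fun2; unfold act; destruct constructive_indefinite_description as [F H]; apply H.
Qed.

Ltac dhint ::=
  lazymatch goal with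
  | |- DT (fun e => act _ _) => apply DT_act
  | |- _ => dhintD
  end.

Lemma in_act f x u : u ∈ act f x <->
  exists y p, op y p ∈ x /\ u = op (act f y) (cact f p).
Proof.
assert (E : act f x = comp (fun u => exists y p, op y p ∈ x /\
    u = op (ap (restr (act f) x) y) (cact f p))).
{ unfold act; destruct constructive_indefinite_description as [F H]; apply H. }
assert (D : DT (fun e => act f (e 0))) by dfn.
rewrite E, in_comp; [|apply isset_act_step].
split; intros (y & p & H & ->); exists y, p; (split; [exact H|]);
  rewrite ap_restr; eauto using op_tc.
Qed.

Lemma op_in_act f x y p : op y p ∈ x -> op (act f y) (cact f p) ∈ act f x.
Proof. intro H; apply in_act; eauto. Qed.

(** By induction on [x], the two premises of the inductive graph are the two inclusions of the
    equation [in_act]; from here on the action is a definable function. *)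
Lemma name_act_iff f x : forall x', name_act f x x' <-> x' = act f x.
Proof.
induction x as [x IH] using name_induction; intro x'; split.
- intro H; destruct H as [x x' H1 H2].
  apply ext; intro u; rewrite in_act; split.
  + intro Hu; destruct (H2 u Hu) as (v & y & p & y' & p' & Hv & E & E' & K & L).
    apply is_opair_op in E, E'; apply cond_act_iff in L; subst.
    apply (IH _ _ Hv) in K; subst; eauto.
  + intros (y & p & Hy & ->).
    destruct (H1 (op y p) y p Hy) as (u' & y' & p' & Hu & E & K & L);
      [apply is_opair_op; auto|].
    apply is_opair_op in E; apply cond_act_iff in L; apply (IH _ _ Hy) in K; subst; auto.
- intros ->; constructor.
  + intros u y p Hu E; apply is_opair_op in E; subst.
    exists (op (act f y) (cact f p)), (act f y), (cact f p); split; [apply op_in_act, Hu|].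
    rewrite is_opair_op, cond_act_iff, (IH _ _ Hu); auto.
  + intros u Hu; apply in_act in Hu; destruct Hu as (y & p & Hy & ->).
    exists (op y p), y, p, (act f y), (cact f p).
    rewrite !is_opair_op, cond_act_iff, (IH _ _ Hy); auto.
Qed.

Lemma name_iff x : name x <->
  forall u, u ∈ x -> exists y p, u = op y p /\ name y /\ cnd p.
Proof.
split.
- intros [z H] u Hu; destruct (H u Hu) as (y & p & E & K); apply is_opair_op in E; eauto.
- intro H; constructor; intros u Hu; destruct (H u Hu) as (y & p & E & K).
  exists y, p; rewrite is_opair_op; auto.
Qed.

Lemma name_op x y p : name x -> op y p ∈ x -> name y /\ cnd p.
Proof.
rewrite name_iff; intros H K; destruct (H _ K) as (y' & p' & E & L).
apply op_inj in E; destruct E; subst; auto.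
Qed.

Lemma name_in x u : name x -> u ∈ x -> exists y p, u = op y p /\ name y /\ cnd p.
Proof. rewrite name_iff; auto. Qed.

Lemma name_act_name f x : perm k f -> name x -> name (act f x).
Proof.
intro Hf; induction x as [x IH] using name_induction; intro Hx.
apply name_iff; intros u Hu; apply in_act in Hu; destruct Hu as (y & p & H & ->).
destruct (name_op Hx H); exists (act f y), (cact f p); split; [reflexivity|].
split; [eauto|apply cond_cact; auto].
Qed.

Lemma act_pid x : name x -> act (pid k) x = x.
Proof.
induction x as [x IH] using name_induction; intro Hx; apply ext; intro u; rewrite in_act; split.
- intros (y & p & H & ->); destruct (name_op Hx H).
  rewrite (IH y p), cact_pid; auto.
- intro H; destruct (name_in Hx H) as (y & p & -> & Hy & Hp); exists y, p; split; [exact H|].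
  rewrite (IH y p), cact_pid; auto.
Qed.

Lemma act_pcomp f g x : perm k f -> perm k g -> name x ->
  act f (act g x) = act (pcomp k f g) x.
Proof.
intros Hf Hg; induction x as [x IH] using name_induction; intro Hx; apply ext; intro u.
rewrite !in_act; split.
- intros (y & p & H & ->); apply in_act in H; destruct H as (y' & p' & H & E).
  apply op_inj in E; destruct E; subst; destruct (name_op Hx H).
  exists y', p'; split; [exact H|]. rewrite (IH y' p'), (cact_pcomp (k := k)); auto.
- intros (y & p & H & ->); destruct (name_op Hx H).
  exists (act g y), (cact g p); split; [apply op_in_act, H|].
  rewrite (IH y p), (cact_pcomp (k := k)); auto.
Qed.

Lemma act_pinv_l f x : perm k f -> name x -> act (pinv f) (act f x) = x.
Proof.
intros Hf Hx; rewrite act_pcomp, pcomp_pinv_l, act_pid; auto using perm_pinv.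
Qed.

Lemma act_pinv_r f x : perm k f -> name x -> act f (act (pinv f) x) = x.
Proof.
intros Hf Hx; rewrite act_pcomp, pcomp_pinv_r, act_pid; auto using perm_pinv.
Qed.

Lemma cact_pinv_r f p : perm k f -> cnd p -> cact f (cact (pinv f) p) = p.
Proof.
intros Hf Hx; rewrite (cact_pcomp (k := k)), pcomp_pinv_r, cact_pid; auto using perm_pinv.
Qed.

Lemma cact_pinv_l f p : perm k f -> cnd p -> cact (pinv f) (cact f p) = p.
Proof.
intros Hf Hx; rewrite (cact_pcomp (k := k)), pcomp_pinv_l, cact_pid; auto using perm_pinv.
Qed.

(** Countable supports are represented by sequences and not by sets, since the reals along a support
    must remember which index stands where. Such a sequence matters only through its values
    [ap a n]. *)
Definition seqs : M := comp (fun a => subset a (prod om k) /\ forall n, n ∈ om -> ap a n ∈ k).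

Lemma in_seqs a : a ∈ seqs <-> subset a (prod om k) /\ forall n, n ∈ om -> ap a n ∈ k.
Proof.
unfold seqs; rewrite in_comp; [tauto|].
apply (isset_sep (x := pow (prod om k))); [dfn|].
intros z [H _]; apply in_pow, H.
Qed.

Lemma seq_graph (F : M -> M) : DT (fun e => F (e 0)) ->
  (forall n, n ∈ om -> F n ∈ k) -> graph F om ∈ seqs.
Proof.
intros D H; apply in_seqs; split.
- intros u Hu; apply mem_graph in Hu; [|exact D]. destruct Hu as (n & Hn & ->).
  apply in_prod_op; auto.
- intros n Hn; rewrite ap_graph; auto.
Qed.

Definition fixes f a : Prop := forall n, n ∈ om -> ap f (ap a n) = ap a n.

(** The even places of [c] list [a] and the odd places list [b], so its range is the union of the
    two ranges. *)
Lemma seq_merge a b : a ∈ seqs -> b ∈ seqs -> exists c, c ∈ seqs /\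
  forall f, fixes f c -> fixes f a /\ fixes f b.
Proof.
intros Ha Hb; apply in_seqs in Ha, Hb; destruct Ha as [_ Ha], Hb as [_ Hb].
destruct (@double_exists M _) as (D & DD & HD).
destruct (@isset_sep _ _ (fun u => exists n, n ∈ om /\
   (u = op (D n) (ap a n) \/ u = op (suc (D n)) (ap b n))) (prod om k)) as [c Hc].
{ apply (@Def_ex M (fun e n => n ∈ om /\
     (e 0 = op (D n) (ap a n) \/ e 0 = op (suc (D n)) (ap b n)))).
  assert (E : DT (fun e => D (e 0))) by exact DD.
  apply Def_and; [dfn|]. apply Def_or; (apply Def_eq; [dfn|]); apply DT_op;
    try apply DT_suc; first [apply (DT_fun1 DD)|apply DT_ap]; dfn. }
{ intros u (n & Hn & H); apply in_om in Hn as K; destruct K as [m ->].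
  rewrite HD in H; destruct H as [->| ->]; apply in_prod_op; auto using num_om.
  split; [apply (num_om (S (2 * m)))|auto]. }
assert (E1 : forall m, ap c (num (2 * m)) = ap a (num m)).
{ intro m; apply ap_eq.
  - apply Hc; exists (num m); rewrite HD; split; [apply num_om|auto].
  - intros z Hz; apply Hc in Hz; destruct Hz as (n & Hn & E); apply in_om in Hn.
    destruct Hn as [j ->]; rewrite HD in E; destruct E as [E|E]; apply op_inj in E;
      destruct E as [E ->].
    + apply num_inj in E; do 2 f_equal; lia.
    + change (num (2 * m) = num (S (2 * j))) in E; apply num_inj in E; lia. }
assert (E2 : forall m, ap c (num (S (2 * m))) = ap b (num m)).
{ intro m; apply ap_eq.
  - apply Hc; exists (num m); rewrite HD; split; [apply num_om|auto].
  - intros z Hz; apply Hc in Hz; destruct Hz as (n & Hn & E); apply in_om in Hn.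
    destruct Hn as [j ->]; rewrite HD in E; destruct E as [E|E]; apply op_inj in E;
      destruct E as [E ->].
    + apply num_inj in E; lia.
    + change (num (S (2 * m)) = num (S (2 * j))) in E; apply num_inj in E; do 2 f_equal; lia. }
exists c; split.
- apply in_seqs; split.
  + intros u Hu; apply Hc in Hu; destruct Hu as (n & Hn & H); apply in_om in Hn as K.
    destruct K as [m ->]; rewrite HD in H; destruct H as [->| ->]; apply in_prod_op;
      auto using num_om.
    split; [apply (num_om (S (2 * m)))|auto].
  + intros n Hn; apply in_om in Hn; destruct Hn as [m ->].
    destruct (Nat.Even_or_Odd m) as [[j ->]|[j ->]].
    * rewrite E1; auto using num_om.
    * rewrite Nat.add_1_r, E2; auto using num_om.
- intros f Hf; split; intros n Hn; apply in_om in Hn; destruct Hn as [m ->].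
  + rewrite <- E1; apply Hf, num_om.
  + rewrite <- E2; apply Hf, num_om.
Qed.

(** The injection of [E] into omega is inverted; indices outside its range receive the default [a0],
    which also covers an empty [E]. *)
Lemma countable_seq E a0 : a0 ∈ k -> subset E k -> countable E ->
  exists a, a ∈ seqs /\ forall x, x ∈ E -> exists n, n ∈ om /\ ap a n = x.
Proof.
intros Ha0 HE (w & j & Hw & [J1 J2] & I); apply is_omega_iff in Hw; subst w.
assert (J : forall x n, op x n ∈ j -> x ∈ E /\ n ∈ om).
{ intros x n H; destruct (J1 _ H) as (x' & n' & Hx & Hn & K); apply is_opair_op, op_inj in K.
  destruct K; subst; auto. }
destruct (@isset_sep_in _ _ (fun u => exists n x, u = op n x /\
  (op x n ∈ j \/ x = a0 /\ forall y, ~ op y n ∈ j)) (prod om k)) as [a Ha]; [dfn|].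
assert (A1 : forall n x, op n x ∈ a <-> n ∈ om /\ x ∈ k /\
  (op x n ∈ j \/ x = a0 /\ forall y, ~ op y n ∈ j)).
{ intros n x; rewrite Ha, in_prod_op; split.
  - intros [[H K] (n' & x' & L & R)]; apply op_inj in L; destruct L; subst; auto.
  - intros (H & K & L); split; [auto|]. exists n, x; auto. }
assert (A2 : forall n x, op x n ∈ j -> ap a n = x).
{ intros n x H; destruct (J _ _ H) as [Hx Hn]; apply ap_eq; [apply A1; auto|].
  intros y K; apply A1 in K; destruct K as (_ & _ & [K|[_ K]]).
  - apply (I y x n); apply app_iff; auto.
  - destruct (K _ H). }
exists a; split.
- apply in_seqs; split; [intros u Hu; apply Ha in Hu; tauto|].
  intros n Hn; destruct (classic (exists x, op x n ∈ j)) as [[x K]|K].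
  + rewrite (A2 _ _ K); apply HE, (J _ _ K).
  + rewrite (@ap_eq _ _ a n a0); auto.
    * apply A1; split; [auto|split; [auto|right; split; [auto|]]]. intros y L; eauto.
    * intros y L; apply A1 in L; destruct L as (_ & _ & [L|[-> _]]); [destruct K; eauto|auto].
- intros x Hx; destruct (J2 x Hx) as (n & K & _); apply app_iff in K.
  exists n; split; [apply (J _ _ K)|auto].
Qed.

Lemma is_comp_pcomp f g h : perm k f -> perm k g -> perm k h ->
  is_comp f g h <-> h = pcomp k f g.
Proof.
intros Hf Hg Hh; unfold is_comp; split.
- intro H; apply perm_ext with k; auto using perm_pcomp.
  intros x Hx; rewrite ap_pcomp; auto.
  assert (K : app h x (ap h x)) by (apply app_iff, perm_ap with k; auto).
  apply H in K; destruct K as (b & K & L); apply app_iff in K, L.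
  apply (perm_op _ _ Hg) in K; apply (perm_op _ _ Hf) in L.
  destruct K as [_ ->], L as [_ ->]; reflexivity.
- intros -> a c; rewrite app_iff, (perm_op _ _ Hh); split.
  + intros [Ha ->]; exists (ap g a); rewrite !app_iff, (perm_op _ _ Hf), (perm_op _ _ Hg).
    rewrite ap_pcomp; auto. split; [auto|split; [apply perm_ap; auto|auto]].
  + intros (b & K & L); rewrite app_iff in K, L.
    apply (perm_op _ _ Hg) in K; apply (perm_op _ _ Hf) in L.
    destruct K as [Ha ->], L as [_ ->]; rewrite ap_pcomp; auto.
Qed.

Lemma is_inv_pinv f g : perm k f -> perm k g -> is_inv f g <-> g = pinv f.
Proof.
intros Hf Hg; unfold is_inv; split.
- intro H; apply perm_ext with k; auto using perm_pinv.
  intros x Hx; assert (K : app g x (ap g x)) by (apply app_iff, perm_ap with k; auto).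
  apply H, app_iff in K; rewrite <- (in_pinv _ _ Hf) in K.
  apply (perm_op _ _ (perm_pinv Hf)) in K; tauto.
- intros -> a b; rewrite !app_iff; apply (in_pinv b a Hf).
Qed.

Lemma perm_app f x y : perm k f -> app f x y <-> x ∈ k /\ ap f x = y.
Proof.
intro Hf; rewrite app_iff, (perm_op _ _ Hf); split; intros []; auto.
Qed.

(** Induction on the generation of the filter. Intersections are handled by merging sequences, and
    conjugation by [f] turns the sequence [a] into f o a. *)
Lemma filter_seq a0 H : a0 ∈ k -> in_filter k H -> exists a, a ∈ seqs /\
  forall f, perm k f -> fixes f a -> f ∈ H.
Proof.
intro Ha0; induction 1 as [E H HE CE HF|H K _ (a & Ha & IH) _ S1|
  H K L _ (a & Ha & IHa) _ (b & Hb & IHb) HL|f H K _ (a & Ha & IH) Hf HK].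
- destruct (countable_seq Ha0 HE CE) as (a & Ha & A); exists a; split; [exact Ha|].
  intros f Hf Fa; apply HF; split; [exact Hf|].
  intros x Hx; destruct (A x Hx) as (n & Hn & <-); apply perm_app; auto.
- exists a; split; [exact Ha|]; intros f Hf Fa; apply S1; auto.
- destruct (seq_merge Ha Hb) as (c & Hc & C); exists c; split; [exact Hc|].
  intros f Hf Fc; apply HL; destruct (C f Fc); auto.
- assert (D : DT (fun e => ap f (ap a (e 0)))) by dfn.
  assert (Ha' : forall n, n ∈ om -> ap a n ∈ k) by (intros n Hn; apply in_seqs in Ha; apply Ha, Hn).
  exists (graph (fun n => ap f (ap a n)) om); split.
  { apply seq_graph; [exact D|]. intros n Hn; apply perm_ap; auto. }
  intros h Hh Fh; apply HK.
  pose proof (perm_pinv Hf) as Hf'.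
  (* If [h] fixes the sequence f o a, then f^-1 h f fixes [a], and [h] is its conjugate by [f]. *)
  assert (Hg : perm k (pcomp k (pinv f) (pcomp k h f))) by auto using perm_pcomp.
  exists (pcomp k (pinv f) (pcomp k h f)); split.
  + apply IH; [exact Hg|]. intros n Hn.
    rewrite !ap_pcomp; auto.
    specialize (Fh n Hn); rewrite ap_graph in Fh; auto. rewrite Fh; apply pinv_l with k; auto.
  + assert (Hm : perm k (pcomp k h f)) by auto using perm_pcomp.
    exists (pinv f), (pcomp k h f).
    split; [exact Hf'|split; [exact Hm|split; [exact Hh|split; [|split]]]].
    * apply is_inv_pinv; auto.
    * apply is_comp_pcomp; auto.
      apply perm_ext with k; auto using perm_pcomp.
      intros x Hx; rewrite ap_pcomp, ap_pcomp, (ap_pcomp (k := k) (pinv f)); auto.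
      assert (Kx : ap f x ∈ k) by (apply perm_ap; auto).
      rewrite ap_pcomp, pinv_r with (k := k); auto; apply perm_ap; auto.
    * apply is_comp_pcomp; auto.
      apply perm_ext with k; auto using perm_pcomp.
      intros x Hx; assert (Kx : ap (pinv f) x ∈ k) by (apply perm_ap; auto).
      rewrite ap_pcomp, ap_pcomp, pinv_r with (k := k); auto.
Qed.

Definition supp a x : Prop :=
  a ∈ seqs /\ forall f, perm k f -> fixes f a -> act f x = x.

(** Each element of the range is injected into omega by its least index. *)
Lemma countable_range a : a ∈ seqs ->
  exists E, countable E /\ forall x, x ∈ E <-> exists n, n ∈ om /\ x = ap a n.
Proof.
intro Ha.
destruct (@isset_image _ _ (fun n => ap a n) om) as [E HE]; [dfn|].
exists E; split; [|exact HE].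
destruct (@isset_sep_in _ _ (fun u => exists x n, u = op x n /\ x = ap a n /\
  forall m, m ∈ n -> ap a m <> x) (prod E om)) as [j Hj]; [dfn|].
assert (J : forall x n, app j x n <-> x ∈ E /\ n ∈ om /\ x = ap a n /\
  forall m, m ∈ n -> ap a m <> x).
{ intros x n; rewrite app_iff, Hj, in_prod_op; split.
  - intros [[Hx Hn] (x' & n' & K & L)]; apply op_inj in K; destruct K; subst; auto.
  - intros (Hx & Hn & L); split; [auto|]. exists x, n; auto. }
exists om, j; split; [exact om_omega|]. split; [split|].
- intros u Hu; apply Hj in Hu; destruct Hu as [Hu _]; apply in_prod in Hu.
  destruct Hu as (x & n & Hx & Hn & ->); exists x, n; rewrite is_opair_op; auto.
- intros x Hx; apply HE in Hx as K; destruct K as (n & Hn & E1).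
  destruct (@mem_min _ _ (fun m => m ∈ om /\ x = ap a m) n) as (m & [Hm Em] & L); auto.
  assert (Hjm : app j x m).
  { apply J; repeat split; auto. intros i Hi Ei; apply (L i Hi); split; [|auto].
    apply in_om in Hm; destruct Hm as [c ->]; apply in_num in Hi; destruct Hi as (d & _ & ->).
    apply num_om. }
  exists m; split; [exact Hjm|].
  intros m' K; apply J in K, Hjm; destruct K as (_ & Hm' & E' & K), Hjm as (_ & _ & _ & K2).
  apply in_om in Hm, Hm'; destruct Hm as [c ->], Hm' as [d ->].
  destruct (Nat.lt_trichotomy c d) as [N|[->|N]]; auto.
  + destruct (K (num c)); [apply in_num; eauto|auto].
  + destruct (K2 (num d)); [apply in_num; eauto|auto].
- intros x x' n H K; apply J in H, K; destruct H as (_ & _ & -> & _), K as (_ & _ & -> & _).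
  reflexivity.
Qed.

Lemma isset_perms P : Def (fun e => P (e 0)) -> isset (fun f => perm k f /\ P f).
Proof.
intro H; destruct (@isset_sep_in _ _ P (perms k) H) as [s Hs].
exists s; intro f; now rewrite Hs, in_perms.
Qed.

(** The stabiliser of a name is a subgroup, so it belongs to the filter once it contains the
    pointwise stabiliser of the range of a sequence; the converse is [filter_seq]. A nonempty [k]
    guarantees that sequences exist. *)
Lemma symmetric_iff x : name x -> (exists a0, a0 ∈ k) ->
  symmetric k x <-> exists a, supp a x.
Proof.
intros Hx [a0 Ha0]; split.
- intros (H & H1 & H2); destruct (filter_seq Ha0 H2) as (a & Ha & A).
  exists a; split; [exact Ha|]. intros f Hf Fa; symmetry; apply name_act_iff, H1; auto.
- intros (a & Ha & A).
  destruct (@isset_perms (fun f => act f x = x)) as [H HH]; [dfn|].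
  exists H; split.
  { intro f; rewrite HH, name_act_iff; split; intros []; auto. }
  destruct (countable_range Ha) as (E & CE & HE).
  destruct (@isset_perms (fun f => forall y, y ∈ E -> app f y y)) as [F HF].
  { unfold app, is_opair, is_pair; dfn. }
  assert (SE : subset E k).
  { intros y Hy; apply HE in Hy; destruct Hy as (n & Hn & ->); apply in_seqs in Ha; apply Ha, Hn. }
  apply (@filter_up M k F H).
  + apply (@filter_gen M k E F); auto.
  + split; [|split; [|split]].
    * intros f Hf; apply HH, Hf.
    * intros f Hf Fi; apply HH; split; [exact Hf|].
      replace f with (pid k); [apply act_pid, Hx|].
      apply perm_ext with k; auto using perm_pid.
      intros y Hy; rewrite ap_pid; auto. specialize (Fi y Hy); apply perm_app in Fi; intuition.
    * intros f g h Hf Hg Hh C; apply HH in Hf, Hg; destruct Hf as [Hf Ef], Hg as [Hg Eg].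
      apply is_comp_pcomp in C; auto; subst h.
      apply HH; split; [exact Hh|]. rewrite <- act_pcomp, Eg; auto.
    * intros f g Hf Hg C; apply HH in Hf; destruct Hf as [Hf Ef].
      apply is_inv_pinv in C; auto; subst g; apply HH; split; [exact Hg|].
      rewrite <- Ef at 1; apply act_pinv_l; auto.
  + intros f Hf; apply HF in Hf; destruct Hf as [Hf Fi]; apply HH; split; [exact Hf|].
    apply A; [exact Hf|]. intros n Hn.
    assert (K : app f (ap a n) (ap a n)) by (apply Fi, HE; eauto).
    apply perm_app in K; tauto.
Qed.

(** The sequence f o a works: if [h] fixes it, then f^-1 h f fixes [a] and hence [x], so [h] fixes
    the image of [x]. *)
Lemma supp_act a x f : perm k f -> name x -> supp a x -> exists b, supp b (act f x).
Proof.
intros Hf Hx [Ha A].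
assert (Ha' : forall n, n ∈ om -> ap a n ∈ k) by (intros n Hn; apply in_seqs in Ha; apply Ha, Hn).
assert (D : DT (fun e => ap f (ap a (e 0)))) by dfn.
pose proof (perm_pinv Hf) as Hf'.
exists (graph (fun n => ap f (ap a n)) om); split.
- apply seq_graph; [exact D|]. intros n Hn; apply perm_ap; auto.
- intros h Hh Fh.
  assert (E : act (pcomp k (pinv f) (pcomp k h f)) x = x).
  { apply A; [auto using perm_pcomp|]. intros n Hn.
    rewrite !ap_pcomp; auto.
    specialize (Fh n Hn); rewrite ap_graph in Fh; auto. rewrite Fh; apply pinv_l with k; auto. }
  rewrite <- !act_pcomp in E; auto using perm_pcomp.
  rewrite <- E at 2; rewrite act_pinv_r; auto using name_act_name.
Qed.

Lemma supp_merge a b x y : supp a x -> supp b y -> exists c, c ∈ seqs /\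
  forall f, perm k f -> fixes f c -> act f x = x /\ act f y = y.
Proof.
intros [Ha A] [Hb B]; destruct (seq_merge Ha Hb) as (c & Hc & C).
exists c; split; [exact Hc|]. intros f Hf Fc; destruct (C f Fc); auto.
Qed.

Lemma HS_iff x : HS om k x <->
  name x /\ symmetric k x /\ forall y p, op y p ∈ x -> HS om k y.
Proof.
split.
- intros [z H1 H2 H3]; split; [auto|split; [auto|]].
  intros y p H; apply (H3 (op y p) y p H); apply is_opair_op; auto.
- intros (H1 & H2 & H3); constructor; auto.
  intros u y p Hu E; apply is_opair_op in E; subst; eauto.
Qed.

Lemma HS_name x : HS om k x -> name x.
Proof. intro H; apply HS_iff in H; tauto. Qed.

Lemma HS_op x y p : HS om k x -> op y p ∈ x -> HS om k y /\ cnd p.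
Proof.
intros H K; apply HS_iff in H; destruct H as (H1 & H2 & H3); split; [eauto|].
apply (name_op H1 K).
Qed.

Lemma HS_supp x : (exists a0, a0 ∈ k) -> HS om k x -> exists a, supp a x.
Proof.
intros N H; apply HS_iff in H; destruct H as (H1 & H2 & H3); apply symmetric_iff; auto.
Qed.

Lemma HS_intro_supp x a : (exists a0, a0 ∈ k) -> supp a x ->
  (forall u, u ∈ x -> exists y p, u = op y p /\ HS om k y /\ cnd p) -> HS om k x.
Proof.
intros N A H.
assert (Hx : name x).
{ apply name_iff; intros u Hu; destruct (H u Hu) as (y & p & E & K & L).
  exists y, p; auto using HS_name. }
apply HS_iff; split; [exact Hx|split].
- apply symmetric_iff; eauto.
- intros y p K; destruct (H _ K) as (y' & p' & E & L & _); apply op_inj in E.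
  destruct E; subst; auto.
Qed.

Lemma HS_act f x : (exists a0, a0 ∈ k) -> perm k f -> HS om k x -> HS om k (act f x).
Proof.
intros N Hf; induction x as [x IH] using name_induction; intro Hx.
destruct (HS_supp N Hx) as [a A]; destruct (supp_act Hf (HS_name Hx) A) as [b B].
apply (HS_intro_supp N B).
intros u Hu; apply in_act in Hu; destruct Hu as (y & p & K & ->).
destruct (HS_op Hx K); exists (act f y), (cact f p); split; [auto|split; [eauto|]].
apply cond_cact; auto.
Qed.

Lemma const_seq : (exists a0, a0 ∈ k) -> exists a, a ∈ seqs.
Proof.
intros [a0 Ha0]; exists (graph (fun _ => a0) om); apply seq_graph; auto; dfn.
Qed.

End Names.

Ltac dhintE :=
  lazymatch goal with
  | |- DT (fun e => act _ _) => apply DT_act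
  | |- Def (fun e => fixes _ _) => unfold fixes
  | |- _ => dhintD
  end.
Ltac dhint ::= dhintE.

(** * Canonical names: pairs, check names, Cohen reals *)

Section SpecialNames.
Context {M : estruct} {gr : Ground M}.
Variable k : M.
Hypothesis kn : exists a0, a0 ∈ k.
Implicit Types (x y z u v f g h p q a b n i : M) (P : M -> Prop).
Notation cnd := (cond om k).
Notation name := (is_name om k).
Notation hsn := (HS om k).

(** Both entries carry the empty condition, which lies in every generic filter and is fixed by every
    permutation. *)
Definition npair x y : M := up (op x emp) (op y emp).
Definition nop x y : M := npair (npair x x) (npair x y).

Lemma act_npair f x y : act f (npair x y) = npair (act f x) (act f y).
Proof.
apply ext; intro u; unfold npair; rewrite in_act, in_up; split.
- intros (a & p & H & ->); apply in_up in H.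
  destruct H as [H|H]; apply op_inj in H; destruct H as [-> ->]; rewrite cact_emp; auto.
- intros [->| ->]; [exists x, emp|exists y, emp]; rewrite cact_emp, in_up; auto.
Qed.

Lemma act_nop f x y : act f (nop x y) = nop (act f x) (act f y).
Proof. unfold nop; now rewrite !act_npair. Qed.

Lemma HS_npair x y : hsn x -> hsn y -> hsn (npair x y).
Proof.
intros Hx Hy; destruct (HS_supp kn Hx) as [a A], (HS_supp kn Hy) as [b B].
destruct (supp_merge A B) as (c & Hc & C).
apply (@HS_intro_supp _ _ _ _ c kn).
- split; [exact Hc|]. intros f Hf Fc; rewrite act_npair.
  destruct (C f Hf Fc) as [-> ->]; reflexivity.
- intros u Hu; apply in_up in Hu; destruct Hu as [->| ->]; eauto 6 using cond_emp.
Qed.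

Lemma HS_nop x y : hsn x -> hsn y -> hsn (nop x y).
Proof. intros; apply HS_npair; apply HS_npair; assumption. Qed.

Lemma isset_chk_step x g : isset (fun u => exists y, y ∈ x /\ u = op (ap g y) emp).
Proof. apply (@isset_image _ _ (fun y => op (ap g y) emp)); dfn. Qed.

Lemma chk_exists : exists F : M -> M, DT (fun e => F (e 0)) /\
  forall x, F x = comp (fun u => exists y, y ∈ x /\ u = op (F y) emp).
Proof.
destruct (@recursion _ _ (fun _ x g => comp (fun u => exists y, y ∈ x /\ u = op (ap g y) emp)))
  as (F & D & H).
{ apply DT_comp; [intro; apply isset_chk_step|dfn]. }
assert (D' : DT (fun e => F emp (e 0))) by (apply (DT_fun2 D); dfn).
exists (F emp); split; [exact D'|].
intro x; rewrite H; apply comp_eq; intro u; rewrite in_comp.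
- split; intros (y & Hy & ->); exists y; (split; [exact Hy|]);
    rewrite ap_restr; auto using tc_sub.
- apply (@isset_image _ _ (fun y => op (F emp y) emp)).
  apply DT_op; [exact D'|dfn].
Qed.

Definition chk : M -> M := proj1_sig (constructive_indefinite_description _ chk_exists).

Lemma DT_chk (t : (nat -> M) -> M) : DT t -> DT (fun e => chk (t e)).
Proof.
apply DT_fun1; unfold chk; destruct constructive_indefinite_description as [F H]; apply H.
Qed.

Ltac dhint ::=
  lazymatch goal with
  | |- DT (fun e => chk _) => apply DT_chk
  | |- DT (fun e => npair _ _) => unfold npair
  | |- DT (fun e => nop _ _) => unfold nop
  | |- _ => dhintE
  end.

Lemma in_chk x u : u ∈ chk x <-> exists y, y ∈ x /\ u = op (chk y) emp.
Proof.
assert (E : chk x = comp (fun u => exists y, y ∈ x /\ u = op (chk y) emp)).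
{ unfold chk; destruct constructive_indefinite_description as [F H]; apply H. }
rewrite E, in_comp; [tauto|].
apply (@isset_image _ _ (fun y => op (chk y) emp)); dfn.
Qed.

Lemma is_check_iff x : forall x', is_check x x' <-> x' = chk x.
Proof.
induction x as [x IH] using mem_ind; intro x'; split.
- intro H; destruct H as [x x' H1 H2]; apply ext; intro u; rewrite in_chk; split.
  + intro Hu; destruct (H2 u Hu) as (y & y' & o & Hy & E & K & L).
    apply is_opair_op in E; apply is_empty_emp in L; apply (IH y Hy) in K; subst; eauto.
  + intros (y & Hy & ->); destruct (H1 y Hy) as (u & y' & o & Hu & E & K & L).
    apply is_opair_op in E; apply is_empty_emp in L; apply (IH y Hy) in K; subst; auto.
- intros ->; constructor.
  + intros y Hy; exists (op (chk y) emp), (chk y), emp.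
    rewrite in_chk, is_opair_op, (IH y Hy), is_empty_emp; eauto 6.
  + intros u Hu; apply in_chk in Hu; destruct Hu as (y & Hy & ->).
    exists y, (chk y), emp; rewrite is_opair_op, (IH y Hy), is_empty_emp; auto.
Qed.

Lemma act_chk f x : act f (chk x) = chk x.
Proof.
induction x as [x IH] using mem_ind; apply ext; intro u; rewrite in_act, in_chk; split.
- intros (y & p & H & ->); apply in_chk in H; destruct H as (z & Hz & E).
  apply op_inj in E; destruct E; subst; rewrite cact_emp, IH; eauto.
- intros (y & Hy & ->); exists (chk y), emp; rewrite cact_emp, IH, in_chk; eauto.
Qed.

Lemma HS_chk x : hsn (chk x).
Proof.
induction x as [x IH] using mem_ind; destruct (const_seq kn) as [a Ha].
apply (@HS_intro_supp _ _ _ _ a kn).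
- split; [exact Ha|]. intros; apply act_chk.
- intros u Hu; apply in_chk in Hu; destruct Hu as (y & Hy & ->); eauto 6 using cond_emp.
Qed.

Definition cn a : M := comp (fun u => exists n p, n ∈ om /\ p ∈ conds k /\
  op (op a n) (sg emp) ∈ p /\ u = op (chk n) p).

Lemma isset_cn a : isset (fun u => exists n p, n ∈ om /\ p ∈ conds k /\
  op (op a n) (sg emp) ∈ p /\ u = op (chk n) p).
Proof.
destruct (@isset_image _ _ chk om) as [s Hs]; [dfn|].
apply (isset_sep (x := prod s (conds k))); [dfn|].
intros z (n & p & Hn & Hp & H & ->); apply in_prod_op; split; [apply Hs; eauto|auto].
Qed.

Lemma in_cn a u : u ∈ cn a <-> exists n p, n ∈ om /\ cnd p /\
  op (op a n) (sg emp) ∈ p /\ u = op (chk n) p.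
Proof.
unfold cn; rewrite in_comp; [|apply isset_cn].
split; intros (n & p & Hn & Hp & H & ->); apply in_conds in Hp; eauto 8.
Qed.

Lemma DT_cn (t : (nat -> M) -> M) : DT t -> DT (fun e => cn (t e)).
Proof. apply DT_fun1; apply DT_comp; [intro; apply isset_cn|dfn]. Qed.

Lemma is_cohen_name_iff a c : is_cohen_name om k a c <-> c = cn a.
Proof.
assert (W : forall u, (exists n n' p t i, n ∈ om /\ is_check n n' /\ cond om k p /\
    t ∈ p /\ is_triple t a n i /\ is_one i /\ is_opair u n' p) <-> u ∈ cn a).
{ intro u; rewrite in_cn; split.
  - intros (n & n' & p & t & i & Hn & C & Hp & Ht & T & I & O).
    apply is_check_iff in C; apply is_triple_iff in T; apply is_one_iff in I.
    apply is_opair_op in O; subst; eauto 8.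
  - intros (n & p & Hn & Hp & H & ->).
    exists n, (chk n), p, (op (op a n) (sg emp)), (sg emp).
    rewrite is_check_iff, is_triple_iff, is_one_iff, is_opair_op; auto 8. }
unfold is_cohen_name; split.
- intro H; apply ext; intro u; now rewrite (H u).
- intros -> u; now rewrite W.
Qed.

Lemma act_cn f a : perm k f -> a ∈ k -> act f (cn a) = cn (ap f a).
Proof.
intros Hf Ha; apply ext; intro u; rewrite in_act, in_cn; split.
- intros (y & p & H & ->); apply in_cn in H; destruct H as (n & p' & Hn & Hp & H & E).
  apply op_inj in E; destruct E; subst.
  exists n, (cact f p'); rewrite act_chk; split; [exact Hn|split; [apply cond_cact; auto|]].
  split; [|reflexivity]. apply in_cact; exists a, (ap f a), n, (sg emp).
  split; [exact H|split; [apply perm_ap with k; auto|reflexivity]].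
- intros (n & p & Hn & Hp & H & ->).
  exists (chk n), (cact (pinv f) p); rewrite act_chk, (cact_pinv_r (k := k)); auto.
  split; [|reflexivity]. apply in_cn.
  exists n, (cact (pinv f) p); split; [exact Hn|]. split; [apply cond_cact; auto using perm_pinv|].
  split; [|reflexivity]. apply in_cact; exists (ap f a), a, n, (sg emp).
  split; [exact H|split; [|reflexivity]].
  apply in_pinv with k; auto; apply perm_ap with k; auto.
Qed.

Lemma HS_cn a : a ∈ k -> hsn (cn a).
Proof.
intro Ha; assert (D : DT (fun _ : nat -> M => a)) by dfn.
apply (@HS_intro_supp _ _ _ _ (graph (fun _ => a) om) kn).
- split; [apply seq_graph; auto|].
  intros f Hf Fi; rewrite act_cn; auto.
  specialize (Fi (num 0) (num_om 0)); rewrite ap_graph in Fi; auto using num_om.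
  now rewrite Fi.
- intros u Hu; apply in_cn in Hu; destruct Hu as (n & p & Hn & Hp & _ & ->).
  eauto using HS_chk.
Qed.

Definition pn n a : M := nop (chk n) (cn a).

Lemma act_pn f n a : perm k f -> a ∈ k -> act f (pn n a) = pn n (ap f a).
Proof. intros; unfold pn; now rewrite act_nop, act_chk, act_cn. Qed.

Lemma HS_pn n a : a ∈ k -> hsn (pn n a).
Proof. intro; apply HS_nop; auto using HS_chk, HS_cn. Qed.

End SpecialNames.

Ltac dhintF :=
  lazymatch goal with
  | |- DT (fun e => chk _) => apply DT_chk
  | |- DT (fun e => npair _ _) => unfold npair
  | |- DT (fun e => nop _ _) => unfold nop
  | |- DT (fun e => cn _ _) => apply DT_cn
  | |- DT (fun e => pn _ _ _) => unfold pn
  | |- _ => dhintE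
  end.
Ltac dhint ::= dhintF.

(** * Forcing equality and membership; evaluation of names *)

Section Forcing.
Context {M : estruct} {gr : Ground M}.
Variable k : M.
Hypothesis kn : exists a0, a0 ∈ k.
Implicit Types (x y z u v f g h p q r s a b n i : M) (P : M -> Prop).
Notation cnd := (cond om k).
Notation name := (is_name om k).
Notation hsn := (HS om k).

(** One unfolding of the forcing clause for equality, with [Q] in place of equality of the elements:
    densely below [p], an element present in one name is matched by an element present in the
    other. *)
Definition fstep (Q : M -> M -> M -> Prop) p x y : Prop :=
  cnd p /\
  (forall u q r, op u q ∈ x -> cnd r -> subset p r -> subset q r ->
    exists r' v s, cnd r' /\ subset r r' /\ op v s ∈ y /\ subset s r' /\ Q r' u v) /\
  (forall v s r, op v s ∈ y -> cnd r -> subset p r -> subset s r ->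
    exists r' u q, cnd r' /\ subset r r' /\ op u q ∈ x /\ subset q r' /\ Q r' u v).

Definition fbisim R : Prop :=
  forall p x y, op (op x y) p ∈ R -> fstep (fun p x y => op (op x y) p ∈ R) p x y.

(* [p] forces [x = y]: a greatest fixed point, so that definability over the
   ground model needs no recursion on names. *)
Definition feq p x y : Prop := exists R, fbisim R /\ op (op x y) p ∈ R.

Lemma fstep_mono (Q Q' : M -> M -> M -> Prop) p x y :
  (forall p u v q s, op u q ∈ x -> op v s ∈ y -> cnd p -> Q p u v -> Q' p u v) ->
  fstep Q p x y -> fstep Q' p x y.
Proof.
intros H (K1 & K2 & K3); split; [exact K1|split].
- intros u q r Hu Hr H1 H2; destruct (K2 u q r Hu Hr H1 H2) as (r' & v & s & A & B & C & D & E).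
  exists r', v, s; eauto 8.
- intros v s r Hu Hr H1 H2; destruct (K3 v s r Hu Hr H1 H2) as (r' & u & q & A & B & C & D & E).
  exists r', u, q; eauto 8.
Qed.

Lemma feq_step p x y : feq p x y -> fstep feq p x y.
Proof.
intros (R & HR & K); apply (@fstep_mono (fun p x y => op (op x y) p ∈ R)); [|auto].
intros p' u v q s _ _ _ L; exists R; auto.
Qed.

Lemma Def_feq (t s u : (nat -> M) -> M) : DT t -> DT s -> DT u ->
  Def (fun e => feq (t e) (s e) (u e)).
Proof.
apply (@Def_rel3 M feq); unfold feq, fbisim, fstep; dfn.
Qed.

Ltac dhint ::=
  lazymatch goal with
  | |- Def (fun e => feq _ _ _) => apply Def_feq
  | |- _ => dhintF
  end.

(** Coinduction: [feq] restricted to the closures of [x] and [y], with the triple for [x], [y], [p]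
    adjoined, is again a bisimulation. The restriction is what makes this relation a set of the
    model. *)
Lemma feq_fold p x y : fstep feq p x y -> feq p x y.
Proof.
intro H.
pose (tx := cup (tc x) (sg x)); pose (ty := cup (tc y) (sg y)).
assert (T : forall z u v q, u ∈ cup (tc z) (sg z) -> op v q ∈ u -> v ∈ cup (tc z) (sg z)).
{ intros z u v q Hu Hv; apply in_cup; left; apply in_cup in Hu; destruct Hu as [Hu|Hu].
  - exact (tc_mono Hu (op_tc Hv)).
  - apply in_sg in Hu; subst; exact (op_tc Hv). }
destruct (@isset_sep _ _ (fun w => exists x' y' p', w = op (op x' y') p' /\
  x' ∈ tx /\ y' ∈ ty /\ p' ∈ conds k /\ (feq p' x' y' \/ x' = x /\ y' = y /\ p' = p))
  (prod (prod tx ty) (conds k))) as [R HR].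
{ dfn. }
{ intros w (x' & y' & p' & -> & H1 & H2 & H3 & _); rewrite !in_prod_op; auto. }
exists R; split.
- intros p' x' y' K; apply HR in K; destruct K as (x1 & y1 & p1 & E & H1 & H2 & H3 & K).
  apply op_inj in E; destruct E as [E ->]; apply op_inj in E; destruct E as [-> ->].
  apply (@fstep_mono feq).
  + intros p2 u v q s Hu Hv Hp2 L; apply HR; exists u, v, p2; split; [reflexivity|].
    split; [exact (T _ _ _ _ H1 Hu)|split; [exact (T _ _ _ _ H2 Hv)|]].
    split; [apply in_conds, Hp2|auto].
  + destruct K as [K|(-> & -> & ->)]; [apply feq_step, K|exact H].
- apply HR; exists x, y, p; unfold tx, ty; rewrite !in_cup, !in_sg, in_conds.
  repeat split; auto; apply H.
Qed.

Lemma sub_trans x y z : subset x y -> subset y z -> subset x z.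
Proof. intros H K u Hu; auto. Qed.

Lemma feq_mono p q x y : feq p x y -> cnd q -> subset p q -> feq q x y.
Proof.
intros H Hq S; apply feq_step in H; destruct H as (H1 & H2 & H3); apply feq_fold.
split; [exact Hq|split].
- intros u q' r Hu Hr A B; exact (H2 u q' r Hu Hr (sub_trans S A) B).
- intros u q' r Hu Hr A B; exact (H3 u q' r Hu Hr (sub_trans S A) B).
Qed.

Lemma sub_pinv f p q : perm k f -> cnd p -> subset (cact f p) q -> subset p (cact (pinv f) q).
Proof.
intros Hf Hp H; rewrite <- (cact_pinv_l Hf Hp); apply cact_mono, H.
Qed.

Lemma sub_act f p q : perm k f -> cnd q -> subset (cact (pinv f) q) p -> subset q (cact f p).
Proof.
intros Hf Hp H; rewrite <- (cact_pinv_r Hf Hp); apply cact_mono, H.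
Qed.

(** The symmetry lemma: an extension of [cact f p] is pulled back along [pinv f], answered there,
    and the answer is pushed forward. *)
Lemma feq_act f x : forall p y, perm k f -> name x -> name y -> feq p x y ->
  feq (cact f p) (act f x) (act f y).
Proof.
induction x as [x IH] using name_induction; intros p y Hf Hx Hy H.
apply feq_step in H; destruct H as (Hp & H1 & H2); apply feq_fold.
split; [apply cond_cact; auto|split].
- intros u' q' r Hu' Hr A B; apply in_act in Hu'; destruct Hu' as (u & q & Hu & E).
  apply op_inj in E; destruct E; subst; destruct (name_op Hx Hu) as [Nu Hq].
  destruct (H1 u q (cact (pinv f) r)) as (r' & v & s & R1 & R2 & R3 & R4 & R5); auto.
  { apply cond_cact; auto using perm_pinv. }
  { apply sub_pinv; auto. }
  { apply sub_pinv; auto. }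
  destruct (name_op Hy R3) as [Nv Hs].
  exists (cact f r'), (act f v), (cact f s); split; [apply cond_cact; auto|].
  split; [apply sub_act; auto|split; [apply op_in_act, R3|]].
  split; [apply cact_mono, R4|]. eapply IH; eauto.
- intros u' q' r Hu' Hr A B; apply in_act in Hu'; destruct Hu' as (v & s & Hv & E).
  apply op_inj in E; destruct E; subst; destruct (name_op Hy Hv) as [Nv Hs].
  destruct (H2 v s (cact (pinv f) r)) as (r' & u & q & R1 & R2 & R3 & R4 & R5); auto.
  { apply cond_cact; auto using perm_pinv. }
  { apply sub_pinv; auto. }
  { apply sub_pinv; auto. }
  destruct (name_op Hx R3) as [Nu Hq].
  exists (cact f r'), (act f u), (cact f q); split; [apply cond_cact; auto|].
  split; [apply sub_act; auto|split; [apply op_in_act, R3|]].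
  split; [apply cact_mono, R4|]. eapply IH; eauto.
Qed.

(** This is stronger than forcing membership, as one element of [x] already present at [p] has to be
    the witness. It has the same truth lemma, which asks only for some condition in the generic
    filter. *)
Definition fmem p z x : Prop := exists y q, op y q ∈ x /\ subset q p /\ feq p y z.

Lemma fmem_mono p q z x : fmem p z x -> cnd q -> subset p q -> fmem q z x.
Proof.
intros (y & s & H & K & L) Hq S; exists y, s; split; [exact H|].
split; [exact (sub_trans K S)|exact (feq_mono L Hq S)].
Qed.

Lemma fmem_act f p z x : perm k f -> name z -> name x -> fmem p z x ->
  fmem (cact f p) (act f z) (act f x).
Proof.
intros Hf Hz Hx (y & q & H & K & L); exists (act f y), (cact f q).
split; [apply op_in_act, H|split; [apply cact_mono, K|]].
apply feq_act; auto. apply (name_op Hx H).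
Qed.

Variable G : M -> Prop.
Hypothesis HG : generic om k G.

Lemma G_cond p : G p -> cnd p.
Proof. apply (gen_cond HG). Qed.

Lemma G_emp : G emp.
Proof.
destruct (gen_inhabited HG) as [p Hp]; apply (gen_up HG Hp); [apply cond_emp|].
intros z Hz; destruct (in_emp Hz).
Qed.

Lemma G_join p q : G p -> G q -> exists r, G r /\ subset p r /\ subset q r.
Proof. apply (gen_directed HG). Qed.

Lemma sub_refl x : subset x x.
Proof. intros z Hz; exact Hz. Qed.

(** The conditions in [P], together with those having no extension in [P], form a dense set of the
    model. *)
Lemma generic_decides P : Def (fun e => P (e 0)) ->
  (exists p, G p /\ P p) \/
  (exists p, G p /\ forall q, cnd q -> subset p q -> ~ P q).
Proof.
intro HP.
assert (HP' : Def (fun e => P (e 1))).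
{ exact (Def_subst (fun j => inl (match j with 0 => 1 | S j => S (S j) end)) HP). }
destruct (@isset_sep_in _ _ (fun p => P p \/ forall q, cnd q -> subset p q -> ~ P q) (conds k))
  as [D HD].
{ apply Def_or; [exact HP|].
  apply (@Def_all M (fun e q => cnd q -> subset (e 0) q -> ~ P q)).
  apply Def_imp; [dfn|]. apply Def_imp; [dfn|]. apply Def_not; exact HP. }
destruct (gen_dense HG (D := D)) as (p & Hp & Gp).
- intros p Hp; apply HD in Hp; apply in_conds; tauto.
- intros p Hp; destruct (classic (exists q, cnd q /\ subset p q /\ P q)) as [(q & Hq & S & K)|N].
  + exists q; rewrite HD, in_conds; auto.
  + exists p; rewrite HD, in_conds; split; [split; [exact Hp|right]|apply sub_refl].
    intros q Hq S K; apply N; eauto.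
- apply HD in Hp; destruct Hp as [_ [Hp|Hp]]; eauto.
Qed.

(** Existence is where smallness enters: the elements of [x] are indexed by a type of the ambient
    universe, so their values form a set there. *)
Lemma eval_unique x : exists v : iset, eval G x v /\ forall v' : iset, eval G x v' -> v' = v.
Proof.
induction x as [x IH] using name_induction.
destruct (gr_small x) as (I0 & c & Hc).
pose (I := {o : I0 | exists y p, c o = op y p /\ op y p ∈ x /\ G p}).
(* The empty tree only makes [epsilon] total; by induction every name occurring in [x] does have a
   value. *)
destruct (@imem_range I (fun o => epsilon (inhabits (iset_of (node (fun e : False => match e with end))))
   (eval G (pr1 (c (proj1_sig o)))))) as [v Hv].
assert (E : forall y p, op y p ∈ x -> eval G y (epsilon
  (inhabits (iset_of (node (fun e : False => match e with end)))) (eval G y))).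
{ intros y p H; apply epsilon_spec; destruct (IH y p H) as (w & K & _); eauto. }
assert (U : forall y p w w', op y p ∈ x -> eval G y w -> eval G y w' -> w = w').
{ intros y p w w' H K K'; destruct (IH y p H) as (w0 & _ & L).
  rewrite (L _ K), (L _ K'); reflexivity. }
assert (EV : eval G x v).
{ constructor.
  - intros u y p Hu O Gp; apply is_opair_op in O; subst.
    eexists; split; [|apply (E y p Hu)].
    apply Hv; destruct (Hc _ Hu) as [i Hi].
    exists (exist _ i (ex_intro _ y (ex_intro _ p (conj (eq_sym Hi) (conj Hu Gp))))); simpl.
    rewrite <- Hi, pr1_op; reflexivity.
  - intros z Hz; apply Hv in Hz; destruct Hz as [[i (y & p & Hi & Hu & Gp)] ->]; simpl.
    rewrite Hi, pr1_op.
    exists (op y p), y, p; rewrite is_opair_op; split; [exact Hu|split; [reflexivity|]].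
    split; [exact Gp|exact (E y p Hu)]. }
exists v; split; [exact EV|].
intros v' H'; destruct H' as [x v' H1 H2]; destruct EV as [x v K1 K2].
apply imem_ext; intro z; split; intro Hz.
- destruct (H2 z Hz) as (u & y & p & Hu & O & Gp & L).
  destruct (K1 u y p Hu O Gp) as (z' & Hz' & L'); apply is_opair_op in O; subst.
  rewrite (U y p z z'); auto.
- destruct (K2 z Hz) as (u & y & p & Hu & O & Gp & L).
  destruct (H1 u y p Hu O Gp) as (z' & Hz' & L'); apply is_opair_op in O; subst.
  rewrite (U y p z z'); auto.
Qed.

Definition val x : iset :=
  proj1_sig (constructive_indefinite_description _ (eval_unique x)).

Lemma eval_iff x (v : iset) : eval G x v <-> v = val x.
Proof.
unfold val; destruct constructive_indefinite_description as [w [H K]]; simpl.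
split; [auto|intros ->; auto].
Qed.

Lemma in_val x (z : iset) : imem z (val x) <-> exists y p, op y p ∈ x /\ G p /\ z = val y.
Proof.
assert (E : eval G x (val x)) by (apply eval_iff; auto).
destruct E as [x v H1 H2]; split.
- intro Hz; destruct (H2 z Hz) as (u & y & p & Hu & O & Gp & L).
  apply is_opair_op in O; apply eval_iff in L; subst; eauto.
- intros (y & p & Hu & Gp & ->); destruct (H1 (op y p) y p Hu) as (z & Hz & L); auto.
  { apply is_opair_op; auto. }
  apply eval_iff in L; subst; auto.
Qed.

Lemma val_chk_inj x : forall y, val (chk x) = val (chk y) -> x = y.
Proof.
assert (A : forall x (z : iset), imem z (val (chk x)) <-> exists y, y ∈ x /\ z = val (chk y)).
{ intros a z; rewrite in_val; split.
  - intros (y & p & H & _ & ->); apply in_chk in H; destruct H as (b & Hb & E).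
    apply op_inj in E; destruct E; subst; eauto.
  - intros (y & Hy & ->); exists (chk y), emp; rewrite in_chk; eauto using G_emp. }
induction x as [x IH] using mem_ind; intros y E; apply ext; intro z; split; intro Hz.
- assert (K : imem (val (chk z)) (val (chk y))) by (rewrite <- E; apply A; eauto).
  apply A in K; destruct K as (z' & Hz' & K); rewrite (IH z Hz z' K); exact Hz'.
- assert (K : imem (val (chk z)) (val (chk x))) by (rewrite E; apply A; eauto).
  apply A in K; destruct K as (z' & Hz' & K); rewrite <- (IH z' Hz' z); auto.
Qed.

(** The conditions matching a given present [u] are dense below a member of [G], so [G] contains
    one, and the partner found there has the same value by induction. *)
Lemma feq_sound x : forall y p, G p -> name x -> name y -> feq p x y -> val x = val y.
Proof.
induction x as [x IH] using name_induction; intros y p Gp Hx Hy H.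
apply feq_step in H; destruct H as (_ & H1 & H2).
apply imem_ext; intro z; rewrite !in_val; split.
- intros (u & q & Hu & Gq & ->).
  destruct (@generic_decides (fun r => exists v s, op v s ∈ y /\ subset s r /\ feq r u v))
    as [(r & Gr & v & s & K1 & K2 & K3)|(p' & Gp' & N)]; [dfn| |].
  + exists v, s; split; [exact K1|split].
    * apply (gen_up HG Gr); [apply (name_op Hy K1)|exact K2].
    * apply (IH u q Hu v r); auto; [apply (name_op Hx Hu)|apply (name_op Hy K1)].
  + exfalso; destruct (G_join Gp Gq) as (r1 & Gr1 & S1 & S2).
    destruct (G_join Gr1 Gp') as (r & Gr & S3 & S4).
    destruct (H1 u q r Hu (G_cond Gr)) as (r' & v & s & K1 & K2 & K3 & K4 & K5);
      eauto using sub_trans.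
    apply (N r' K1); eauto using sub_trans.
- intros (v & s & Hv & Gs & ->).
  destruct (@generic_decides (fun r => exists u q, op u q ∈ x /\ subset q r /\ feq r u v))
    as [(r & Gr & u & q & K1 & K2 & K3)|(p' & Gp' & N)]; [dfn| |].
  + exists u, q; split; [exact K1|split].
    * apply (gen_up HG Gr); [apply (name_op Hx K1)|exact K2].
    * symmetry; apply (IH u q K1 v r); auto; [apply (name_op Hx K1)|apply (name_op Hy Hv)].
  + exfalso; destruct (G_join Gp Gs) as (r1 & Gr1 & S1 & S2).
    destruct (G_join Gr1 Gp') as (r & Gr & S3 & S4).
    destruct (H2 v s r Hv (G_cond Gr)) as (r' & u & q & K1 & K2 & K3 & K4 & K5);
      eauto using sub_trans.
    apply (N r' K1); eauto using sub_trans.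
Qed.

(** A failure is a condition at which some present element is matched by no later condition. Equal
    values exclude failures in [G], so some [p] in [G] has no failing extension, which is exactly
    the premise of [feq_fold]. *)
Lemma feq_complete x : forall y, name x -> name y -> val x = val y ->
  exists p, G p /\ feq p x y.
Proof.
induction x as [x IH] using name_induction; intros y Hx Hy E.
destruct (@generic_decides (fun p =>
  (exists u q, op u q ∈ x /\ subset q p /\
     forall v s r, op v s ∈ y -> cnd r -> subset p r -> subset s r -> ~ feq r u v) \/
  (exists v s, op v s ∈ y /\ subset s p /\
     forall u q r, op u q ∈ x -> cnd r -> subset p r -> subset q r -> ~ feq r u v)))
  as [(p & Gp & [(u & q & H & S & K)|(v & s & H & S & K)])|(p & Gp & N)]; [dfn| | |].
- exfalso.
  assert (Gq : G q) by (apply (gen_up HG Gp); [apply (name_op Hx H)|exact S]).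
  assert (L : imem (val u) (val y)) by (rewrite <- E; apply in_val; eauto).
  apply in_val in L; destruct L as (v & s & Hv & Gs & L).
  destruct (IH u q H v) as (r & Gr & R); auto; [apply (name_op Hx H)|apply (name_op Hy Hv)|].
  destruct (G_join Gp Gs) as (r1 & Gr1 & S1 & S2).
  destruct (G_join Gr1 Gr) as (r2 & Gr2 & S3 & S4).
  apply (K v s r2 Hv (G_cond Gr2)); eauto using sub_trans.
  apply (feq_mono R (G_cond Gr2) S4).
- exfalso.
  assert (Gs : G s) by (apply (gen_up HG Gp); [apply (name_op Hy H)|exact S]).
  assert (L : imem (val v) (val x)) by (rewrite E; apply in_val; eauto).
  apply in_val in L; destruct L as (u & q & Hu & Gq & L).
  destruct (IH u q Hu v) as (r & Gr & R); auto; [apply (name_op Hx Hu)|apply (name_op Hy H)|].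
  destruct (G_join Gp Gq) as (r1 & Gr1 & S1 & S2).
  destruct (G_join Gr1 Gr) as (r2 & Gr2 & S3 & S4).
  apply (K u q r2 Hu (G_cond Gr2)); eauto using sub_trans.
  apply (feq_mono R (G_cond Gr2) S4).
- exists p; split; [exact Gp|]. apply feq_fold; split; [exact (G_cond Gp)|split].
  + intros u q r Hu Hr S1 S2; apply NNPP; intro L; apply (N r Hr S1); left.
    exists u, q; split; [exact Hu|split; [exact S2|]].
    intros v s r' Hv Hr' S3 S4 K; apply L; exists r', v, s; auto.
  + intros v s r Hv Hr S1 S2; apply NNPP; intro L; apply (N r Hr S1); right.
    exists v, s; split; [exact Hv|split; [exact S2|]].
    intros u q r' Hu Hr' S3 S4 K; apply L; exists r', u, q; auto.
Qed.

Lemma fmem_truth z x : name z -> name x ->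
  imem (val z) (val x) <-> exists p, G p /\ fmem p z x.
Proof.
intros Hz Hx; rewrite in_val; split.
- intros (y & q & H & Gq & E).
  destruct (@feq_complete y z) as (p & Gp & K); auto; [apply (name_op Hx H)|].
  destruct (G_join Gp Gq) as (r & Gr & S1 & S2); exists r; split; [exact Gr|].
  exists y, q; split; [exact H|split; [exact S2|exact (feq_mono K (G_cond Gr) S1)]].
- intros (p & Gp & y & q & H & S & K); exists y, q; split; [exact H|].
  destruct (name_op Hx H); split; [apply (gen_up HG Gp); auto|].
  symmetry; eapply feq_sound; eauto.
Qed.

(** Any condition extends, at a fresh place, by the digit 1 for [a] and 0 for [b]; a generic filter
    therefore contains a condition separating the two reals. *)
Lemma val_cn_inj a b : a ∈ k -> b ∈ k -> val (cn k a) = val (cn k b) -> a = b.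
Proof.
intros Ha Hb E; apply NNPP; intro Nab.
destruct (@generic_decides (fun p => exists n, n ∈ om /\ op (op a n) (sg emp) ∈ p /\
  op (op b n) emp ∈ p)) as [(p & Gp & n & Hn & K1 & K2)|(p & Gp & N)]; [dfn| |].
- assert (L : imem (val (chk n)) (val (cn k b))).
  { rewrite <- E; apply in_val; exists (chk n), p; rewrite in_cn; split; [|auto].
    exists n, p; auto using G_cond. }
  apply in_val in L; destruct L as (y & q & H & Gq & L).
  apply in_cn in H; destruct H as (m & q' & Hm & Hq & H & E').
  apply op_inj in E'; destruct E'; subst y q'; apply val_chk_inj in L; subst m.
  destruct (G_join Gp Gq) as (r & Gr & S1 & S2).
  pose proof (proj1 (cond_iff k r) (G_cond Gr)) as (_ & _ & F).
  assert (X : emp = sg emp) by (apply (F b n); auto).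
  apply (in_emp (z := emp)); rewrite X at 2; apply in_sg; auto.
- pose proof (G_cond Gp) as Hp; destruct (cond_fresh Hp) as [m Hm].
  assert (C1 : cnd (cup p (sg (op (op a (num m)) (sg emp))))).
  { apply cond_add; auto using num_om. }
  assert (C2 : cnd (cup (cup p (sg (op (op a (num m)) (sg emp)))) (sg (op (op b (num m)) emp)))).
  { apply cond_add; auto using num_om. intros j H; apply in_cup in H; rewrite in_sg in H.
    destruct H as [H|H]; [exact (Hm _ _ H)|]. apply trip_inj in H; destruct H; congruence. }
  apply (N _ C2).
  + intros z Hz; rewrite !in_cup; auto.
  + exists (num m); rewrite !in_cup, !in_sg; auto using num_om.
Qed.

End Forcing.

Ltac dhintG :=
  lazymatch goal with
  | |- Def (fun e => feq _ _ _ _) => apply Def_feq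
  | |- Def (fun e => fmem _ _ _ _) => unfold fmem
  | |- _ => dhintF
  end.
Ltac dhint ::= dhintG.

(** * Ordered pairs in the ambient universe *)

Section AmbientPairs.
Implicit Types u v x y z : iset.

Lemma iup_exists x y : exists u, forall z, imem z u <-> z = x \/ z = y.
Proof.
destruct (@imem_range bool (fun b : bool => if b then x else y)) as [u Hu].
exists u; intro z; rewrite Hu; split.
- intros [[|] ->]; auto.
- intros [->| ->]; [exists true|exists false]; reflexivity.
Qed.

Definition iup x y : iset := proj1_sig (constructive_indefinite_description _ (iup_exists x y)).

Lemma in_iup x y z : imem z (iup x y) <-> z = x \/ z = y.
Proof. unfold iup; destruct constructive_indefinite_description; auto. Qed.

Definition iop x y : iset := iup (iup x x) (iup x y).

Lemma iup_inj_l x y x' : iup x y = iup x' x' -> x = x' /\ y = x'.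
Proof.
intro H; split.
- assert (K : imem x (iup x' x')) by (rewrite <- H; apply in_iup; auto).
  apply in_iup in K; tauto.
- assert (K : imem y (iup x' x')) by (rewrite <- H; apply in_iup; auto).
  apply in_iup in K; tauto.
Qed.

Lemma iup_inj_r x y y' : iup x y = iup x y' -> y = y'.
Proof.
intro H.
assert (K : imem y (iup x y')) by (rewrite <- H; apply in_iup; auto).
assert (L : imem y' (iup x y)) by (rewrite H; apply in_iup; auto).
apply in_iup in K, L; intuition congruence.
Qed.

Lemma iop_inj x y x' y' : iop x y = iop x' y' -> x = x' /\ y = y'.
Proof.
intro H.
assert (E : x = x').
{ assert (K : imem (iup x x) (iop x' y')) by (rewrite <- H; apply in_iup; auto).
  apply in_iup in K; destruct K as [K|K].
  - apply iup_inj_l in K; tauto.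
  - symmetry in K; apply iup_inj_l in K; destruct K; auto. }
subst x'; split; [reflexivity|].
apply iup_inj_r in H; now apply iup_inj_r in H.
Qed.

End AmbientPairs.

(** * A name for the set of all sequences of Cohen reals *)

Section Sequences.
Context {M : estruct} {gr : Ground M}.
Variable k : M.
Hypothesis kn : exists a0, a0 ∈ k.
Implicit Types (x y u f g h p q r s a b i : M) (P : M -> Prop).
Notation cnd := (cond om k).
Notation name := (is_name om k).
Notation hsn := (HS om k).
Notation feq := (feq k).
Notation fmem := (fmem k).
Notation pn := (pn k).
Notation seqs := (seqs k).

(* It suffices that the action maps [X] into itself, as the inverses of
   the permutations that fix [a] fix [a]. *)
Lemma supp_intro a X : a ∈ seqs -> name X ->
  (forall f y p, perm k f -> fixes f a -> op y p ∈ X -> op (act f y) (cact f p) ∈ X) ->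
  supp k a X.
Proof.
intros Ha HX H; split; [exact Ha|]; intros f Hf Fa.
assert (W : forall f, perm k f -> fixes f a -> subset (act f X) X).
{ clear f Hf Fa; intros f Hf Fa u Hu; apply in_act in Hu; destruct Hu as (y & p & K & ->); auto. }
apply ext; intro u; split; [apply W; auto|].
intro Hu; destruct (name_in HX Hu) as (y & p & -> & Hy & Hp).
assert (Fi : fixes (pinv f) a).
{ intros n Hn; rewrite <- (Fa n Hn) at 1; apply pinv_l with k; auto.
  apply in_seqs in Ha; apply Ha, Hn. }
apply in_act; exists (act (pinv f) y), (cact (pinv f) p).
rewrite (act_pinv_r Hf Hy), (cact_pinv_r Hf Hp); split; [|reflexivity].
apply H; auto using perm_pinv.
Qed.

Definition pns : M := comp (fun u => exists n a, n ∈ om /\ a ∈ k /\ u = pn n a).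

Lemma in_pns u : u ∈ pns <-> exists n a, n ∈ om /\ a ∈ k /\ u = pn n a.
Proof.
unfold pns; rewrite in_comp; [tauto|].
destruct (@isset_image _ _ (fun w => pn (pr1 w) (pr2 w)) (prod om k)) as [s Hs]; [dfn|].
apply (isset_sep (x := s)); [dfn|].
intros z (n & a & Hn & Ha & ->); apply Hs; exists (op n a).
rewrite in_prod_op, pr1_op, pr2_op; auto.
Qed.

(* Names for relations from omega to the set of Cohen reals. *)
Definition rels : M := prod pns (conds k).

(** A nice name for the part of [x] inside the product of omega and the set of Cohen reals. Nice
    names range over a set of the model, which allows a single name to collect all sequences. *)
Definition nice x : M := comp (fun u => exists n a p, n ∈ om /\ a ∈ k /\ p ∈ conds k /\
  fmem p (pn n a) x /\ u = op (pn n a) p).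

Lemma in_nice x u : u ∈ nice x <-> exists n a p, n ∈ om /\ a ∈ k /\ cnd p /\
  fmem p (pn n a) x /\ u = op (pn n a) p.
Proof.
unfold nice; rewrite in_comp.
- split; intros (n & a & p & H1 & H2 & H3 & H4); apply in_conds in H3; eauto 8.
- apply (isset_sep (x := rels)); [dfn|].
  intros z (n & a & p & Hn & Ha & Hp & _ & ->); apply in_prod_op; rewrite in_pns; eauto 6.
Qed.

Definition names : M := comp (fun y => subset y rels /\ exists a, supp k a y).

Lemma Def_supp (t s : (nat -> M) -> M) : DT t -> DT s -> Def (fun e => supp k (t e) (s e)).
Proof.
apply (@Def_rel2 M (supp k)); unfold supp; dfn.
Qed.

Ltac dhint ::=
  lazymatch goal with
  | |- Def (fun e => supp _ _ _) => apply Def_supp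
  | |- _ => dhintG
  end.

Lemma in_names y : y ∈ names <-> subset y rels /\ exists a, supp k a y.
Proof.
unfold names; rewrite in_comp; [tauto|].
apply (isset_sep (x := pow rels)); [dfn|].
intros z [H _]; apply in_pow, H.
Qed.

Lemma names_op y u : y ∈ names -> u ∈ y ->
  exists n a p, n ∈ om /\ a ∈ k /\ cnd p /\ u = op (pn n a) p.
Proof.
intros H K; apply in_names in H; destruct H as [H _]; apply H, in_prod in K.
destruct K as (v & p & Hv & Hp & ->); apply in_pns in Hv; apply in_conds in Hp.
destruct Hv as (n & a & Hn & Ha & ->); eauto 8.
Qed.

Lemma HS_names y : y ∈ names -> hsn y.
Proof.
intro H; pose proof H as H'; apply in_names in H'; destruct H' as [_ [a A]].
apply (HS_intro_supp kn A); intros u Hu.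
destruct (names_op H Hu) as (n & b & p & Hn & Hb & Hp & ->).
exists (pn n b), p; auto using HS_pn.
Qed.

Lemma act_names f y : perm k f -> y ∈ names -> act f y ∈ names.
Proof.
intros Hf H; apply in_names; split.
- intros u Hu; apply in_act in Hu; destruct Hu as (v & p & Hv & ->).
  destruct (names_op H Hv) as (n & a & p' & Hn & Ha & Hp & E).
  apply op_inj in E; destruct E; subst; apply in_prod_op; split.
  + rewrite act_pn; auto; apply in_pns; exists n, (ap f a); split; [auto|split; [|auto]].
    apply perm_ap; auto.
  + apply in_conds, cond_cact; auto.
- pose proof (HS_name (HS_names H)); apply in_names in H; destruct H as [_ [a A]].
  eapply supp_act; eauto.
Qed.

(** Whatever supports [x] supports its nice name, because [fmem] is preserved by the action. *)
Lemma nice_names x : hsn x -> nice x ∈ names.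
Proof.
intro Hx; apply in_names; split.
- intros u Hu; apply in_nice in Hu; destruct Hu as (n & a & p & Hn & Ha & Hp & _ & ->).
  apply in_prod_op; rewrite in_pns, in_conds; eauto 6.
- destruct (HS_supp kn Hx) as [a [Ha A]]; exists a; apply supp_intro; [exact Ha| |].
  + apply name_iff; intros u Hu; apply in_nice in Hu.
    destruct Hu as (n & b & p & Hn & Hb & Hp & _ & ->).
    exists (pn n b), p; eauto 10 using HS_name, HS_pn.
  + intros f y p Hf Fa K; apply in_nice in K; destruct K as (n & b & p' & Hn & Hb & Hp & L & E).
    apply op_inj in E; destruct E; subst; apply in_nice.
    exists n, (ap f b), (cact f p'); rewrite act_pn; auto.
    split; [auto|split; [apply perm_ap; auto|split; [apply cond_cact; auto|split; [|auto]]]].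
    rewrite <- (A f Hf Fa), <- act_pn; auto.
    apply fmem_act; eauto 10 using HS_name, HS_pn.
Qed.

(* [p] forces that [x] is a function from omega to the set of Cohen reals. *)
Definition ffun p x : Prop :=
  (forall n q, n ∈ om -> cnd q -> subset p q -> exists r a, cnd r /\ subset q r /\ a ∈ k /\
     fmem r (pn n a) x) /\
  (forall n a b q, n ∈ om -> a ∈ k -> b ∈ k -> cnd q -> subset p q ->
     fmem q (pn n a) x -> fmem q (pn n b) x -> a = b).

Lemma ffun_mono p q x : ffun p x -> subset p q -> ffun q x.
Proof.
intros [H K] S; split.
- intros n r Hn Hr L; apply H; eauto 10 using sub_trans.
- intros n a b r Hn Ha Hb Hr L; apply K; eauto 10 using sub_trans.
Qed.

Lemma ffun_act f p x : perm k f -> cnd p -> hsn x -> ffun p x -> ffun (cact f p) (act f x).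
Proof.
intros Hf Hp Hx [H K]; pose proof (perm_pinv Hf) as Hf'; split.
- intros n q Hn Hq S.
  destruct (H n (cact (pinv f) q) Hn) as (r & a & Hr & R1 & R2 & R3).
  { apply cond_cact; auto. }
  { apply (sub_pinv Hf); auto. }
  exists (cact f r), (ap f a); split; [apply cond_cact; auto|].
  split; [apply (sub_act Hf); auto|split; [apply perm_ap; auto|]].
  rewrite <- act_pn; auto; apply fmem_act; eauto 10 using HS_name, HS_pn.
- intros n a b q Hn Ha Hb Hq S H1 H2.
  apply (perm_inj Hf'); auto; apply (K n _ _ (cact (pinv f) q)); auto.
  + apply perm_ap; auto.
  + apply perm_ap; auto.
  + apply cond_cact; auto.
  + apply (sub_pinv Hf); auto.
  + rewrite <- act_pn, <- (act_pinv_l Hf (HS_name Hx)); auto.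
    apply fmem_act; eauto 10 using HS_name, HS_pn, HS_act.
  + rewrite <- act_pn, <- (act_pinv_l Hf (HS_name Hx)); auto.
    apply fmem_act; eauto 10 using HS_name, HS_pn, HS_act.
Qed.

Lemma Def_ffun (t s : (nat -> M) -> M) : DT t -> DT s -> Def (fun e => ffun (t e) (s e)).
Proof. apply (@Def_rel2 M ffun); unfold ffun; dfn. Qed.

Ltac dhint ::=
  lazymatch goal with
  | |- Def (fun e => supp _ _ _) => apply Def_supp
  | |- Def (fun e => ffun _ _) => apply Def_ffun
  | |- _ => dhintG
  end.

Definition seq_name : M := comp (fun u => exists y p, y ∈ names /\ p ∈ conds k /\
  ffun p y /\ u = op y p).

Lemma in_seq_name u : u ∈ seq_name <-> exists y p, y ∈ names /\ cnd p /\ ffun p y /\ u = op y p.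
Proof.
unfold seq_name; rewrite in_comp.
- split; intros (y & p & H1 & H2 & H3); apply in_conds in H2; eauto 6.
- apply (isset_sep (x := prod names (conds k))); [dfn|].
  intros z (y & p & H1 & H2 & _ & ->); apply in_prod_op; auto.
Qed.

(** Both [names] and [ffun] are preserved by all permutations, so an arbitrary sequence serves as
    support. *)
Lemma HS_seq_name : hsn seq_name.
Proof.
destruct (const_seq kn) as [a Ha].
apply (@HS_intro_supp _ _ _ _ a kn).
- apply supp_intro; [exact Ha| |].
  + apply name_iff; intros u Hu; apply in_seq_name in Hu; destruct Hu as (y & p & H1 & H2 & _ & ->).
    eauto 10 using HS_name, HS_names.
  + intros f y p Hf _ K; apply in_seq_name in K; destruct K as (y' & p' & H1 & H2 & H3 & E).
    apply op_inj in E; destruct E; subst; apply in_seq_name.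
    exists (act f y'), (cact f p'); split; [apply act_names; auto|].
    split; [apply cond_cact; auto|split; [|auto]]. apply ffun_act; auto using HS_names.
- intros u Hu; apply in_seq_name in Hu; destruct Hu as (y & p & H1 & H2 & _ & ->).
  eauto 10 using HS_names.
Qed.

Definition reals_name : M := comp (fun u => exists a, a ∈ k /\ u = op (cn k a) emp).

Lemma in_reals_name u : u ∈ reals_name <-> exists a, a ∈ k /\ u = op (cn k a) emp.
Proof.
unfold reals_name; rewrite in_comp; [tauto|].
apply (@isset_image _ _ (fun a => op (cn k a) emp)); dfn.
Qed.

Lemma HS_reals_name : hsn reals_name.
Proof.
destruct (const_seq kn) as [a Ha].
apply (@HS_intro_supp _ _ _ _ a kn).
- apply supp_intro; [exact Ha| |].
  + apply name_iff; intros u Hu; apply in_reals_name in Hu; destruct Hu as (b & Hb & ->).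
    eauto 10 using HS_name, HS_cn, cond_emp.
  + intros f y p Hf _ K; apply in_reals_name in K; destruct K as (b & Hb & E).
    apply op_inj in E; destruct E; subst; apply in_reals_name.
    exists (ap f b); rewrite act_cn, cact_emp; auto. split; [apply perm_ap; auto|auto].
- intros u Hu; apply in_reals_name in Hu; destruct Hu as (b & Hb & ->).
  eauto 10 using HS_cn, cond_emp.
Qed.

(* The canonical name of the sequence of the [a n]-th Cohen reals. *)
Definition sq a : M := comp (fun u => exists n, n ∈ om /\ u = op (pn n (ap a n)) emp).

Lemma isset_sq a : isset (fun u => exists n, n ∈ om /\ u = op (pn n (ap a n)) emp).
Proof. apply (@isset_image _ _ (fun n => op (pn n (ap a n)) emp)); dfn. Qed.

Lemma in_sq a u : u ∈ sq a <-> exists n, n ∈ om /\ u = op (pn n (ap a n)) emp.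
Proof. unfold sq; rewrite in_comp; [tauto|apply isset_sq]. Qed.

Lemma DT_sq (t : (nat -> M) -> M) : DT t -> DT (fun e => sq (t e)).
Proof. apply DT_fun1; apply DT_comp; [intro; apply isset_sq|dfn]. Qed.

Lemma HS_sq a : a ∈ seqs -> hsn (sq a).
Proof.
intro Ha; assert (Ha' : forall n, n ∈ om -> ap a n ∈ k) by (apply in_seqs, Ha).
apply (@HS_intro_supp _ _ _ _ a kn).
- apply supp_intro; [exact Ha| |].
  + apply name_iff; intros u Hu; apply in_sq in Hu; destruct Hu as (n & Hn & ->).
    eauto 10 using HS_name, HS_pn, cond_emp.
  + intros f y p Hf Fa K; apply in_sq in K; destruct K as (n & Hn & E).
    apply op_inj in E; destruct E; subst; apply in_sq.
    exists n; rewrite act_pn, cact_emp, Fa; auto.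
- intros u Hu; apply in_sq in Hu; destruct Hu as (n & Hn & ->).
  eauto 10 using HS_pn, cond_emp.
Qed.

Variable G : M -> Prop.
Hypothesis HG : generic om k G.
Notation val := (val G).
Let G1 : G emp := G_emp HG.
Let Gc p : G p -> cnd p := @G_cond _ _ _ _ HG p.

Lemma val_npair x y : val (npair x y) = iup (val x) (val y).
Proof.
apply imem_ext; intro z; rewrite in_val, in_iup; split.
- intros (u & p & H & Gp & ->); apply in_up in H.
  destruct H as [H|H]; apply op_inj in H; destruct H; subst; auto.
- intros [->| ->]; [exists x, emp|exists y, emp]; unfold npair; rewrite in_up;
    eauto 10.
Qed.

Lemma val_nop x y : val (nop x y) = iop (val x) (val y).
Proof. unfold nop, iop; now rewrite !val_npair. Qed.

Lemma val_pn_inj n a n' a' : a ∈ k -> a' ∈ k -> val (pn n a) = val (pn n' a') ->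
  n = n' /\ a = a'.
Proof.
intros Ha Ha' E; change (val (nop (chk n) (cn k a)) = val (nop (chk n') (cn k a'))) in E; rewrite !val_nop in E; apply iop_inj in E.
destruct E as [E1 E2]; apply (val_chk_inj HG) in E1; apply (val_cn_inj HG) in E2; auto.
Qed.

(** The truth counterpart of [ffun]. It compares indices of reals and not the reals themselves,
    which agrees by [val_cn_inj]. *)
Definition isfn (v : iset) : Prop :=
  (forall n, n ∈ om -> exists a, a ∈ k /\ imem (val (pn n a)) v) /\
  (forall n a b, n ∈ om -> a ∈ k -> b ∈ k -> imem (val (pn n a)) v ->
     imem (val (pn n b)) v -> a = b).

Lemma fmem_pn n a x : a ∈ k -> hsn x ->
  imem (val (pn n a)) (val x) <-> exists p, G p /\ fmem p (pn n a) x.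
Proof. intros; apply (fmem_truth HG); eauto 10 using HS_name, HS_pn. Qed.

Lemma ffun_sound p x : G p -> hsn x -> ffun p x -> isfn (val x).
Proof.
intros Gp Hx [H K]; split.
- intros n Hn.
  destruct (@generic_decides _ _ _ _ HG (fun q => exists a, a ∈ k /\ fmem q (pn n a) x))
    as [(q & Gq & a & Ha & L)|(q & Gq & N)]; [dfn| |].
  + exists a; split; [exact Ha|]. apply fmem_pn; eauto.
  + destruct (G_join HG Gp Gq) as (r & Gr & S1 & S2).
    destruct (H n r Hn (G_cond HG Gr) S1) as (r' & a & Hr' & S3 & Ha & L).
    destruct (N r' Hr'); eauto 10 using sub_trans.
- intros n a b Hn Ha Hb H1 H2; apply fmem_pn in H1, H2; auto.
  destruct H1 as (p1 & Gp1 & H1), H2 as (p2 & Gp2 & H2).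
  destruct (G_join HG Gp1 Gp2) as (r1 & Gr1 & S1 & S2).
  destruct (G_join HG Gr1 Gp) as (r & Gr & S3 & S4).
  pose proof (G_cond HG Gr).
  apply (K n a b r); auto.
  + apply (fmem_mono H1); eauto 10 using sub_trans.
  + apply (fmem_mono H2); eauto 10 using sub_trans.
Qed.

(** A failure is either a place that no extension fills or a place carrying two different reals. The
    value being a function excludes both in [G], so some condition in [G] has no failing
    extension. *)
Lemma ffun_complete x : hsn x -> isfn (val x) -> exists p, G p /\ ffun p x.
Proof.
intros Hx [H K].
destruct (@generic_decides _ _ _ _ HG (fun p =>
  (exists n, n ∈ om /\ forall q a, cnd q -> subset p q -> a ∈ k -> ~ fmem q (pn n a) x) \/
  (exists n a b, n ∈ om /\ a ∈ k /\ b ∈ k /\ a <> b /\ fmem p (pn n a) x /\ fmem p (pn n b) x)))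
  as [(p & Gp & [(n & Hn & L)|(n & a & b & Hn & Ha & Hb & Nab & L1 & L2)])|(p & Gp & N)];
  [dfn| | |].
- destruct (H n Hn) as (a & Ha & L1); apply fmem_pn in L1; auto.
  destruct L1 as (q & Gq & L1); destruct (G_join HG Gp Gq) as (r & Gr & S1 & S2).
  destruct (L r a (G_cond HG Gr) S1 Ha); apply (fmem_mono L1); auto; apply (G_cond HG Gr).
- destruct Nab; apply (K n); auto; apply fmem_pn; eauto.
- exists p; split; [exact Gp|split].
  + intros n q Hn Hq S; apply NNPP; intro L; apply (N q Hq S); left.
    exists n; split; [exact Hn|]. intros r a Hr S' Ha F; apply L; exists r, a; auto.
  + intros n a b q Hn Ha Hb Hq S H1 H2; apply NNPP; intro L; apply (N q Hq S); right.
    exists n, a, b; auto 8.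
Qed.

Lemma in_val_nice x (z : iset) : hsn x -> imem z (val (nice x)) <->
  exists n a, n ∈ om /\ a ∈ k /\ z = val (pn n a) /\ imem z (val x).
Proof.
intro Hx; rewrite in_val; split.
- intros (y & p & H & Gp & ->); apply in_nice in H; destruct H as (n & a & p' & Hn & Ha & Hp & L & E).
  apply op_inj in E; destruct E; subst; exists n, a; split; [auto|split; [auto|split; [auto|]]].
  apply fmem_pn; eauto.
- intros (n & a & Hn & Ha & -> & K); apply fmem_pn in K; auto.
  destruct K as (p & Gp & K); exists (pn n a), p; rewrite in_nice.
  split; [|auto]. exists n, a, p; auto 8.
Qed.

Lemma in_val_seq v : imem v (val seq_name) <->
  exists y p, y ∈ names /\ G p /\ ffun p y /\ v = val y.
Proof.
rewrite in_val; split.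
- intros (y & p & H & Gp & ->); apply in_seq_name in H; destruct H as (y' & p' & H1 & _ & H3 & E).
  apply op_inj in E; destruct E; subst; eauto 6.
- intros (y & p & H1 & H2 & H3 & ->); exists y, p; rewrite in_seq_name; split; [|auto].
  exists y, p; auto.
Qed.

(** Passing to [nice x] does not change the value, since every element of it is a pair named by some
    [pn n a]; the nice name is then forced to be a function by a condition in [G]. *)
Lemma seq_name_complete x : hsn x -> isfn (val x) ->
  (forall z, imem z (val x) -> exists n a, n ∈ om /\ a ∈ k /\ z = val (pn n a)) ->
  imem (val x) (val seq_name).
Proof.
intros Hx Fx B.
assert (E : val (nice x) = val x).
{ apply imem_ext; intro z; rewrite in_val_nice; auto; split.
  - intros (n & a & _ & _ & _ & K); exact K.
  - intro K; destruct (B z K) as (n & a & H1 & H2 & ->); eauto 6. }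
pose proof (nice_names Hx) as Hn.
destruct (@ffun_complete (nice x)) as (p & Gp & K).
- apply HS_names, Hn.
- rewrite E; exact Fx.
- apply in_val_seq; exists (nice x), p; auto.
Qed.

Lemma seq_name_sound v : imem v (val seq_name) -> isfn v /\
  forall z, imem z v -> exists n a, n ∈ om /\ a ∈ k /\ z = val (pn n a).
Proof.
intro H; apply in_val_seq in H; destruct H as (y & p & Hy & Gp & K & ->); split.
- apply (ffun_sound Gp); auto using HS_names.
- intros z Hz; apply in_val in Hz; destruct Hz as (u & q & Hu & Gq & ->).
  destruct (names_op Hy Hu) as (n & a & p' & Hn & Ha & _ & E).
  apply op_inj in E; destruct E; subst; eauto 6.
Qed.

Lemma in_val_reals v : imem v (val reals_name) <-> exists a, a ∈ k /\ v = val (cn k a).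
Proof.
rewrite in_val; split.
- intros (y & p & H & _ & ->); apply in_reals_name in H; destruct H as (a & Ha & E).
  apply op_inj in E; destruct E; subst; eauto.
- intros (a & Ha & ->); exists (cn k a), emp; rewrite in_reals_name; eauto 10.
Qed.

Lemma in_val_chk x v : imem v (val (chk x)) <-> exists y, y ∈ x /\ v = val (chk y).
Proof.
rewrite in_val; split.
- intros (y & p & H & _ & ->); apply in_chk in H; destruct H as (a & Ha & E).
  apply op_inj in E; destruct E; subst; eauto.
- intros (a & Ha & ->); exists (chk a), emp; rewrite in_chk; eauto 10.
Qed.

Lemma in_val_act_sq f a v : perm k f -> a ∈ seqs ->
  imem v (val (act f (sq a))) <-> exists n, n ∈ om /\ v = val (pn n (ap f (ap a n))).
Proof.
intros Hf Ha; assert (Ha' : forall n, n ∈ om -> ap a n ∈ k) by (apply in_seqs, Ha).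
rewrite in_val; split.
- intros (y & p & H & _ & ->); apply in_act in H; destruct H as (y' & p' & H & E).
  apply in_sq in H; destruct H as (n & Hn & E'); apply op_inj in E, E'.
  destruct E, E'; subst; rewrite act_pn; eauto.
- intros (n & Hn & ->); exists (pn n (ap f (ap a n))), emp; split; [|eauto 10].
  apply in_act; exists (pn n (ap a n)), emp; rewrite act_pn, cact_emp, in_sq; eauto.
Qed.

Lemma val_act_sq_inj f f' a : perm k f -> perm k f' -> a ∈ seqs ->
  val (act f (sq a)) = val (act f' (sq a)) ->
  forall n, n ∈ om -> ap f (ap a n) = ap f' (ap a n).
Proof.
intros Hf Hf' Ha E n Hn; assert (Ha' : forall n, n ∈ om -> ap a n ∈ k) by (apply in_seqs, Ha).
assert (K : imem (val (pn n (ap f (ap a n)))) (val (act f' (sq a)))).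
{ rewrite <- E; apply in_val_act_sq; eauto. }
apply in_val_act_sq in K; auto; destruct K as (m & Hm & K).
apply val_pn_inj in K; [|apply perm_ap; auto|apply perm_ap; auto].
destruct K as [-> K]; exact K.
Qed.

End Sequences.

Ltac dhintH :=
  lazymatch goal with
  | |- Def (fun e => supp _ _ _) => apply Def_supp
  | |- Def (fun e => ffun _ _ _) => apply Def_ffun
  | |- DT (fun e => sq _ _) => apply DT_sq
  | |- _ => dhintG
  end.
Ltac dhint ::= dhintH.

(** * The name of the surjection *)

Section Surjection.
Context {M : estruct} {gr : Ground M}.
Variable k : M.
Hypothesis kn : exists a0, a0 ∈ k.
Implicit Types (y z u f g p q r s a b i : M) (P : M -> Prop).
Notation cnd := (cond om k).
Notation name := (is_name om k).
Notation hsn := (HS om k).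
Notation feq := (feq k).
Notation fmem := (fmem k).
Notation pn := (pn k).
Notation seqs := (seqs k).
Notation names := (names k).
Notation ffun := (ffun k).
Notation sq := (sq k).

Variables x x0 q0 : M.
Hypothesis Hx : hsn x.
Hypothesis Hx0 : op x0 q0 ∈ x.

(** Keeping all supports of each name avoids choosing one, and the pairs still form a set of the
    model. *)
Definition supported : M :=
  comp (fun u => exists y a, (exists q, op y q ∈ x) /\ supp k a y /\ u = op y a).

Lemma in_supported u : u ∈ supported <->
  exists y a, (exists q, op y q ∈ x) /\ supp k a y /\ u = op y a.
Proof.
unfold supported; rewrite in_comp; [tauto|].
apply (isset_sep (x := prod (un (un x)) seqs)); [dfn|].
intros v (y & a & [q Hq] & [Ha _] & ->); apply in_prod_op; split; [|exact Ha].
apply in_un; exists (sg y); split; [apply in_sg; auto|].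
apply in_un; exists (op y q); split; [apply in_up; auto|exact Hq].
Qed.

Variables (eta : M) (h : M -> M).
Hypothesis Dh : DT (fun e => h (e 0)).
Hypothesis h_in : forall i, h i ∈ supported.
Hypothesis h_onto : forall t, t ∈ supported -> exists i, i ∈ eta /\ h i = t.

(* [p] forces that the sequence named by [s] is [f a] and that the value named
   by [z = f y] lies in the set named by [x], where [h i = (y, a)]. *)
Definition hit p s i z : Prop := exists f y a, perm k f /\ h i = op y a /\ z = act f y /\
  feq p s (act f (sq a)) /\ fmem p z x.

(* Where no extension of [p] yields a value, the default value is [x0]. *)
Definition gval p s i z : Prop :=
  hit p s i z \/ z = x0 /\ forall q z', cnd q -> subset p q -> ~ hit q s i z'.

Ltac dhint ::=
  lazymatch goal with
  | |- DT (fun e => h _) => apply (DT_fun1 Dh)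
  | |- _ => dhintH
  end.

Lemma Def_hit : Def (fun e => hit (e 0) (e 1) (e 2) (e 3)).
Proof. unfold hit; dfn. Qed.

Ltac dhint ::=
  lazymatch goal with
  | |- DT (fun e => h _) => apply (DT_fun1 Dh)
  | |- Def (fun e => hit _ _ _ _) => apply (Def_rel4 Def_hit)
  | |- _ => dhintH
  end.

Lemma h_spec i y a : h i = op y a -> (exists q, op y q ∈ x) /\ supp k a y /\ hsn y.
Proof.
intro E; pose proof (h_in i) as K; apply in_supported in K.
destruct K as (y' & a' & [q Hq] & S & E'); rewrite E in E'; apply op_inj in E'.
destruct E'; subst; split; [eauto|split; [exact S|]]. apply (HS_op Hx Hq).
Qed.

Lemma hit_mono p q s i z : hit p s i z -> cnd q -> subset p q -> hit q s i z.
Proof.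
intros (f & y & a & H1 & H2 & H3 & H4 & H5) Hq S; exists f, y, a.
splits; auto; [exact (feq_mono H4 Hq S)|exact (fmem_mono H5 Hq S)].
Qed.

(** The witness f turns into g o f, while the index [i] keeps the same [y] and [a]. That [g] fixes
    [x] is used for the clause placing the value in [x]. *)
Lemma hit_act g p s i z : perm k g -> act g x = x -> name s -> hit p s i z ->
  hit (cact g p) (act g s) i (act g z).
Proof.
intros Hg Ex Hs (f & y & a & H1 & H2 & -> & H4 & H5).
destruct (h_spec H2) as (_ & [Ha A] & Hy).
pose proof (HS_name Hy) as Ny; pose proof (HS_name (HS_sq kn Ha)) as Na.
exists (pcomp k g f), y, a; split; [apply perm_pcomp; auto|split; [exact H2|]].
rewrite <- !act_pcomp; auto; split; [reflexivity|split].
- apply feq_act; auto; apply name_act_name; auto.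
- rewrite <- Ex; apply fmem_act; auto; [apply name_act_name; auto|apply HS_name, Hx].
Qed.

(** For the default clause, a hit at an extension of [cact g p] would be pulled back along [pinv g]
    to a hit excluded above [p]. *)
Lemma gval_act g p s i z : perm k g -> cnd p -> act g x = x -> act g x0 = x0 -> name s ->
  gval p s i z -> gval (cact g p) (act g s) i (act g z).
Proof.
intros Hg Hp Ex Ex0 Hs [H|[-> H]]; [left; apply hit_act; auto|right].
split; [exact Ex0|]. intros q z' Hq S K.
apply (H (cact (pinv g) q) (act (pinv g) z')).
- apply cond_cact; auto using perm_pinv.
- apply (sub_pinv Hg); auto.
- rewrite <- (act_pinv_l Hg Hs); apply hit_act; auto using perm_pinv, name_act_name.
  rewrite <- Ex at 1; apply act_pinv_l with k; auto; apply HS_name, Hx.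
Qed.

Lemma gval_name p s i z : gval p s i z ->
  exists f y q, perm k f /\ op y q ∈ x /\ z = act f y.
Proof.
intros [(f & y & a & H1 & H2 & -> & _)|[-> _]].
- destruct (h_spec H2) as ([q Hq] & _); eauto 8.
- exists (pid k), x0, q0; split; [apply perm_pid|split; [exact Hx0|]].
  symmetry; apply act_pid, (name_op (HS_name Hx) Hx0).
Qed.

Lemma HS_gval p s i z : gval p s i z -> hsn z.
Proof.
intro H; destruct (gval_name H) as (f & y & q & Hf & Hy & ->).
apply HS_act; auto; apply (HS_op Hx Hy).
Qed.

Definition graph_name : M := comp (fun u => exists s i z p, s ∈ names /\ i ∈ eta /\ p ∈ conds k /\
  ffun p s /\ gval p s i z /\ u = op (nop (nop s (chk i)) z) p).

Lemma in_graph_name u : u ∈ graph_name <-> exists s i z p, s ∈ names /\ i ∈ eta /\ cnd p /\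
  ffun p s /\ gval p s i z /\ u = op (nop (nop s (chk i)) z) p.
Proof.
unfold graph_name; rewrite in_comp.
- split; intros (s & i & z & p & H1 & H2 & H3 & H4); apply in_conds in H3; exists s, i, z, p; auto.
(* By [gval_name] every value, the default included, is the image under a permutation of a name
   occurring in [x]; this bounds the values by the set [Z]. *)
- destruct (@isset_image _ _ (fun w => act (pr1 w) (pr2 w)) (prod (perms k) (un (un x))))
    as [Z HZ]; [dfn|].
  destruct (@isset_image _ _ (fun w => nop (nop (pr1 (pr1 w)) (chk (pr2 (pr1 w)))) (pr2 w))
    (prod (prod names eta) Z)) as [W HW]; [dfn|].
  apply (isset_sep (x := prod W (conds k))); [unfold gval; dfn|].
  intros v (s & i & z & p & H1 & H2 & H3 & H4 & H5 & ->); apply in_prod_op; split; [|exact H3].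
  apply HW; exists (op (op s i) z); rewrite !pr1_op, !pr2_op, !in_prod_op; split; [|auto].
  split; [auto|]. destruct (gval_name H5) as (f & y & q & Hf & Hy & ->).
  apply HZ; exists (op f y); rewrite pr1_op, pr2_op, in_prod_op, in_perms; split; [|auto].
  split; [auto|]. apply in_un; exists (sg y); split; [apply in_sg; auto|].
  apply in_un; exists (op y q); split; [apply in_up; auto|exact Hy].
Qed.

(** The support merges one of [x], for the clause on membership in [x], with one of the default
    [x0]. Nothing is required for the listed names and their supports. *)
Lemma HS_graph_name : hsn graph_name.
Proof.
destruct (HS_supp kn Hx) as [a A].
destruct (HS_supp kn (proj1 (HS_op Hx Hx0))) as [b B].
destruct (supp_merge A B) as (c & Hc & C).
assert (W : forall u, u ∈ graph_name -> exists y p, u = op y p /\ hsn y /\ cnd p).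
{ intros u Hu; apply in_graph_name in Hu; destruct Hu as (s & i & z & p & H1 & H2 & H3 & H4 & H5 & ->).
  exists (nop (nop s (chk i)) z), p; split; [auto|split; [|auto]].
  apply HS_nop; auto; [apply HS_nop; auto|exact (HS_gval H5)].
  - apply HS_names; auto.
  - apply HS_chk; auto. }
apply (@HS_intro_supp _ _ _ _ c kn); [|exact W].
apply supp_intro; [exact Hc| |].
- apply name_iff; intros u Hu; destruct (W u Hu) as (y & p & -> & H & K).
  exists y, p; auto using HS_name.
- intros f y p Hf Fc K; apply in_graph_name in K.
  destruct K as (s & i & z & p' & H1 & H2 & H3 & H4 & H5 & E); apply op_inj in E.
  destruct E; subst y p'; destruct (C f Hf Fc) as [Ex Ex0]; apply in_graph_name.
  exists (act f s), i, (act f z), (cact f p); rewrite !act_nop, act_chk.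
  pose proof (HS_names kn H1) as Hs.
  splits; auto.
  + apply act_names; auto.
  + apply cond_cact; auto.
  + apply ffun_act; auto.
  + apply gval_act; auto using HS_name.
Qed.

Definition prod_name : M := comp (fun u => exists s i p, s ∈ names /\ i ∈ eta /\ p ∈ conds k /\
  ffun p s /\ u = op (nop s (chk i)) p).

Lemma in_prod_name u : u ∈ prod_name <-> exists s i p, s ∈ names /\ i ∈ eta /\ cnd p /\
  ffun p s /\ u = op (nop s (chk i)) p.
Proof.
unfold prod_name; rewrite in_comp.
- split; intros (s & i & p & H1 & H2 & H3 & H4); apply in_conds in H3; exists s, i, p; auto.
- destruct (@isset_image _ _ (fun w => nop (pr1 w) (chk (pr2 w))) (prod names eta)) as [W HW]; [dfn|].
  apply (isset_sep (x := prod W (conds k))); [dfn|].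
  intros v (s & i & p & H1 & H2 & H3 & H4 & ->); apply in_prod_op; split; [|exact H3].
  apply HW; exists (op s i); rewrite pr1_op, pr2_op, in_prod_op; auto.
Qed.

Lemma HS_prod_name : hsn prod_name.
Proof.
destruct (const_seq kn) as [a Ha].
assert (W : forall u, u ∈ prod_name -> exists y p, u = op y p /\ hsn y /\ cnd p).
{ intros u Hu; apply in_prod_name in Hu; destruct Hu as (s & i & p & H1 & H2 & H3 & H4 & ->).
  exists (nop s (chk i)), p; split; [auto|split; [|auto]].
  apply HS_nop; auto; [apply HS_names; auto|apply HS_chk; auto]. }
apply (@HS_intro_supp _ _ _ _ a kn); [|exact W].
apply supp_intro; [exact Ha| |].
- apply name_iff; intros u Hu; destruct (W u Hu) as (y & p & -> & H & K).
  exists y, p; auto using HS_name.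
- intros f y p Hf _ K; apply in_prod_name in K.
  destruct K as (s & i & p' & H1 & H2 & H3 & H4 & E); apply op_inj in E.
  destruct E; subst y p'; apply in_prod_name.
  exists (act f s), i, (cact f p); rewrite act_nop, act_chk.
  split; [apply act_names; auto|split; [auto|split; [apply cond_cact; auto|split; [|auto]]]].
  apply ffun_act; auto using HS_names.
Qed.

Variable G : M -> Prop.
Hypothesis HG : generic om k G.
Hypothesis Gq0 : G q0.
Notation val := (val G).
Let G1 : G emp := G_emp HG.
Let Gc p : G p -> cnd p := @G_cond _ _ _ _ HG p.

Lemma in_val_graph w : imem w (val graph_name) <-> exists s i z p, s ∈ names /\ i ∈ eta /\ G p /\
  ffun p s /\ gval p s i z /\ w = iop (iop (val s) (val (chk i))) (val z).
Proof.
rewrite in_val; split.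
- intros (y & p & H & Gp & ->); apply in_graph_name in H.
  destruct H as (s & i & z & p' & H1 & H2 & H3 & H4 & H5 & E); apply op_inj in E.
  destruct E; subst; exists s, i, z, p'; rewrite !(val_nop HG); auto 8.
- intros (s & i & z & p & H1 & H2 & H3 & H4 & H5 & ->).
  exists (nop (nop s (chk i)) z), p; rewrite !(val_nop HG); split; [|auto].
  apply in_graph_name; exists s, i, z, p; auto 8.
Qed.

Lemma in_val_prod w : imem w (val prod_name) <->
  exists v i, imem v (val (seq_name k)) /\ i ∈ eta /\ w = iop v (val (chk i)).
Proof.
rewrite in_val; split.
- intros (y & p & H & Gp & ->); apply in_prod_name in H.
  destruct H as (s & i & p' & H1 & H2 & H3 & H4 & E); apply op_inj in E.
  destruct E; subst; exists (val s), i; rewrite (val_nop HG); split; [|auto].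
  apply (in_val_seq HG); eauto 8.
- intros (v & i & H & Hi & ->); apply (in_val_seq HG) in H.
  destruct H as (s & p & H1 & H2 & H3 & ->); exists (nop s (chk i)), p.
  rewrite (val_nop HG); split; [|auto]. apply in_prod_name; exists s, i, p; auto 8.
Qed.

Lemma gval_in p s i z : G p -> gval p s i z -> imem (val z) (val x).
Proof.
intros Gp [(f & y & a & H1 & H2 & -> & H4 & H5)|[-> _]].
- destruct (h_spec H2) as (_ & _ & Hy); apply (fmem_truth HG); eauto.
  + apply name_act_name; auto using HS_name.
  + apply HS_name, Hx.
- apply in_val; eauto.
Qed.

(** Genericity decides whether a hit occurs: either a condition of [G] is one, or a condition of [G]
    has no hitting extension, and then the default clause applies. *)
Lemma gval_total v i : imem v (val (seq_name k)) -> i ∈ eta ->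
  exists s z p, s ∈ names /\ G p /\ ffun p s /\ gval p s i z /\ v = val s.
Proof.
intros H Hi; apply (in_val_seq HG) in H; destruct H as (s & p & H1 & H2 & H3 & ->).
destruct (@generic_decides _ _ _ _ HG (fun q => exists z, hit q s i z))
  as [(q & Gq & z & K)|(q & Gq & N)]; [dfn| |].
- destruct (G_join HG H2 Gq) as (r & Gr & S1 & S2).
  exists s, z, r; splits; auto; try apply (ffun_mono H3 S1).
  left; exact (hit_mono K (Gc Gr) S2).
- destruct (G_join HG H2 Gq) as (r & Gr & S1 & S2).
  exists s, x0, r; splits; auto; try apply (ffun_mono H3 S1).
  right; split; [reflexivity|]. intros r' z' Hr' S K; apply (N r' Hr'); eauto using sub_trans.
Qed.

Lemma hit_val p s i z : G p -> hsn s -> hit p s i z -> exists f y a, perm k f /\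
  h i = op y a /\ z = act f y /\ val s = val (act f (sq a)) /\ imem (val z) (val x).
Proof.
intros Gp Hs H; pose proof (gval_in Gp (or_introl H)) as K.
destruct H as (f & y & a & H1 & H2 & H3 & H4 & H5).
destruct (h_spec H2) as (_ & [Ha _] & _).
exists f, y, a; splits; auto.
apply (feq_sound HG Gp); auto using HS_name.
apply name_act_name; auto; apply HS_name, HS_sq; auto.
Qed.

Lemma val_hit f y a i s : perm k f -> h i = op y a -> hsn s ->
  val s = val (act f (sq a)) -> imem (val (act f y)) (val x) ->
  exists p, G p /\ hit p s i (act f y).
Proof.
intros Hf E Hs E1 E2; destruct (h_spec E) as (_ & [Ha _] & Hy).
destruct (feq_complete HG (x := s) (y := act f (sq a))) as (p & Gp & K1); auto using HS_name.
{ apply name_act_name; auto; apply HS_name, HS_sq; auto. }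
apply (fmem_truth HG) in E2; [|apply name_act_name; auto using HS_name|apply HS_name, Hx].
destruct E2 as (q & Gq & K2); destruct (G_join HG Gp Gq) as (r & Gr & S1 & S2).
exists r; split; [exact Gr|]. exists f, y, a; splits; auto.
- exact (feq_mono K1 (Gc Gr) S1).
- exact (fmem_mono K2 (Gc Gr) S2).
Qed.

Lemma gval_unique p s i z p' s' z' : G p -> G p' -> s ∈ names -> s' ∈ names ->
  val s = val s' -> gval p s i z -> gval p' s' i z' -> val z = val z'.
Proof.
(* A hit and a default exclude each other: by [val_hit] the existence of a hit in [G] depends only
   on the value of the sequence name, so it passes from [s] to [s'] and contradicts the default at a
   common extension. *)
assert (W : forall p s i z p' s', G p -> G p' -> s ∈ names -> s' ∈ names ->
  val s = val s' -> hit p s i z ->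
  ~ (forall q z', cnd q -> subset p' q -> ~ hit q s' i z')).
{ clear p s i z p' s' z'; intros p s i z p' s' Gp Gp' Hs Hs' E H N.
  apply hit_val in H; auto; [|apply HS_names; auto].
  destruct H as (f & y & a & H1 & H2 & -> & H4 & H5).
  destruct (@val_hit f y a i s') as (r & Gr & K); auto; [apply HS_names; auto|congruence|].
  destruct (G_join HG Gp' Gr) as (r' & Gr' & S1 & S2).
  apply (N r' (act f y) (Gc Gr') S1); exact (hit_mono K (Gc Gr') S2). }
intros Gp Gp' Hs Hs' E [H|[-> N]] [H'|[-> N']].
- apply hit_val in H, H'; auto; try (apply HS_names; auto).
  destruct H as (f & y & a & H1 & H2 & -> & H4 & H5).
  destruct H' as (f' & y' & a' & H1' & H2' & -> & H4' & H5').
  rewrite H2 in H2'; apply op_inj in H2'; destruct H2'; subst y' a'.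
  destruct (h_spec H2) as (_ & [Ha A] & Hy).
  pose proof (perm_pinv H1') as Hi.
  assert (K : forall n, n ∈ om -> ap f (ap a n) = ap f' (ap a n)).
  { apply (val_act_sq_inj HG); auto; congruence. }
  (* As [f] and [f'] agree along the support [a], the permutation f'^-1 f fixes [a] pointwise and
     therefore fixes [y]. *)
  assert (E' : act (pcomp k (pinv f') f) y = y).
  { apply A; [apply perm_pcomp; auto|]. intros n Hn.
    assert (Han : ap a n ∈ k) by (apply in_seqs in Ha; apply Ha, Hn).
    rewrite ap_pcomp, K; auto. apply pinv_l with k; auto. }
  rewrite <- (act_pcomp Hi H1 (HS_name Hy)) in E'.
  f_equal; rewrite <- E' at 2; symmetry; apply act_pinv_r with k; auto.
  apply name_act_name; auto using HS_name.
- destruct (W p s i z p' s'); auto.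
- destruct (W p' s' i z' p s); auto.
- reflexivity.
Qed.

(** The identity permutation suffices: the element named by [y] is reached from the sequence [sq a]
    at the index of the pair of [y] and [a]. A name [s] for that sequence, forced by a member of [G]
    to be a function, comes from [seq_name_complete]. *)
Lemma gval_onto v : imem v (val x) -> exists s i z p, s ∈ names /\ i ∈ eta /\ G p /\
  ffun p s /\ gval p s i z /\ v = val z.
Proof.
intro H; pose proof H as Hv; apply in_val in H; destruct H as (y & q & Hy & Gq & ->).
destruct (HS_op Hx Hy) as [HSy _]; destruct (HS_supp kn HSy) as [a A].
destruct (h_onto (t := op y a)) as (i & Hi & E).
{ apply in_supported; eauto 6. }
pose proof (proj1 A) as Ha.
assert (Ha' : forall n, n ∈ om -> ap a n ∈ k) by (apply in_seqs, Ha).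
assert (B : forall z : iset, imem z (val (sq a)) <-> exists n, n ∈ om /\ z = val (pn n (ap a n))).
{ intro z; rewrite <- (act_pid (HS_name (HS_sq kn Ha))), (in_val_act_sq HG); auto using perm_pid.
  split; intros (n & Hn & ->); exists n; rewrite ap_pid; auto. }
assert (K : imem (val (sq a)) (val (seq_name k))).
{ apply (seq_name_complete kn HG); [apply HS_sq; auto| |].
  - split.
    + intros n Hn; exists (ap a n); split; [auto|]. apply B; eauto.
    + intros n b c Hn Hb Hc Kb Kc; apply B in Kb, Kc.
      destruct Kb as (m & Hm & Kb), Kc as (m' & Hm' & Kc).
      apply (val_pn_inj HG) in Kb, Kc; auto. destruct Kb, Kc; congruence.
  - intros z Hz; apply B in Hz; destruct Hz as (n & Hn & ->); exists n, (ap a n); auto. }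
apply (in_val_seq HG) in K; destruct K as (s & p & H1 & H2 & H3 & H4).
destruct (@val_hit (pid k) y a i s) as (r & Gr & K); auto using perm_pid.
- apply HS_names; auto.
- rewrite act_pid; auto. apply HS_name, HS_sq; auto.
- rewrite act_pid; auto using HS_name.
- destruct (G_join HG H2 Gr) as (r' & Gr' & S1 & S2).
  exists s, i, (act (pid k) y), r'; splits; auto; try apply (ffun_mono H3 S1).
  + left; exact (hit_mono K (Gc Gr') S2).
  + rewrite act_pid; auto using HS_name.
Qed.

End Surjection.

(** * Absoluteness of pairs for transitive classes *)

Section TransitiveClass.
Variable C : iset -> Prop.
Hypothesis HC : transitive_class C.
Notation N := (class_struct C).
Implicit Types x y z u : N.

Lemma class_eq x y : proj1_sig x = proj1_sig y -> x = y.
Proof.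
destruct x as [x Hx], y as [y Hy]; simpl; intros ->; f_equal; apply proof_irrelevance.
Qed.

Lemma class_ext x y : (forall z, z ∈ x <-> z ∈ y) -> x = y.
Proof.
intro H; apply class_eq, imem_ext; intro z; split; intro K.
- exact (proj1 (H (exist _ z (HC (proj2_sig x) K))) K).
- exact (proj2 (H (exist _ z (HC (proj2_sig y) K))) K).
Qed.

Lemma class_wf : well_founded (@rel N).
Proof.
intro x; destruct x as [x Hx]; revert Hx.
induction x as [x IH] using (well_founded_ind imem_wf); intro Hx.
constructor; intros [y Hy] K; exact (IH y K Hy).
Qed.

Lemma class_pair u x y : is_pair u x y <-> proj1_sig u = iup (proj1_sig x) (proj1_sig y).
Proof.
split.
- intro H; apply imem_ext; intro z; rewrite in_iup; split.
  + intro K; destruct (proj1 (H (exist _ z (HC (proj2_sig u) K))) K) as [E|E];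
      [left|right]; now rewrite <- E.
  + intros [->| ->]; [apply (H x)|apply (H y)]; auto.
- intros E z; change (imem (proj1_sig z) (proj1_sig u) <-> z = x \/ z = y).
  rewrite E, in_iup; split; (intros [K|K]; [left|right]); try (apply class_eq, K); now rewrite K.
Qed.

(** The two unordered pairs that make up [u] are elements of [u], so transitivity puts them into the
    class. *)
Lemma class_opair u x y : is_opair u x y <-> proj1_sig u = iop (proj1_sig x) (proj1_sig y).
Proof.
split.
- intros (s & d & H & K & L); apply class_pair in H, K, L; rewrite L, H, K; reflexivity.
- intro E.
  assert (Hs : imem (iup (proj1_sig x) (proj1_sig x)) (proj1_sig u))
    by (rewrite E; apply in_iup; auto).
  assert (Hd : imem (iup (proj1_sig x) (proj1_sig y)) (proj1_sig u))
    by (rewrite E; apply in_iup; auto).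
  exists (exist _ _ (HC (proj2_sig u) Hs)), (exist _ _ (HC (proj2_sig u) Hd)).
  rewrite !class_pair; auto.
Qed.

Lemma class_app f x y : app f x y <-> imem (iop (proj1_sig x) (proj1_sig y)) (proj1_sig f).
Proof.
split.
- intros (u & Hu & E); apply class_opair in E; rewrite <- E; exact Hu.
- intro H; exists (exist _ _ (HC (proj2_sig f) H)); split; [exact H|].
  apply class_opair; reflexivity.
Qed.

(** A tree representing the set indexes its elements by its branching type, and transitivity keeps
    these elements in the class. *)
Lemma class_small x : exists (I : Type) (f : I -> N), forall y, y ∈ x -> exists i, y = f i.
Proof.
destruct x as [x Hx]; destruct (iset_repr x) as [[I c] ->].
assert (K : forall i, C (iset_of (c i))).
{ intro i; apply (HC Hx), imem_of; eauto. }
exists I, (fun i => exist _ (iset_of (c i)) (K i)).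
intros [y Hy] H; apply imem_of in H; destruct H as [i E]; exists i.
apply class_eq; exact E.
Qed.

End TransitiveClass.

(** * The symmetric extension and its set of sequences *)

Section SymmetricExtension.
Context {M : estruct} {gr : Ground M}.
Variable k : M.
Hypothesis kn : exists a0, a0 ∈ k.
Variable G : M -> Prop.
Hypothesis HG : generic om k G.
Notation cnd := (cond om k).
Notation hsn := (HS om k).
Notation pn := (pn k).
Notation val := (val G).
Notation N := (class_struct (sym_ext om k G)).
Let G1 : G emp := G_emp HG.

Lemma sym_ext_iff v : sym_ext om k G v <-> exists x, hsn x /\ v = val x.
Proof.
split; intros (x & H & E); exists x; (split; [exact H|]); apply eval_iff; exact E.
Qed.

Lemma sym_ext_transitive : transitive_class (sym_ext om k G).
Proof.
intros z v Hv Hz; apply sym_ext_iff in Hv; destruct Hv as (x & Hx & ->).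
apply in_val in Hz; destruct Hz as (y & p & H & _ & ->); apply sym_ext_iff.
exists y; split; [apply (HS_op Hx H)|reflexivity].
Qed.

Let T := sym_ext_transitive.

Definition nval x (H : hsn x) : N :=
  exist _ (val x) (proj2 (sym_ext_iff (val x)) (ex_intro _ x (conj H eq_refl))).

Lemma nval_repr (X : N) : exists x (H : hsn x), X = nval H.
Proof.
destruct X as [v Hv]; pose proof Hv as K; apply sym_ext_iff in K.
destruct K as (x & H & E); exists x, H; apply class_eq; exact E.
Qed.

Definition nchk x : N := nval (HS_chk kn x).

Lemma in_nchk x (z : N) : z ∈ nchk x <-> exists y, y ∈ x /\ z = nchk y.
Proof.
change (imem (proj1_sig z) (val (chk x)) <-> exists y, y ∈ x /\ z = nchk y).
rewrite (in_val_chk HG); split; intros (y & Hy & E); exists y; (split; [exact Hy|]).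
- apply class_eq; exact E.
- rewrite E; reflexivity.
Qed.

Lemma nchk_empty (z : N) : is_empty z <-> z = nchk emp.
Proof.
split.
- intro H; apply (class_ext T); intro y; split; intro K; [destruct (H y K)|].
  apply in_nchk in K; destruct K as (a & Ha & _); destruct (in_emp Ha).
- intros -> y K; apply in_nchk in K; destruct K as (a & Ha & _); destruct (in_emp Ha).
Qed.

Lemma nchk_succ x (y : N) : is_succ y (nchk x) <-> y = nchk (suc x).
Proof.
assert (W : forall z, z ∈ nchk (suc x) <-> z ∈ nchk x \/ z = nchk x).
{ intro z; rewrite !in_nchk; split.
  - intros (b & Hb & ->); apply in_suc in Hb; destruct Hb as [Hb| ->]; eauto.
  - intros [(b & Hb & ->)| ->]; [exists b|exists x]; rewrite in_suc; auto. }
split.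
- intro H; apply (class_ext T); intro z; now rewrite (H z), W.
- intros -> z; apply W.
Qed.

Lemma nchk_omega (z : N) : is_omega z <-> z = nchk om.
Proof.
assert (I : inductive_set (nchk om)).
{ split.
  - exists (nchk emp); split; [apply nchk_empty; auto|].
    apply in_nchk; exists emp; split; [exact (num_om 0)|auto].
  - intros y Hy; apply in_nchk in Hy; destruct Hy as (n & Hn & ->).
    exists (nchk (suc n)); split; [|apply nchk_succ; auto].
    apply in_nchk; exists (suc n); split; [|auto].
    apply in_om in Hn; destruct Hn as [m ->]; exact (num_om (S m)). }
assert (J : forall v : N, inductive_set v -> subset (nchk om) v).
{ intros v [(e & He & Hev) Hs] y Hy; apply in_nchk in Hy; destruct Hy as (n & Hn & ->).
  apply in_om in Hn; destruct Hn as [m ->]; induction m as [|m IH].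
  - apply nchk_empty in He; subst e; exact Hev.
  - destruct (Hs _ IH) as (y & Hy & E); apply nchk_succ in E; subst y; exact Hy. }
split.
- intros [I' J']; apply (class_ext T); intro y; split; intro K.
  + exact (J' _ I y K).
  + exact (J _ I' y K).
- intros ->; split; auto.
Qed.

(** The clause on least elements concerns all subsets in the extension, including those outside the
    ground model; minimal elements are supplied by well-foundedness of the ambient membership. *)
Lemma nchk_ord x : is_ord x -> is_ord (nchk x).
Proof.
intro O; pose proof O as O'; apply is_ord_iff in O'; destruct O' as [T1 T2].
split; [|split; [|split]].
- intros a b Ha Hb; apply in_nchk in Hb; destruct Hb as (j & Hj & ->).
  apply in_nchk in Ha; destruct Ha as (i & Hi & ->); apply in_nchk; exists i; eauto.
- intros a b c _ _ Hc Ha Hb; apply in_nchk in Hc; destruct Hc as (l & Hl & ->).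
  apply in_nchk in Hb; destruct Hb as (j & Hj & ->).
  apply in_nchk in Ha; destruct Ha as (i & Hi & ->); apply in_nchk; exists i.
  split; [exact (T2 l Hl _ _ Hj Hi)|auto].
- intros a b Ha Hb; apply in_nchk in Ha, Hb; destruct Ha as (i & Hi & ->), Hb as (j & Hj & ->).
  destruct (is_ord_total (is_ord_in O Hi) (is_ord_in O Hj)) as [K|[->|K]]; auto.
  + left; apply in_nchk; eauto.
  + right; right; apply in_nchk; eauto.
- intros b _ [y Hy].
  induction y as [y IH] using (well_founded_ind (@class_wf (sym_ext om k G))).
  destruct (classic (exists z, z ∈ b /\ z ∈ y)) as [(z & Hz & K)|L]; [exact (IH z K Hz)|].
  exists y; split; [exact Hy|]. intros z Hz K; apply L; eauto.
Qed.

Definition reals : N := nval (HS_reals_name kn).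
Definition sequences : N := nval (HS_seq_name kn).

Lemma in_reals (z : N) : z ∈ reals <-> exists a, a ∈ k /\ proj1_sig z = val (cn k a).
Proof. exact (in_val_reals HG (proj1_sig z)). Qed.

Definition ncn a (H : a ∈ k) : N := nval (HS_cn kn H).

Lemma ncn_reals a (H : a ∈ k) : ncn H ∈ reals.
Proof. apply in_reals; exists a; auto. Qed.

Lemma val_pn n a : val (pn n a) = iop (val (chk n)) (val (cn k a)).
Proof. apply (val_nop HG). Qed.

(** The omega of the extension is [nchk om], and each of its functions has a hereditarily symmetric
    name, to which [seq_name_complete] applies. *)
Lemma in_sequences (f : N) :
  f ∈ sequences <-> exists wN : N, is_omega wN /\ is_fun f wN reals.
Proof.
split.
- intro H; apply (seq_name_sound kn HG) in H; destruct H as [[F1 F2] F3].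
  exists (nchk om); split; [apply nchk_omega; auto|split].
  + intros u Hu; destruct (F3 _ Hu) as (n & a & Hn & Ha & E).
    exists (nchk n), (ncn Ha); split; [apply in_nchk; eauto|].
    split; [apply ncn_reals|]. apply (class_opair T); rewrite E; apply val_pn.
  + intros x Hx; apply in_nchk in Hx; destruct Hx as (n & Hn & ->).
    destruct (F1 n Hn) as (a & Ha & K).
    exists (ncn Ha); split.
    * apply (class_app T); simpl; rewrite <- val_pn; exact K.
    * intros y Hy; apply (class_app T) in Hy; destruct (F3 _ Hy) as (m & b & Hm & Hb & E).
      rewrite val_pn in E; apply iop_inj in E; destruct E as [E1 E2].
      apply (val_chk_inj HG) in E1; subst m; apply class_eq; simpl; rewrite E2.
      f_equal; f_equal; apply (F2 n); auto. rewrite val_pn, <- E2; exact Hy.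
- intros (wN & Hw & F1 & F2); apply nchk_omega in Hw; subst wN.
  destruct (nval_repr f) as (x & Hx & ->).
  apply (seq_name_complete kn HG Hx).
  + split.
    * intros n Hn; destruct (F2 (nchk n)) as (y & Hy & _); [apply in_nchk; eauto|].
      apply (class_app T) in Hy as K.
      destruct Hy as (u & Hu & E); destruct (F1 u Hu) as (n' & y' & _ & Hy' & E').
      apply (class_opair T) in E, E'; rewrite E in E'; apply iop_inj in E'; destruct E' as [_ E'].
      apply class_eq in E'; subst y'; apply in_reals in Hy'; destruct Hy' as (a & Ha & Ey).
      exists a; split; [exact Ha|]. rewrite val_pn, <- Ey; exact K.
    * intros n a b Hn Ha Hb Ka Kb; destruct (F2 (nchk n)) as (y & _ & U); [apply in_nchk; eauto|].
      rewrite val_pn in Ka, Kb.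
      assert (Ea : y = ncn Ha) by (apply U, (class_app T); exact Ka).
      assert (Eb : y = ncn Hb) by (apply U, (class_app T); exact Kb).
      rewrite Ea in Eb; apply (f_equal (@proj1_sig _ _)) in Eb.
      exact (val_cn_inj HG Ha Hb Eb).
  + intros z Hz; destruct (F1 (exist _ z (T (proj2_sig (nval Hx)) Hz)) Hz) as (n & c & Hn & Hc & E).
    apply (class_opair T) in E; simpl in E; apply in_nchk in Hn; destruct Hn as (m & Hm & ->).
    apply in_reals in Hc; destruct Hc as (a & Ha & Ec); exists m, a.
    rewrite val_pn, <- Ec; auto.
Qed.

Lemma svc_sequences : SVC sequences.
Proof.
intro X; destruct (nval_repr X) as (x & Hx & ->).
destruct (classic (exists v, imem v (val x))) as [[v0 Hv]|Em].
(* For an empty [X] there is no default value; ordinal, product and map are all taken empty. *)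
2:{ assert (Z : is_empty (nchk emp)) by (apply nchk_empty; auto).
  exists (nchk emp), (nchk emp), (nchk emp); split; [|split; [|split; [split|]]].
  - apply nchk_ord, is_ord_iff; split; [intros y z Hy|intros y Hy]; destruct (in_emp Hy).
  - intro u; split; [intro H; destruct (Z u H)|intros (a & b & _ & Hb & _); destruct (Z b Hb)].
  - intros u H; destruct (Z u H).
  - intros u H; destruct (Z u H).
  - intros y Hy; destruct Em; exists (proj1_sig y); exact Hy. }
(* An element of [X] supplies the default name [x0] with a condition [q0] in [G]; paired with a
   support of [x0] it is the initial element that [well_order] requires. *)
apply in_val in Hv; destruct Hv as (x0 & q0 & Hx0 & Gq0 & _).
destruct (HS_supp kn (proj1 (HS_op Hx Hx0))) as [a0 A0].
destruct (@well_order _ _ (supported k x) (op x0 a0)) as (eta & h & Oeta & Dh & h_in & h_onto).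
{ apply in_supported; eauto 6. }
pose (d := nval (@HS_prod_name _ _ _ kn eta)).
pose (e := nval (HS_graph_name kn Hx Hx0 eta Dh h_in)).
pose proof (fun u : N => in_val_graph Hx Hx0 eta Dh h_in HG (proj1_sig u)) as Ge.
exists (nchk eta), d, e; split; [exact (nchk_ord Oeta)|].
assert (Pd : forall u : N, u ∈ d <-> exists s b, s ∈ sequences /\ b ∈ nchk eta /\ is_opair u s b).
{ intro u; change (imem (proj1_sig u) (val (prod_name k eta)) <->
    exists s b, s ∈ sequences /\ b ∈ nchk eta /\ is_opair u s b).
  rewrite (in_val_prod eta HG); split.
  - intros (v & i & Hv & Hi & E).
    exists (exist _ v (T (proj2_sig sequences) Hv)), (nchk i).
    split; [exact Hv|split; [apply in_nchk; eauto|]]. apply (class_opair T); exact E.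
  - intros (s & b & Hs & Hb & E); apply (class_opair T) in E; apply in_nchk in Hb.
    destruct Hb as (i & Hi & ->); exists (proj1_sig s), i; auto. }
split; [exact Pd|].
assert (Ae : forall u y, app e u y <-> exists s i z p, s ∈ names k /\ i ∈ eta /\ G p /\
  ffun k p s /\ gval k x x0 h p s i z /\ proj1_sig u = iop (val s) (val (chk i)) /\
  proj1_sig y = val z).
{ intros u y; rewrite (class_app T); unfold e; simpl.
  rewrite (in_val_graph Hx Hx0 eta Dh h_in HG); split.
  - intros (s & i & z & p & H1 & H2 & H3 & H4 & H5 & E); apply iop_inj in E.
    destruct E; exists s, i, z, p; auto 8.
  - intros (s & i & z & p & H1 & H2 & H3 & H4 & H5 & -> & ->); exists s, i, z, p; auto 8. }
assert (Dn : forall s i p (u : N), s ∈ names k -> i ∈ eta -> G p -> ffun k p s ->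
  proj1_sig u = iop (val s) (val (chk i)) -> u ∈ d).
{ intros s i p u H1 H2 H3 H4 E; apply (in_val_prod eta HG); exists (val s), i.
  split; [apply (in_val_seq HG); eauto 6|auto]. }
split; [split|].
- intros u Hu; apply Ge in Hu; destruct Hu as (s & i & z & p & H1 & H2 & H3 & H4 & H5 & E).
  (* The argument of the map lies in the extension because it is an element of an element of the
     pair [u]. *)
  assert (Ku : imem (iup (iop (val s) (val (chk i))) (iop (val s) (val (chk i)))) (proj1_sig u)).
  { rewrite E; apply in_iup; auto. }
  assert (Kv : imem (iop (val s) (val (chk i))) (iup (iop (val s) (val (chk i))) (iop (val s) (val (chk i))))).
  { apply in_iup; auto. }
  pose (v := exist _ _ (T (T (proj2_sig u) Ku) Kv) : N).
  pose proof (gval_in Hx Hx0 h_in HG Gq0 H3 H5) as Hz.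
  pose (y := exist _ _ (T (proj2_sig (nval Hx)) Hz) : N).
  exists v, y; split; [apply (Dn s i p); auto|split; [exact Hz|]].
  apply (class_opair T); exact E.
- intros u Hu; apply Pd in Hu; destruct Hu as (s & b & Hs & Hb & E).
  apply (class_opair T) in E; apply in_nchk in Hb; destruct Hb as (i & Hi & ->).
  destruct (gval_total x x0 Dh HG Hs Hi) as (s' & z & p & H1 & H2 & H3 & H4 & H5).
  pose proof (gval_in Hx Hx0 h_in HG Gq0 H2 H4) as Hz.
  exists (exist _ _ (T (proj2_sig (nval Hx)) Hz)); split.
  + apply Ae; exists s', i, z, p; rewrite E, H5; auto 8.
  + intros y Hy; apply Ae in Hy; destruct Hy as (s2 & i2 & z2 & p2 & K1 & K2 & K3 & K4 & K5 & K6 & K7).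
    rewrite E in K6; apply iop_inj in K6; destruct K6 as [K6 K8].
    apply (val_chk_inj HG) in K8; subst i2; apply class_eq; simpl; rewrite K7.
    eapply (gval_unique kn Hx Hx0 h_in HG Gq0 H2 K3 H1 K1); eauto; congruence.
- intros y Hy; destruct (gval_onto kn x0 Hx h_in h_onto HG Hy)
    as (s & i & z & p & H1 & H2 & H3 & H4 & H5 & E).
  assert (Hu : imem (iop (val s) (val (chk i))) (proj1_sig d)).
  { apply (in_val_prod eta HG); exists (val s), i; split; [apply (in_val_seq HG); eauto 6|auto]. }
  exists (exist _ _ (T (proj2_sig d) Hu)); apply Ae; exists s, i, z, p; auto 8.
Qed.

End SymmetricExtension.

Theorem proposition3p27 :
  forall V : iset -> Prop,
  transitive_class V ->
  ZFC (class_struct V) ->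
  forall w k : class_struct V,
  is_omega w ->
  is_omega1 k ->
  forall G0 : class_struct V -> Prop,
  generic w k G0 ->
  let N := class_struct (sym_ext w k G0) in
  exists A S : N,
    (forall a : iset, imem a (proj1_sig A) <->
       exists alpha c : class_struct V,
         alpha ∈ k /\ is_cohen_name w k alpha c /\ eval G0 c a) /\
    (forall f : N, f ∈ S <-> exists wN : N, is_omega wN /\ is_fun f wN A) /\
    SVC S.
Proof.
intros V HV HZ w k Hw [_ [Hk _]] G HG.
assert (gr : Ground (class_struct V)).
{ split; [exact HZ|apply class_wf|exact (inhabits w)|apply (class_small HV)]. }
apply is_omega_iff in Hw; subst w.
(* An empty [k] would be countable, with the empty set as injection. *)
assert (kn : exists a0, a0 ∈ k).
{ apply NNPP; intro E; apply Hk; exists om, emp; split; [exact om_omega|].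
  split; [split|].
  - intros u Hu; destruct (in_emp Hu).
  - intros a Ha; destruct E; eauto.
  - intros a a' b H; apply app_iff in H; destruct (in_emp H). }
intro N; exists (reals kn G), (sequences kn G); split; [|split].
- intro a; unfold reals; simpl; rewrite (in_val_reals HG); split.
  + intros (b & Hb & ->); exists b, (cn k b); rewrite is_cohen_name_iff, eval_iff; auto.
  + intros (b & c & Hb & Hc & E); apply is_cohen_name_iff in Hc; apply eval_iff in E.
    subst; exists b; auto.
- apply (in_sequences kn HG).
- apply (svc_sequences kn HG).
Qed.
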